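(* Let $\alpha\in\mathbb{N}_0$ and $\beta>\frac12$. Let $\mathrm{K}_\alpha|_{D_r}$ be the integral operator on $L^2(D_r,\mu)$, $\mathrm{d}\mu=\frac1\pi e^{-|z|^2}\mathrm{d}m$, with kernel $K_\alpha(z,w)=L_\alpha(|z-w|^2)e^{z\bar w}$. Then, as $r\to\infty$, \[ S_\alpha^\beta(D_r):=\operatorname{Tr}\bigl[f_\beta(\mathrm{K}_\alpha|_{D_r})\bigr]=r\int_{\mathbb{R}}f_\beta(\Phi_\alpha(x))\,\mathrm{d}x+o(1), \] where $f_\beta(x)=\frac{\log(x^\beta+(1-x)^\beta)}{1-\beta}$ for $\beta\ne1$ and $f_1(x)=-x\log x-(1-x)\log(1-x)$, $x\in[0,1]$.
   Context: $D_r=\{|z|<r\}$; $L_\alpha(x)=\sum_{\ell=0}^\alpha\binom{\alpha}{\ell}\frac{(-x)^\ell}{\ell!}$. $H_\alpha$ is the degree-$\alpha$ Hermite polynomial orthonormal with respect to $e^{-x^2/2}/\sqrt{2\pi}$, $h_\alpha(x)^2=H_\alpha(x)^2e^{-x^2/2}/\sqrt{2\pi}$, and $\Phi_\alpha(x)=\int_x^\infty h_\alpha(t)^2\mathrm{d}t$. $f_\beta$ of the operator is defined by functional calculus (the operator is self-adjoint with spectrum in $[0,1]$). *)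

(* Defs.v *)
From HB Require Import structures.
From mathcomp Require Import all_boot all_order all_algebra.
From mathcomp Require Import all_classical all_reals all_analysis.
From mathcomp Require Import complex.
Set Implicit Arguments. Unset Strict Implicit. Unset Printing Implicit Defensive.
Import Order.TTheory GRing.Theory Num.Theory.
Import numFieldNormedType.Exports.
Local Open Scope classical_set_scope.
Local Open Scope ring_scope.
Local Open Scope complex_scope.

Section Defs.
Variable R : realType.
Local Notation C := R[i].

Definition plane := (@lebesgue_measure R \x @lebesgue_measure R)%E.

Definition disk (r : R) : set (R * R) := [set z | z.1 ^+ 2 + z.2 ^+ 2 < r ^+ 2].

Definition gauss (z : R * R) : R := expR (- (z.1 ^+ 2 + z.2 ^+ 2)) / pi.

Definition laguerre (a : nat) (x : R) : R :=
  \sum_(l < a.+1) 'C(a, l)%:R * (- x) ^+ l / (l`!)%:R.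

(* e^{z \bar w} for z = z.1 + i z.2, w = w.1 + i w.2 *)
Definition exp_zwbar (z w : R * R) : C :=
  let a := z.1 * w.1 + z.2 * w.2 in
  let b := z.2 * w.1 - z.1 * w.2 in
  (expR a * cos b) +i* (expR a * sin b).

Definition Kker (a : nat) (z w : R * R) : C :=
  (laguerre a ((z.1 - w.1) ^+ 2 + (z.2 - w.2) ^+ 2))%:C * exp_zwbar z w.

Definition cint (D : set (R * R)) (f : R * R -> C) : C :=
  (Rintegral plane D (fun w => complex.Re (f w)))
    +i* (Rintegral plane D (fun w => complex.Im (f w))).

Definition Kop (a : nat) (r : R) (g : R * R -> C) (z : R * R) : C :=
  cint (disk r) (fun w => Kker a z w * g w * (gauss w)%:C).

Definition inL2 (r : R) (g : R * R -> C) : Prop :=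
  [/\ measurable_fun (disk r) (fun w => complex.Re (g w)),
      measurable_fun (disk r) (fun w => complex.Im (g w)) &
      plane.-integrable (disk r)
        (fun w => ((complex.Re (g w) ^+ 2 + complex.Im (g w) ^+ 2) * gauss w)%:E)].

(* g lies in the eigenspace of K_alpha|_{D_r} for the eigenvalue l
   (equality in L^2(D_r, mu), i.e. mu-a.e. = m-a.e. on D_r) *)
Definition eigenfun (a : nat) (r l : R) (g : R * R -> C) : Prop :=
  inL2 r g /\ {ae plane, forall z, disk r z -> Kop a r g z = l%:C * g z}.

Definition L2_indep (r : R) (n : nat) (gs : 'I_n -> R * R -> C) : Prop :=
  forall c : 'I_n -> C,
    {ae plane, forall z, disk r z -> \sum_(i < n) c i * gs i z = 0} ->
    forall i, c i = 0.

Definition mult (a : nat) (r l : R) : \bar R :=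
  ereal_sup [set (n%:R)%:E | n in
    [set n : nat | exists gs : 'I_n -> R * R -> C,
       (forall i, eigenfun a r l (gs i)) /\ L2_indep r gs]].

Definition fbeta (b x : R) : R :=
  if b == 1 then - x * ln x - (1 - x) * ln (1 - x)
  else ln (x `^ b + (1 - x) `^ b) / (1 - b).

(* Tr f_beta(K_alpha|_{D_r}) = sum over nonzero eigenvalues (in ]0,1],
   the spectrum lying in [0,1]) of multiplicity * f_beta(eigenvalue);
   f_beta(0) = 0 so the eigenvalue 0 does not contribute *)
Definition S (a : nat) (b r : R) : \bar R :=
  (\esum_(l in [set x : R | 0 < x <= 1]%R) (mult a r l * (fbeta b l)%:E))%E.

(* probabilists' Hermite polynomials He_n via the three term recurrence:
   he2 n x = (He_n x, He_{n+1} x) *)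
Fixpoint he2 (n : nat) (x : R) : R * R :=
  match n with
  | 0 => (1, x)
  | k.+1 => let p := he2 k x in (p.2, x * p.2 - k.+1%:R * p.1)
  end.

(* H_alpha: orthonormal w.r.t. e^{-x^2/2}/sqrt(2 pi) *)
Definition hermite (a : nat) (x : R) : R := (he2 a x).1 / Num.sqrt (a`!)%:R.

Definition hsq (a : nat) (x : R) : R :=
  hermite a x ^+ 2 * expR (- (x ^+ 2) / 2) / Num.sqrt (2 * pi).

Definition Phi (a : nat) (x : R) : R :=
  Rintegral lebesgue_measure `[x, +oo[%classic (hsq a).

End Defs.

(* Main.v *)
(** The operator is diagonalised by the complex Hermite functions
    [Hf a k z = (zbar - d/dz)^a z^k]: expanding the exponential gives
    K_a(z,w) = sum_k H_k(z) conj(H_k(w)) / (a! k!), uniformly on compact sets, and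
    rotation invariance makes the H_k orthogonal on every centred disk.  Hence the
    nonzero eigenvalues, with multiplicity, are the numbers
    lam_k(r) = (1/(a! k!)) int_{D_r} |H_k|^2 dmu, and the trace is sum_k f(lam_k(r)).

    Radial integration of |H_k|^2 gives lam_k(r) in closed form: a Poisson(r^2) tail
    at k plus r times the Poisson weight times a sum of products of consecutive
    Charlier-type polynomials in x = (k - r^2)/r, which deform the Hermite polynomials
    with parameter 1/r.  A second order local limit theorem for the gamma density, in
    the coordinate X = 2(sqrt k - r), yields
    lam_k(r) = Phi_a(X) + (even function of X)/r + O(e^{-c X^2}/r^2).

    Comparing f(lam_k(r)) with r times the integral of f o Phi_a over the cell
    [(k - r^2)/r, (k + 1 - r^2)/r[, the difference, scaled by r, converges pointwise to
    an odd function (f o Phi_a is even, so its derivative is odd) and is dominated by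
    an exponential.  Dominated convergence therefore shows that the total error tends
    to the integral of an odd function, which is 0.  The hypothesis b > 1/2 enters
    because |f(p) - f(q)| is controlled only by |p - q| times q^(g-1) + (1-q)^(g-1)
    with g = min(b, 3/4), and the Gaussian decay of the error beats that of Phi^(g-1)
    exactly when g > 1/2. *)
Require Import Defs.
From HB Require Import structures.
From mathcomp Require Import all_boot all_order all_algebra.
From mathcomp Require Import all_classical all_reals all_analysis.
From mathcomp Require Import measurable_realfun complex ring lra.
Set Implicit Arguments. Unset Strict Implicit. Unset Printing Implicit Defensive.
Import Order.TTheory GRing.Theory Num.Theory.
Import numFieldNormedType.Exports.
Local Open Scope classical_set_scope.
Local Open Scope ring_scope.

(** * One-variable calculus *)

(** The coordinate [X = 2 (sqrt k - r)] is the variance stabilising one: in it the gamma density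
    obeys a Gaussian bound on its whole range. Where |X| is large compared with sqrt k, this bound
    is e^{-X^2/4} and not e^{-X^2/2}, so the errors of the eigenvalues decay at rates d < 1/4. As
    [Phi] has Gaussian rate 1/2, its power g - 1 grows at rate (1 - g)/2, and (1 - g)/2 < 1/4 reads
    g > 1/2.

    About r eigenvalues lie in the transition region and each differs from its limit profile by
    order 1/r. A first order comparison therefore leaves a bounded error; the 1/r terms have to be
    identified, and it is only their parity that removes them.

    The peak of the gamma density is normalised by its total mass: an estimate started at the left
    end, where the distribution function is 0, and one started at infinity, where it is 1, must
    agree in the middle.

    Integrals over the plane rest on two elementary facts: a rotation is a product of three shears,
    and in the variable |z|^2 an annulus has area proportional to its width. *)

Section Calculus.
Variable R : realType.
Implicit Types (f g : R -> R) (x y a b c d : R).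

(* A plain definition, so that [apply:] does not fire the instances of [is_derive]. *)
Definition is_der x (f : R -> R) d : Prop := is_derive x (1:R) f d.

Lemma is_der_cst c x : is_der x (fun _ : R => c) (0:R).
Proof. exact: is_derive_cst. Qed.
Lemma is_der_id x : is_der x (fun y : R => y) (1:R).
Proof. exact: is_derive_id. Qed.
Lemma is_der_add f g x c d : is_der x f c -> is_der x g d ->
  is_der x (fun y => f y + g y) (c + d).
Proof. by move=> hf hg; exact: (is_deriveD hf hg). Qed.
Lemma is_der_opp f x c : is_der x f c ->
  is_der x (fun y => - f y) (- c).
Proof. by move=> hf; exact: (is_deriveN hf). Qed.
Lemma is_der_mul f g x c d : is_der x f c -> is_der x g d ->
  is_der x (fun y => f y * g y) (f x * d + c * g x).
Proof.
move=> hf hg; have h := is_deriveM hf hg.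
by apply: (is_derive_eq h); rewrite /GRing.scale/= [g x * c]mulrC.
Qed.
Lemma is_der_comp f g x c d : is_der (g x) f c -> is_der x g d ->
  is_der x (fun y => f (g y)) (c * d).
Proof.
move=> hf hg; have h := is_derive1_comp hf hg.
exact: h.
Qed.
Lemma is_der_expR f x c : is_der x f c ->
  is_der x (fun y => expR (f y)) (expR (f x) * c).
Proof. by move=> h; apply: (@is_der_comp expR) => //; exact: is_derive_expR. Qed.
Lemma is_der_ln f x c : 0 < f x -> is_der x f c ->
  is_der x (fun y => ln (f y)) ((f x)^-1 * c).
Proof. by move=> f0 h; apply: (@is_der_comp (@ln R)) => //; exact: is_derive1_ln. Qed.
Lemma is_der_exp n f x c : is_der x f c ->
  is_der x (fun y => f y ^+ n) (n%:R * f x ^+ n.-1 * c).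
Proof.
move=> hf; have -> : (fun y => f y ^+ n) = f ^+ n by rewrite exprfctE.
exact: (is_deriveX n hf).
Qed.
Lemma is_der_inv f x c : f x != 0 -> is_der x f c ->
  is_der x (fun y => (f y)^-1) (- (f x) ^- 2 * c).
Proof. by move=> h0 h; exact: is_deriveV. Qed.
Lemma is_der_sum n (f : 'I_n -> R -> R) x (d : 'I_n -> R) :
  (forall i, is_der x (f i) (d i)) ->
  is_der x (fun y => \sum_(i < n) f i y) (\sum_(i < n) d i).
Proof.
move=> h; have -> : (fun y => \sum_(i < n) f i y) = (\sum_(i < n) f i).
  by apply/funext => y; rewrite fct_sumE.
exact: is_derive_sum.
Qed.
Lemma is_der_eq f x c d : is_der x f c -> c = d -> is_der x f d.
Proof. by move=> h <-. Qed.

End Calculus.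

Ltac der1 := first
  [ eassumption
  | apply: is_der_cst | apply: is_der_id | apply: is_der_add | apply: is_der_opp
  | apply: is_der_expR | apply: is_der_ln | apply: is_der_exp | apply: is_der_mul
  | apply: is_der_inv ].
Ltac der := apply: is_der_eq; [repeat der1 | try (rewrite /predn)].

Section Calculus2.
Variable R : realType.
Implicit Types (f g : R -> R) (x y a b c d : R).

Lemma derive_ge0_le f (f' : R -> R) a b : a <= b ->
  (forall x, a <= x <= b -> is_der x f (f' x)) ->
  (forall x, a <= x <= b -> 0 <= f' x) -> f a <= f b.
Proof.
move=> ab df f'0.
have [x xab e] : exists2 c, c \in `[a, b] & f b - f a = f' c * (b - a).
  apply: (MVT_segment ab) => [x|].
    by move=> xab; apply: df; move: xab; rewrite in_itv/= => /andP[? ?]; lra.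
  apply: derivable_within_continuous => x; rewrite in_itv/= => xab.
  by have [] := df _ xab.
rewrite -subr_ge0 e mulr_ge0 ?subr_ge0//; apply: f'0.
by move: xab; rewrite in_itv.
Qed.

(** Follows from the monotonicity of [g - f] and [g + f]. It does the work of integrating a bound on
    the derivative: whenever the majorant has an explicit primitive [g], no integral has to be
    formed. *)
Lemma derive_norm_le f (f' : R -> R) g (g' : R -> R) a b : a <= b ->
  (forall x, a <= x <= b -> is_der x f (f' x)) ->
  (forall x, a <= x <= b -> is_der x g (g' x)) ->
  (forall x, a <= x <= b -> `|f' x| <= g' x) -> `|f b - f a| <= g b - g a.
Proof.
move=> ab df dg fg; rewrite ler_norml; apply/andP; split.
  have := @derive_ge0_le (fun x => f x + g x) (fun x => f' x + g' x) a b ab.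
  have h x : a <= x <= b -> 0 <= f' x + g' x.
    by move=> /fg; rewrite ler_norml => /andP[? ?]; lra.
  move=> /(_ (fun x xab => is_der_add (df _ xab) (dg _ xab)) h); lra.
have := @derive_ge0_le (fun x => g x - f x) (fun x => g' x - f' x) a b ab.
have h x : a <= x <= b -> 0 <= g' x - f' x.
  by move=> /fg; rewrite ler_norml => /andP[? ?]; lra.
move=> /(_ (fun x xab => is_der_add (dg _ xab) (is_der_opp (df _ xab))) h); lra.
Qed.

End Calculus2.

(** * Local limit theorem for the gamma density *)

Section GammaDensity.
Variable R : realType.
Implicit Types (x y z A : R).

(** The maximum covers both signs of [x]. It is kept because the remainder is later multiplied by
    e^{-y^2/2}, and both e^{-y^2/2} and e^{-y^2/2 + e} lie below the same Gaussian. *)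
Lemma expR_taylor1 x : `|expR x - 1 - x| <= x ^+ 2 * Num.max 1 (expR x).
Proof.
have h1 : expR x * (1 - x) <= 1.
  have := expR_ge1Dx (- x); rewrite -(ler_pM2l (expR_gt0 x)) -expRD subrr expR0.
  by [].
have h2 := expR_ge1Dx x.
rewrite ger0_norm; last by lra.
have [x0|x0] := leP 0 x.
  have -> : Num.max 1 (expR x) = expR x by apply/max_idPr; lra.
  have : expR x - 1 <= x * expR x by lra.
  nra.
have -> : Num.max 1 (expR x) = 1 by apply/max_idPl; rewrite ltW// expR_lt1.
nra.
Qed.

Let is_derive_ln3 x : -1 < x -> is_der x
  (fun z => ln (1 + z) - z + z ^+ 2 / 2 - z ^+ 3 / 3) (- x ^+ 3 / (1 + x)).
Proof. move=> x0; der; first by lra. by field; lra. Qed.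

(** The coefficient of the quartic matches the range: adding z^4/2 turns the derivative into x^3 (1
    + 2 x) / (1 + x), which keeps the sign of [x] as long as x >= -1/2. *)
Lemma ln_taylor3 z : - (1/2) <= z ->
  - (z ^+ 4 / 2) <= ln (1 + z) - z + z ^+ 2 / 2 - z ^+ 3 / 3 <= 0.
Proof.
move=> z12.
pose v := fun z : R => ln (1 + z) - z + z ^+ 2 / 2 - z ^+ 3 / 3.
have v0 : v 0 = 0 by rewrite /v addr0 ln1 !expr0n/=; lra.
rewrite -/(v z).
have dv4 x : -1 < x -> is_der x (fun z => v z + z ^+ 4 / 2)
    (- x ^+ 3 / (1 + x) + 2 * x ^+ 3).
  move=> x1; have := is_derive_ln3 x1 => ?.
  by apply: is_der_add => //; der; field.
have [z0|z0] := leP 0 z; apply/andP; split.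
- have := @derive_ge0_le R (fun z => v z + z ^+ 4 / 2)
    (fun x => - x ^+ 3 / (1 + x) + 2 * x ^+ 3) 0 z z0.
  rewrite v0 => /(_ _ _) h; suff : 0 + 0 ^+ 4 / 2 <= v z + z ^+ 4 / 2 by rewrite expr0n/=; lra.
  apply: h => x /andP[x0 xz]; first by apply: dv4; lra.
  have -> : - x ^+ 3 / (1 + x) + 2 * x ^+ 3 = x ^+ 3 * (1 + 2 * x) / (1 + x).
    by field; lra.
  by rewrite divr_ge0 ?mulr_ge0 ?exprn_ge0//; lra.
- have := @derive_ge0_le R (fun z => - v z) (fun x => - (- x ^+ 3 / (1 + x))) 0 z z0.
  rewrite v0 => /(_ _ _) h; suff : - 0 <= - v z by lra.
  apply: h => x /andP[x0 xz]; first by apply: is_der_opp; apply: is_derive_ln3; lra.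
  by rewrite -mulNr opprK divr_ge0 ?exprn_ge0//; lra.
- have := @derive_ge0_le R (fun z => - (v z + z ^+ 4 / 2))
    (fun x => - (- x ^+ 3 / (1 + x) + 2 * x ^+ 3)) z 0 (ltW z0).
  rewrite v0 => /(_ _ _) h; suff : - (v z + z ^+ 4 / 2) <= - (0 + 0 ^+ 4 / 2) by rewrite expr0n/=; lra.
  apply: h => x /andP[zx x0]; first by apply: is_der_opp; apply: dv4; lra.
  have -> : - (- x ^+ 3 / (1 + x) + 2 * x ^+ 3) = (- x) * x ^+ 2 * (1 + 2 * x) / (1 + x).
    by field; lra.
  move: (sqr_ge0 x); move: (x ^+ 2) => q q0.
  by rewrite divr_ge0 ?mulr_ge0//; lra.
- have := @derive_ge0_le R v (fun x => - x ^+ 3 / (1 + x)) z 0 (ltW z0).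
  rewrite v0; apply => x /andP[zx x0]; first by apply: is_derive_ln3; lra.
  have -> : - x ^+ 3 = (- x) * x ^+ 2 by ring.
  move: (sqr_ge0 x); move: (x ^+ 2) => q q0.
  by rewrite divr_ge0 ?mulr_ge0//; lra.
Qed.

(** [expR (K ^+ 2 * gexp z)] is the ratio of the Poisson weight of index k = K^2 at t = K^2 (1 +
    z)^2 to its value at the peak t = k. *)
Definition gexp (z : R) := 2 * (ln (1 + z) - z) - z ^+ 2.

Lemma gexp_le z : -1 < z -> gexp z <= - z ^+ 2.
Proof. by move=> z1; have := le_ln1Dx z1; rewrite /gexp; lra. Qed.

(** The exponent is -y^2/2 + y^3/(12 K) + O(y^4/K^2), and the Jacobian 1 + y/(2 K) supplies the
    other first order term. The error keeps the rate 1/4, which is all that survives when y is large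
    compared with K. *)
Lemma gamma_density_approx (K y : R) : 1 <= K -> - (2 * K) < y ->
  `|(1 + y / (2 * K)) * expR (K ^+ 2 * gexp (y / (2 * K)))
    - expR (- (y ^+ 2 / 2)) * (1 + (y / 2 + y ^+ 3 / 12) / K)|
  <= 4 / K ^+ 2 * (1 + `|y|) ^+ 9 * expR (- (y ^+ 2 / 4)).
Proof.
move=> K1 yK; set z := y / (2 * K).
have K0 : 0 < K by lra.
have K20 : 0 < K ^+ 2 by rewrite exprn_gt0.
have ez : y = 2 * K * z by rewrite /z; field; lra.
have z1 : -1 < z by rewrite /z ltr_pdivlMr; lra.
set P := 1 + `|y|.
have P1 : 1 <= P by rewrite /P; have := normr_ge0 y; lra.
have yP : `|y| <= P by rewrite /P; lra.
have yXP n : (n <= 9)%N -> `|y| ^+ n <= P ^+ 9.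
  move=> n9; rewrite (le_trans (_ : _ <= P ^+ n))//.
    by rewrite lerXn2r ?nnegrE//; lra.
  by rewrite ler_weXn2l.
set G := expR (- (y ^+ 2 / 4)).
have G0 : 0 < G by exact: expR_gt0.
have eG : - (y ^+ 2 / 4) = - (K ^+ 2 * z ^+ 2) by rewrite ez; field.
have hE : expR (K ^+ 2 * gexp z) <= G.
  rewrite /G eG ler_expR; have := gexp_le z1; nra.
have hG2 : expR (- (y ^+ 2 / 2)) <= G.
  by rewrite /G ler_expR; have := sqr_ge0 y; lra.
have ceq : 4 / K ^+ 2 * P ^+ 9 * G = K ^- 2 * (4 * P ^+ 9 * G) by field; lra.
have [z12|z12] := leP (- (1/2)) z.
  pose l := ln (1 + z) - z + z ^+ 2 / 2.
  pose e := 2 * K ^+ 2 * l; pose e1 := y ^+ 3 / 12 / K.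
  have ee : K ^+ 2 * gexp z = - (y ^+ 2 / 2) + e by rewrite /e /l /gexp ez; field.
  have he : `|e - e1| <= K ^- 2 * (`|y| ^+ 4 / 16).
    have /andP[l1 l2] := ln_taylor3 z12.
    have -> : e - e1 = 2 * K ^+ 2 * (l - z ^+ 3 / 3).
      by rewrite /e /e1 ez; field; lra.
    have -> : K ^- 2 * (`|y| ^+ 4 / 16) = 2 * K ^+ 2 * (z ^+ 4 / 2).
      rewrite -normrX ger0_norm; last by rewrite (exprM y 2 2) sqr_ge0.
      by rewrite ez; field; lra.
    rewrite normrM ger0_norm; last by lra.
    rewrite ler_pM2l; last by lra.
    by rewrite ler_norml /l; lra.
  rewrite ee expRD.
  have -> : (1 + z) * (expR (- (y ^+ 2 / 2)) * expR e) -
     expR (- (y ^+ 2 / 2)) * (1 + (y / 2 + y ^+ 3 / 12) / K) =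
     (* Three second order remainders: of the exponential, of the exponent, and the product of the
        two first order terms. *)
     expR (- (y ^+ 2 / 2)) * ((1 + z) * (expR e - 1 - e) + ((1 + z) * (e - e1) + z * e1)).
    by rewrite /e1 ez; field; lra.
  have kk : K ^- 2 <= 1 by rewrite invf_le1//; nra.
  have ki : 0 < K ^- 2 by rewrite invr_gt0.
  have he2 : e ^+ 2 <= K ^- 2 * (2 / 144 * `|y| ^+ 6 + 2 / 256 * `|y| ^+ 8).
    have a1 : e1 ^+ 2 = K ^- 2 * (`|y| ^+ 6 / 144).
      rewrite -normrX ger0_norm; last by rewrite (exprM y 3 2) sqr_ge0.
      by rewrite /e1; field; lra.
    have a2 : (e - e1) ^+ 2 <= K ^- 2 * (`|y| ^+ 8 / 256).
      rewrite -real_normK ?num_real//.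
      have : `|e - e1| ^+ 2 <= (K ^- 2 * (`|y| ^+ 4 / 16)) ^+ 2.
        by rewrite lerXn2r// nnegrE ?normr_ge0// (le_trans _ he).
      move/le_trans; apply.
      have -> : (K ^- 2 * (`|y| ^+ 4 / 16)) ^+ 2 = K ^- 2 * (K ^- 2 * (`|y| ^+ 8 / 256)).
        by field; lra.
      by rewrite ler_pM2l// ler_piMl// divr_ge0// exprn_ge0.
    have : e ^+ 2 <= 2 * e1 ^+ 2 + 2 * (e - e1) ^+ 2 by have := sqr_ge0 (e - 2 * e1); lra.
    lra.
  have hz : `|z| <= `|y|.
    have -> : `|y| = 2 * K * `|z| by rewrite {1}ez normrM (@gtr0_norm _ (2 * K))//; lra.
    by rewrite ler_peMl ?normr_ge0//; lra.
  have hz1 : `|1 + z| <= P by rewrite (le_trans (ler_normD _ _))// normr1 /P; lra.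
  have PyP n : (n <= 8)%N -> P * `|y| ^+ n <= P ^+ 9.
    move=> n8; rewrite [leRHS]exprS ler_pM2l; last by lra.
    rewrite (le_trans (_ : _ <= P ^+ n))//.
      by rewrite lerXn2r ?nnegrE//; lra.
    by rewrite ler_weXn2l.
  set W := expR (- (y ^+ 2 / 2)); have W0 : 0 < W by exact: expR_gt0.
  have hA : W * `|(1 + z) * (expR e - 1 - e)| <= G * (P * e ^+ 2).
    have hW : W * Num.max 1 (expR e) <= G.
      case: (leP 1 (expR e)) => _; first by rewrite /W -expRD -ee.
      by rewrite mulr1.
    rewrite normrM.
    have := expR_taylor1 e; set U := `|expR _ - _ - _|; set m := Num.max _ _ in hW *.
    move=> hU; have U0 : 0 <= U by exact: normr_ge0.
    apply: (@le_trans _ _ (W * (P * (e ^+ 2 * m)))).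
      by rewrite ler_pM2l// ler_pM.
    have -> : W * (P * (e ^+ 2 * m)) = (W * m) * (P * e ^+ 2) by ring.
    by rewrite ler_wpM2r// mulr_ge0 ?sqr_ge0//; lra.
  have hA' : P * e ^+ 2 <= K ^- 2 * ((2 / 144 + 2 / 256) * P ^+ 9).
    apply: (@le_trans _ _ (P * (K ^- 2 * (2 / 144 * `|y| ^+ 6 + 2 / 256 * `|y| ^+ 8)))).
      by rewrite ler_pM2l//; lra.
    have -> : P * (K ^- 2 * (2 / 144 * `|y| ^+ 6 + 2 / 256 * `|y| ^+ 8)) =
      K ^- 2 * (2 / 144 * (P * `|y| ^+ 6) + 2 / 256 * (P * `|y| ^+ 8)) by ring.
    rewrite ler_pM2l//; have := PyP 6%N isT; have := PyP 8%N isT; lra.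
  have hB : `|(1 + z) * (e - e1)| <= K ^- 2 * (1 / 16 * P ^+ 9).
    rewrite normrM; apply: (@le_trans _ _ (P * (K ^- 2 * (`|y| ^+ 4 / 16)))).
      by rewrite ler_pM.
    have -> : P * (K ^- 2 * (`|y| ^+ 4 / 16)) = K ^- 2 * (1 / 16 * (P * `|y| ^+ 4)).
      by field; lra.
    by rewrite ler_pM2l//; have := PyP 4%N isT; lra.
  have hC : `|z * e1| <= K ^- 2 * (1 / 24 * P ^+ 9).
    have -> : `|z * e1| = K ^- 2 * (1 / 24 * `|y| ^+ 4).
      have -> : z * e1 = K ^- 2 * (1 / 24 * y ^+ 4) by rewrite /e1 /z; field; lra.
      by rewrite 2!normrM normrX (gtr0_norm ki) (@gtr0_norm _ (1 / 24))//; lra.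
    by rewrite ler_pM2l//; have := yXP 4%N isT; lra.
  rewrite normrM (gtr0_norm W0) ceq.
  apply: (@le_trans _ _ (W * `|(1 + z) * (expR e - 1 - e)| +
      W * (`|(1 + z) * (e - e1)| + `|z * e1|))).
    rewrite -mulrDr ler_pM2l//.
    by rewrite (le_trans (ler_normD _ _))// lerD2l ler_normD.
  have hBC : W * (`|(1 + z) * (e - e1)| + `|z * e1|) <=
      G * (K ^- 2 * ((1 / 16 + 1 / 24) * P ^+ 9)).
    apply: ler_pM; [exact: ltW|by rewrite addr_ge0|exact: hG2|].
    by set Q := P ^+ 9 in hB hC *; lra.
  have hAA : G * (P * e ^+ 2) <= G * (K ^- 2 * ((2 / 144 + 2 / 256) * P ^+ 9)).
    by rewrite ler_pM2l.
  have : 0 <= K ^- 2 * (P ^+ 9 * G).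
    apply: mulr_ge0; first exact: ltW.
    by apply: mulr_ge0; [apply: exprn_ge0; lra|exact: ltW].
  set Q := P ^+ 9 in hBC hAA *; lra.
(* For z < -1/2 one has y < -K. The two terms are bounded separately, and the factor 1/K^2 is paid
   for by y^2. *)
have A1 : 1 <= K ^- 2 * `|y| ^+ 2.
  rewrite mulrC ler_pdivlMr// mul1r; have : K <= `|y|.
    have : y < - K by rewrite ez; nra.
    by move=> h; rewrite ltr0_norm; lra.
  by move=> h; rewrite lerXn2r// nnegrE; lra.
have zn : -1 < z <= 0 by apply/andP; split => //; lra.
have hE2 : expR (K ^+ 2 * gexp z) <= G by [].
set W := expR (- (y ^+ 2 / 2)) in hG2 *.
have W0 : 0 < W by exact: expR_gt0.
have h1 : `|(1 + z) * expR (K ^+ 2 * gexp z)| <= G.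
  rewrite normrM (gtr0_norm (expR_gt0 _)); apply: (le_trans _ hE2).
  rewrite ler_piMl ?expR_ge0//.
  by rewrite ger0_norm; lra.
have h2 : `|W * (1 + (y / 2 + y ^+ 3 / 12) / K)| <= G * (1 + `|y| + `|y| ^+ 3).
  rewrite normrM (gtr0_norm W0) ler_pM//; first by lra.
  rewrite (le_trans (ler_normD _ _))// normr1 -addrA lerD2l normrM.
  have Ki : `|K^-1| <= 1 by rewrite gtr0_norm ?invr_gt0// invf_le1.
  apply: (@le_trans _ _ `|y / 2 + y ^+ 3 / 12|); first by rewrite ler_piMr.
  rewrite (le_trans (ler_normD _ _))// (normrM y) (normrM (y ^+ 3)) normrX.
  have := normr_ge0 y; have := exprn_ge0 3 (normr_ge0 y).
  by rewrite (@gtr0_norm _ 2^-1) ?(@gtr0_norm _ 12^-1); lra.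
rewrite ceq.
apply: (@le_trans _ _ (G * (2 + `|y| + `|y| ^+ 3))).
  by rewrite (le_trans (ler_normB _ _))//; lra.
apply: (@le_trans _ _ ((K ^- 2 * `|y| ^+ 2) * (G * (2 + `|y| + `|y| ^+ 3)))).
  rewrite ler_peMl//; apply: mulr_ge0; first exact: ltW.
  by have := normr_ge0 y; have := exprn_ge0 3 (normr_ge0 y); lra.
have -> : (K ^- 2 * `|y| ^+ 2) * (G * (2 + `|y| + `|y| ^+ 3)) =
   K ^- 2 * ((2 * `|y| ^+ 2 + `|y| ^+ 3 + `|y| ^+ 5) * G) by ring.
rewrite ler_pM2l ?invr_gt0// ler_pM2r//.
have := yXP 2%N isT; have := yXP 3%N isT; have := yXP 5%N isT.
lra.
Qed.
End GammaDensity.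

(** * Gaussian functions and the profile Phi *)

Section Gaussian.
Variable R : realType.
Implicit Types (x y : R).
Local Notation mu := (@lebesgue_measure R).

Definition gphi (x : R) : R := expR (- (x ^+ 2) / 2) / Num.sqrt (2 * pi).
Definition he (a : nat) (x : R) : R := (he2 a x).1.
(** The polynomial for which [Phi a = Phi 0 + gphi * hecor a]. *)
Definition hecor (a : nat) (x : R) : R :=
  \sum_(i < a) he i x * he i.+1 x / (i.+1)`!%:R.

Lemma sqrt2pi_gt0 : 0 < Num.sqrt (2 * pi) :> R.
Proof. by rewrite sqrtr_gt0 mulr_gt0 ?pi_gt0. Qed.

Lemma gphi_gt0 x : 0 < gphi x.
Proof. by rewrite divr_gt0 ?expR_gt0 ?sqrt2pi_gt0. Qed.

Lemma gphiN x : gphi (- x) = gphi x.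
Proof. by rewrite /gphi sqrrN. Qed.

Lemma is_der_gphi x : is_der x gphi (- x * gphi x).
Proof. by rewrite /gphi; der; field; rewrite gt_eqF// sqrt2pi_gt0. Qed.

Lemma he0 x : he 0 x = 1. Proof. by []. Qed.
Lemma he1 x : he 1 x = x. Proof. by []. Qed.
Lemma heSS a x : he a.+2 x = x * he a.+1 x - a.+1%:R * he a x.
Proof. by []. Qed.

Opaque he.

Lemma is_der_he a x : is_der x (he a.+1) (a.+1%:R * he a x).
Proof.
suff : is_der x (he a.+1) (a.+1%:R * he a x) /\
       is_der x (he a.+2) (a.+2%:R * he a.+1 x) by case.
elim: a => [|a [IH1 IH2]].
  split.
    have -> : he 1 = id by apply/funext => y; rewrite he1.
    by apply: is_der_eq (is_der_id _) _; rewrite he0 mulr1.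
  have -> : he 2 = (fun x => x * x - 1) by apply/funext => y; rewrite heSS he1 he0 !mul1r.
  by der; rewrite he1; ring.
split => //.
have -> : he a.+3 = (fun x => x * he a.+2 x - a.+2%:R * he a.+1 x).
  by apply/funext => y; rewrite heSS.
der; rewrite heSS -!(natr1 a.+2) -!(natr1 a.+1); ring.
Qed.

Lemma heN a x : he a (- x) = (-1) ^+ a * he a x.
Proof.
suff : he a (- x) = (-1) ^+ a * he a x /\ he a.+1 (- x) = (-1) ^+ a.+1 * he a.+1 x by case.
elim: a => [|a [IH1 IH2]]; first by split; rewrite ?he0 ?he1 ?expr0 ?expr1; ring.
split => //; rewrite !heSS IH1 IH2 !exprS; ring.
Qed.

Lemma hecorN a x : hecor a (- x) = - hecor a x.
Proof.
rewrite /hecor -sumrN; apply: eq_bigr => i _; rewrite !heN exprS.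
have -> : forall u v w : R, (-1) ^+ i * u * (-1 * (-1) ^+ i * v) * w =
    - (((-1) ^+ i) ^+ 2 * (u * v * w)) by move=> *; ring.
by rewrite sqrr_sign mul1r.
Qed.

Lemma hsqE a x : hsq a x = he a x ^+ 2 / a`!%:R * gphi x.
Proof.
rewrite /hsq /hermite -/(he a x) /gphi expr_div_n sqr_sqrtr ?ler0n//.
by rewrite !mulrA.
Qed.

Lemma hsqN a x : hsq a (- x) = hsq a x.
Proof. by rewrite !hsqE gphiN heN exprMn sqrr_sign mul1r. Qed.

Lemma hsq_ge0 a x : 0 <= hsq a x.
Proof.
by rewrite hsqE mulr_ge0 ?(ltW (gphi_gt0 _))// divr_ge0// ?sqr_ge0.
Qed.

(** Telescoping: by the recurrence, the derivative of gphi he_i he_{i+1} / (i+1)! is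
    [hsq i - hsq i.+1]. *)
Lemma is_der_gphi_hecor a x :
  is_der x (fun y => gphi y * hecor a y) (gphi x - hsq a x).
Proof.
elim: a => [|a IH].
  have -> : (fun y => gphi y * hecor 0 y) = (fun=> 0).
    by apply/funext => y; rewrite /hecor big_ord0 mulr0.
  apply: is_der_eq (is_der_cst _ _) _.
  by rewrite hsqE he0 expr1n fact0 invr1 !mul1r subrr.
have -> : (fun y => gphi y * hecor a.+1 y) = (fun y => gphi y * hecor a y +
    gphi y * (he a y * he a.+1 y) / (a.+1)`!%:R).
  by apply/funext => y; rewrite /hecor big_ord_recr/= mulrDr !mulrA.
have da : is_der x (fun y => he a y * he a.+1 y)
    (x * he a x * he a.+1 x + a.+1%:R * he a x ^+ 2 - he a.+1 x ^+ 2).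
  case: a {IH} => [|a].
    have -> : (fun y => he 0 y * he 1 y) = (fun y : R => y).
      by apply/funext => y; rewrite he0 he1 mul1r.
    by apply: is_der_eq (is_der_id _) _; rewrite he0 he1; ring.
  have h1 := is_der_he a x; have h2 := is_der_he a.+1 x.
  der; rewrite heSS; ring.
have dg := is_der_gphi x.
der; rewrite [hsq a.+1 x]hsqE [hsq a x]hsqE factS natrM.
have f0 : a`!%:R != 0 :> R by rewrite pnatr_eq0 -lt0n fact_gt0.
have : a.+1%:R != 0 :> R by rewrite pnatr_eq0.
move: (a`!%:R) f0 => f f0; move: (a.+1%:R) => u u0.
by field; rewrite u0 f0.
Qed.

Lemma continuous_of_der (f : R -> R) (f' : R -> R) :
  (forall x, is_der x f (f' x)) -> continuous f.
Proof.
move=> h x; apply/differentiable_continuous/derivable1_diffP.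
by have [] := h x.
Qed.

Lemma continuous_gphi : continuous gphi.
Proof. exact: (continuous_of_der (f' := fun x => - x * gphi x) is_der_gphi). Qed.

Lemma continuous_he a : continuous (he a).
Proof.
case: a => [|a]; first by rewrite (_ : he 0 = cst 1); [exact: cst_continuous|apply/funext => y; rewrite he0].
exact: (continuous_of_der (f' := fun x => a.+1%:R * he a x) (is_der_he a)).
Qed.

Lemma continuous_hsq a : continuous (@hsq R a).
Proof.
have -> : @hsq R a = (fun x => he a x ^+ 2 / a`!%:R * gphi x) by apply/funext => x; rewrite hsqE.
move=> x; apply: cvgM; last exact: continuous_gphi.
apply: cvgM; last exact: cvg_cst.
by apply: cvgM; exact: continuous_he.
Qed.

Lemma continuous_hecor a : continuous (hecor a).
Proof.
elim: a => [|a IH].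
  rewrite (_ : hecor 0 = cst 0); first exact: cst_continuous.
  by apply/funext => x; rewrite /hecor big_ord0.
rewrite (_ : hecor a.+1 = fun x => hecor a x + he a x * he a.+1 x / a.+1`!%:R); last first.
  by apply/funext => x; rewrite /hecor big_ord_recr.
move=> x; apply: cvgD; first exact: IH.
apply: cvgM; last exact: cvg_cst.
by apply: cvgM; exact: continuous_he.
Qed.

Lemma gphi_normal_pdf x : gphi x = normal_pdf 0 1 x.
Proof.
rewrite normal_pdfE ?oner_neq0// /normal_peak /normal_fun subr0 expr1n mul1r.
by rewrite /gphi mulrC mulr_natl.
Qed.

Lemma integrable_gphi D : measurable D -> mu.-integrable D (EFin \o gphi).
Proof.
move=> mD; apply: (@integrableS _ _ _ mu setT) => //.
have := @integrable_normal_pdf R 0 1.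
by congr (_.-integrable _ _); apply/funext => x/=; rewrite gphi_normal_pdf.
Qed.

Lemma hsq0 : @hsq R 0 = gphi.
Proof. by apply/funext => x; rewrite hsqE he0 expr1n fact0 invr1 !mul1r. Qed.

Definition gcdf x : R := \int[mu]_(t in `]-oo, x]) gphi t.

Lemma is_der_gcdf x : is_der x gcdf (gphi x).
Proof.
have x1 : x < x + 1 by rewrite ltrDl.
have [h1 h2] := @continuous_FTC1 R gphi -oo%O x (x + 1) x1
  (integrable_gphi (measurable_itv _)) (ltNyr _) (@continuous_gphi x).
by apply: DeriveDef; [exact: h1|rewrite -h2 derive1E].
Qed.

Lemma Phi0_gcdf x : Phi 0 x = 1 - gcdf x.
Proof.
rewrite /Phi hsq0 /gcdf.
rewrite -Rintegral_itv_obnd_cbnd; last exact: integrable_gphi.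
rewrite -(@Rintegral_itvB R gphi -oo%O +oo%O x)//; last exact: integrable_gphi.
rewrite set_itvE; congr (_ - _); rewrite /Rintegral.
rewrite -[RHS]/(fine 1%E) -(@integral_normal_pdf R 0 1).
by congr fine; apply: eq_integral => y _; rewrite gphi_normal_pdf.
Qed.

Lemma is_der_Phi0 x : is_der x (Phi 0) (- gphi x).
Proof.
have -> : Phi 0 = (fun y => 1 - gcdf y) by apply/funext => y; rewrite Phi0_gcdf.
by have := is_der_gcdf x; move=> h; der; ring.
Qed.

Lemma Phi0N x : Phi 0 (- x) = 1 - Phi 0 x.
Proof.
have -> : 1 - Phi 0 x = gcdf x by rewrite Phi0_gcdf; ring.
rewrite /Phi hsq0 /gcdf /Rintegral; congr fine.
rewrite -[X in `]-oo, X]]opprK ge0_integration_by_substitutionNy//.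
- by apply: eq_integral => y _ /=; rewrite gphiN.
- exact/continuous_subspaceT/continuous_gphi.
- by move=> y _; exact/ltW/gphi_gt0.
Qed.

Lemma Phi0_ge0 x : 0 <= Phi 0 x.
Proof. by apply: Rintegral_ge0 => y _; exact: hsq_ge0. Qed.

Lemma expR_sqr_cvg0 (c : R) : 0 < c -> expR (- (c * x ^+ 2)) @[x --> +oo] --> (0:R).
Proof.
move=> c0; apply: (@squeeze_cvgr _ _ _ _ (fun=> 0) (fun x => expR (- (c * x)))).
- near=> x; rewrite expR_ge0 ler_expR lerN2 ler_pM2l//= expr2 ler_peMl//.
- exact: cvg_cst.
- apply: (@cvg_comp _ _ _ (fun x => c * x) (fun x => expR (- x)) _ +oo).
    by apply: gt0_cvgMry => //; exact: cvg_id.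
  exact: cvgr_expR.
Unshelve. all: by end_near. Qed.

Lemma gphi_cvg0 : gphi x @[x --> +oo] --> (0:R).
Proof.
rewrite -[X in _ --> X](mul0r (Num.sqrt (2 * pi))^-1).
apply: cvgM; last exact: cvg_cst.
have := @expR_sqr_cvg0 (2^-1); rewrite invr_gt0 ltr0n => /(_ isT).
by apply: cvg_trans; apply: near_eq_cvg; near=> t; congr expR; ring.
Unshelve. all: by end_near. Qed.

(** Beyond 1 the density is at most t gphi(t), which has the primitive -gphi. *)
Lemma Phi0_le_gphi x : 1 <= x -> Phi 0 x <= gphi x.
Proof.
move=> x1; rewrite /Phi hsq0.
have E : (\int[mu]_(t in `[x, +oo[) (t * gphi t)%:E = (gphi x)%:E)%E.
  rewrite (@ge0_continuous_FTC2y _ _ (fun t => - gphi t) x 0).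
  - by rewrite -EFinB sub0r opprK.
  - by move=> t xt; rewrite mulr_ge0 ?(ltW (gphi_gt0 _))//; lra.
  - apply: continuous_subspaceT => t; apply: cvgM; first exact: cvg_id.
    exact: continuous_gphi.
  - by rewrite -[0]oppr0; apply: cvgN; exact: gphi_cvg0.
  - by move=> t _; have [] := is_der_opp (is_der_gphi t).
  - apply: cvg_at_right_filter; apply: cvgN; exact: continuous_gphi.
  - move=> t _; rewrite derive1E.
    by have [_ ->] := is_der_opp (is_der_gphi t); ring.
rewrite /Rintegral -[leRHS]/(fine (gphi x)%:E); apply: fine_le => //.
  by apply: integrable_fin_num => //; exact: integrable_gphi.
rewrite -E; apply: ge0_le_integral => //.
- by move=> t _; rewrite lee_fin; exact/ltW/gphi_gt0.
- apply/measurable_EFinP; apply: measurable_funTS.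
  by apply: continuous_measurable_fun; exact: continuous_gphi.
- apply/measurable_EFinP; apply: measurable_funTS; apply: continuous_measurable_fun => t.
  by apply: cvgM; [exact: cvg_id|exact: continuous_gphi].
- move=> t /=; rewrite in_itv/= andbT => xt; rewrite lee_fin.
  by rewrite ler_peMl ?(ltW (gphi_gt0 _))//; lra.
Qed.

Lemma Phi0_cvg0 : Phi 0 x @[x --> +oo] --> (0:R).
Proof.
apply: (@squeeze_cvgr _ _ _ _ (fun=> 0) gphi); last exact: gphi_cvg0.
- by near=> x; rewrite Phi0_ge0 Phi0_le_gphi.
- exact: cvg_cst.
Unshelve. all: by end_near. Qed.

(** With d = c/n, this is the n-th power of 1 + |x| <= (2 + 1/d)(1 + d x^2) <= (2 + 1/d) e^{d
    x^2}. *)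
Lemma poly_le_expR (n : nat) (c : R) : 0 < c ->
  exists2 C, 0 < C & forall x : R, (1 + `|x|) ^+ n <= C * expR (c * x ^+ 2).
Proof.
move=> c0; case: n => [|n].
  exists 1 => // x; rewrite expr0 mul1r -expR0 ler_expR.
  by rewrite mulr_ge0 ?sqr_ge0// ltW.
pose d := c / n.+1%:R; have d0 : 0 < d by rewrite divr_gt0.
exists ((2 + d^-1) ^+ n.+1); first by rewrite exprn_gt0// addr_gt0// invr_gt0.
move=> x.
have -> : c * x ^+ 2 = n.+1%:R * (d * x ^+ 2).
  by rewrite /d; field; rewrite addrC natr1 pnatr_eq0.
rewrite expRM_natl -exprMn; apply: lerXn2r; rewrite ?nnegrE.
- by rewrite addr_ge0.
- by rewrite mulr_ge0 ?expR_ge0// addr_ge0// invr_ge0 ltW.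
apply: (@le_trans _ _ ((2 + d^-1) * (1 + d * x ^+ 2))); last first.
  by rewrite ler_pM2l ?expR_ge1Dx// addr_gt0// invr_gt0.
have -> : (2 + d^-1) * (1 + d * x ^+ 2) = 2 + x ^+ 2 + (d^-1 + 2 * (d * x ^+ 2)).
  by field; rewrite gt_eqF.
have : 0 <= d^-1 + 2 * (d * x ^+ 2).
  rewrite addr_ge0 ?invr_ge0 ?(ltW d0)//.
  by apply: mulr_ge0 => //; apply: mulr_ge0; [exact: ltW|exact: sqr_ge0].
have -> : x ^+ 2 = `|x| ^+ 2 by rewrite real_normK// num_real.
have := sqr_ge0 (1 - `|x|); have := normr_ge0 x.
move: (d^-1 + _) => u; nra.
Qed.

End Gaussian.

(** * Uniformly polynomially bounded families *)

Section PolyBounded.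
Variables (R : realType) (I : Type) (P : I -> Prop).
Implicit Types f g : I -> R -> R.

(** The index [i] with its predicate [P] is there for the expansions in 1/r, whose bounds must hold
    for all e = 1/r in ]0, 1] at once. Bounds without a parameter use the index type [unit]. *)
Definition polyb f := exists C n, forall i x, P i -> `|f i x| <= C * (1 + `|x|) ^+ n.

Lemma polyb_cst (c : R) : polyb (fun _ _ => c).
Proof. by exists `|c|, 0%N => i x _; rewrite expr0 mulr1. Qed.

Lemma polyb_id : polyb (fun _ x => x).
Proof. by exists 1, 1%N => i x _; rewrite mul1r expr1 lerDr. Qed.

Lemma polyb_param (u : I -> R) : (forall i, P i -> `|u i| <= 1) -> polyb (fun i _ => u i).
Proof. by move=> u1; exists 1, 0%N => i x /u1; rewrite expr0 mulr1. Qed.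

Let powle (C D : R) (m n : nat) (x : R) : C <= D -> 0 <= D -> (m <= n)%N ->
  C * (1 + `|x|) ^+ m <= D * (1 + `|x|) ^+ n.
Proof.
move=> CD D0 mn; apply: (@le_trans _ _ (D * (1 + `|x|) ^+ m)).
  by rewrite ler_wpM2r// exprn_ge0// addr_ge0.
by rewrite ler_wpM2l// ler_weXn2l// lerDl.
Qed.

Lemma polyb_add f g : polyb f -> polyb g -> polyb (fun i x => f i x + g i x).
Proof.
move=> [C [m hf]] [D [n hg]]; exists (`|C| + `|D|), (maxn m n) => i x Pi.
rewrite (le_trans (ler_normD _ _))// mulrDl lerD//.
  by rewrite (le_trans (hf i x Pi))// powle ?ler_norm ?leq_maxl.
by rewrite (le_trans (hg i x Pi))// powle ?ler_norm ?leq_maxr.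
Qed.

Lemma polyb_opp f : polyb f -> polyb (fun i x => - f i x).
Proof. by move=> [C [m hf]]; exists C, m => i x Pi; rewrite normrN hf. Qed.

Lemma polyb_mul f g : polyb f -> polyb g -> polyb (fun i x => f i x * g i x).
Proof.
move=> [C [m hf]] [D [n hg]]; exists (C * D), (m + n)%N => i x Pi.
by rewrite normrM exprD mulrACA ler_pM// ?hf ?hg.
Qed.

Lemma polyb_exp f n : polyb f -> polyb (fun i x => f i x ^+ n).
Proof.
move=> hf; elim: n => [|n IH].
  by rewrite (_ : (fun _ _ => _) = (fun _ _ => 1)); [exact: polyb_cst|].
by rewrite (_ : (fun _ _ => _) = (fun i x => f i x * f i x ^+ n));
  [exact: polyb_mul|apply/funext => i; apply/funext => x; rewrite exprS].
Qed.

Lemma polyb_sum n (f : 'I_n -> I -> R -> R) : (forall j, polyb (f j)) ->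
  polyb (fun i x => \sum_(j < n) f j i x).
Proof.
move=> hf; elim: n f hf => [|n IH] f hf.
  rewrite (_ : (fun _ _ => _) = (fun _ _ => 0)); first exact: polyb_cst.
  by apply/funext => i; apply/funext => x; rewrite big_ord0.
rewrite (_ : (fun _ _ => _) = (fun i x => \sum_(j < n) f (widen_ord (leqnSn n) j) i x +
   f ord_max i x)).
  by apply: polyb_add => //; exact: (IH (fun j => f (widen_ord (leqnSn n) j))).
by apply/funext => i; apply/funext => x; rewrite big_ord_recr.
Qed.

Lemma polyb_gauss f (c d : R) : polyb f -> d < c ->
  exists2 C, 0 < C & forall i x, P i ->
    `|f i x| * expR (- (c * x ^+ 2)) <= C * expR (- (d * x ^+ 2)).
Proof.
move=> [A [n hA]] dc; have [C C0 hC] := @poly_le_expR R n _ (ltac:(rewrite subr_gt0; exact: dc) : 0 < c - d).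
exists (`|A| * C + 1); first by rewrite ltr_wpDl// mulr_ge0// ltW.
move=> i x Pi; have := hA i x Pi => h.
apply: (@le_trans _ _ (`|A| * (C * expR ((c - d) * x ^+ 2)) * expR (- (c * x ^+ 2)))).
  rewrite ler_wpM2r ?expR_ge0// (le_trans h)// (le_trans _ (ler_wpM2l _ (hC x)))//.
  by rewrite ler_wpM2r ?ler_norm// exprn_ge0// addr_ge0.
rewrite -!mulrA -expRD.
have -> : (c - d) * x ^+ 2 - c * x ^+ 2 = - (d * x ^+ 2) by ring.
by rewrite mulrA mulrDl lerDl mul1r expR_ge0.
Qed.

End PolyBounded.

(** * The profile Phi_a: reflection and two-sided tail bounds *)

Section PhiA.
Variable R : realType.
Implicit Types (x y : R).
Local Notation mu := (@lebesgue_measure R).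

Lemma polyb_he I (P : I -> Prop) a : polyb P (fun _ (x : R) => he a x).
Proof.
suff : polyb P (fun _ (x : R) => he a x) /\ polyb P (fun _ (x : R) => he a.+1 x) by case.
elim: a => [|a [IH1 IH2]].
  by split; [exact: polyb_cst|exact: polyb_id].
split => //; apply: polyb_add; first by apply: polyb_mul => //; exact: polyb_id.
by apply: polyb_opp; apply: polyb_mul => //; exact: polyb_cst.
Qed.

Lemma polyb_hecor I (P : I -> Prop) a : polyb P (fun _ (x : R) => hecor a x).
Proof.
apply: polyb_sum => j; apply: polyb_mul; last exact: polyb_cst.
by apply: polyb_mul; exact: polyb_he.
Qed.

Lemma polyb_gphi_cvg0 (f : R -> R) : polyb (fun _ : unit => True) (fun _ => f) ->
  gphi x * f x @[x --> +oo] --> (0:R).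
Proof.
move=> hf; have [C C0 hC] := polyb_gauss hf (ltac:(lra) : 4^-1 < 2^-1 :> R).
have s0 := @sqrt2pi_gt0 R.
apply/norm_cvg0P.
apply: (@squeeze_cvgr _ _ _ _ (fun=> 0)
   (fun x => C / Num.sqrt (2 * pi) * expR (- (4^-1 * x ^+ 2)))).
- near=> x; rewrite normr_ge0/= normrM (gtr0_norm (gphi_gt0 x)) /gphi.
  have := hC tt x I.
  have -> : - (2^-1 * x ^+ 2) = - x ^+ 2 / 2 by ring.
  rewrite -(ler_pM2r (_ : 0 < (Num.sqrt (2 * pi))^-1)) ?invr_gt0// => h.
  by apply: le_trans (le_trans _ h) _; rewrite le_eqVlt; apply/orP; left; apply/eqP; ring.
- exact: cvg_cst.
- rewrite -[X in _ --> X](mulr0 (C / Num.sqrt (2 * pi))).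
  by apply: cvgM; [exact: cvg_cst|apply: expR_sqr_cvg0; rewrite invr_gt0].
Unshelve. all: by end_near. Qed.

(** The right-hand side tends to 0 at infinity and has derivative [- hsq a], so it is the tail
    integral. The derivative, the reflection formula and the limit of [Phi a] are read off from
    it. *)
Lemma PhiE a x : Phi a x = Phi 0 x + gphi x * hecor a x.
Proof.
pose F := fun y : R => - (Phi 0 y + gphi y * hecor a y).
have dF y : is_der y F (hsq a y).
  apply: is_der_eq; first apply: is_der_opp.
    by apply: is_der_add; [exact: is_der_Phi0|exact: is_der_gphi_hecor].
  ring.
rewrite [LHS](@Rintegral_ge0_continuous_FTC2y _ _ F x 0).
- by rewrite /F sub0r opprK.
- by move=> t _; exact: hsq_ge0.
- exact/continuous_subspaceT/continuous_hsq.
- rewrite /F -[X in _ --> X]oppr0; apply: cvgN; rewrite -[X in _ --> X]addr0.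
  apply: cvgD; first exact: Phi0_cvg0.
  exact/polyb_gphi_cvg0/polyb_hecor.
- by move=> t _; have [] := dF t.
- apply: cvg_at_right_filter; exact: (continuous_of_der dF).
- by move=> t _; rewrite derive1E; have [_ ->] := dF t.
Qed.

Lemma is_der_Phi a x : is_der x (Phi a) (- hsq a x).
Proof.
have -> : Phi a = fun x : R => Phi 0 x + gphi x * hecor a x by apply/funext => y; rewrite PhiE.
apply: is_der_eq; first by apply: is_der_add; [exact: is_der_Phi0|exact: is_der_gphi_hecor].
ring.
Qed.

Lemma PhiN a x : Phi a (- x) = 1 - Phi a x.
Proof. by rewrite !(PhiE a) Phi0N gphiN hecorN; ring. Qed.

Lemma Phi_ge0 a x : 0 <= Phi a x.
Proof. by apply: Rintegral_ge0 => y _; exact: hsq_ge0. Qed.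

Lemma Phi_le1 a x : Phi a x <= 1.
Proof. by have := Phi_ge0 a (- x); rewrite PhiN subr_ge0. Qed.

Lemma Phi_noninc a x y : x <= y -> Phi a y <= Phi a x.
Proof.
move=> xy; rewrite -lerN2.
apply: (@derive_ge0_le _ (fun x => - Phi a x) (hsq a)) => // z _; last exact: hsq_ge0.
by apply: is_der_eq (is_der_opp (is_der_Phi a z)) _; rewrite opprK.
Qed.

Lemma Phi_cvg0 a : Phi a x @[x --> +oo] --> (0:R).
Proof.
have -> : Phi a = fun x : R => Phi 0 x + gphi x * hecor a x by apply/funext => y; rewrite PhiE.
rewrite -[X in _ --> X]addr0; apply: cvgD; first exact: Phi0_cvg0.
exact/polyb_gphi_cvg0/polyb_hecor.
Qed.

(** For x >= a + 1 the recurrence makes he_0(x), ..., he_{a+1}(x) a nondecreasing sequence. *)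
Lemma he_ge1 a x : a.+1%:R <= x -> 1 <= he a x.
Proof.
suff h b : b.+1%:R <= x -> 1 <= he b x /\ he b x <= he b.+1 x by move=> /h[].
elim: b => [|b IH] hx; first by rewrite he0 he1.
have [|h1 h2] := IH; first by rewrite (le_trans _ hx)// ler_nat.
split; first exact: le_trans h1 h2.
have hx' : b.+1%:R + 1 <= x by rewrite natr1.
rewrite heSS; move: (b.+1%:R) hx' (ler0n R b.+1) => u; nra.
Qed.

(** Barrier argument: beyond a + 1, where he_a >= 1, the function L(y) = c e^{-y^2/2 - y} satisfies
    (L - Phi_a)' >= 0 because (1 + y) e^{-y} <= 1, and L - Phi_a tends to 0. The Gaussian rate 1/2
    is kept without loss, as it decides how fast negative powers of [Phi a] may grow. *)
Lemma Phi_lower a : exists2 c : R, 0 < c & forall x, 0 <= x ->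
  c * expR (- (x ^+ 2 / 2) - x) <= Phi a x.
Proof.
pose c : R := (a`!%:R * Num.sqrt (2 * pi))^-1.
have s0 := @sqrt2pi_gt0 R.
have f0 : 0 < a`!%:R :> R by rewrite ltr0n fact_gt0.
have c0 : 0 < c by rewrite invr_gt0 mulr_gt0.
pose L := fun x : R => c * expR (- (x ^+ 2 / 2) - x).
have main x : a.+1%:R <= x -> L x <= Phi a x.
  move=> ax.
  have dD y : is_der y (fun y => L y - Phi a y) (- (y + 1) * L y + hsq a y).
    have h := is_der_Phi a y.
    by rewrite /L; der; field.
  have D0 : (fun y => L y - Phi a y) y @[y --> +oo] --> (0:R).
    rewrite -[X in _ --> X]subr0; apply: cvgB; last exact: Phi_cvg0.
    rewrite -[X in _ --> X](mulr0 c); apply: cvgM; first exact: cvg_cst.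
    apply: (@squeeze_cvgr _ _ _ _ (fun=> 0) (fun x => expR (- (2^-1 * x ^+ 2)))).
    - near=> y; rewrite expR_ge0/= ler_expR.
      have : 0 <= y by near: y; exact: nbhs_pinfty_ge.
      by move=> ?; lra.
    - exact: cvg_cst.
    - by apply: expR_sqr_cvg0; rewrite invr_gt0.
  have mono y z : a.+1%:R <= y -> y <= z -> L y - Phi a y <= L z - Phi a z.
    move=> ay yz.
    apply: (@derive_ge0_le _ (fun y => L y - Phi a y)
      (fun y => - (y + 1) * L y + hsq a y)) => // t /andP[yt tz].
    have at1 : a.+1%:R <= t by lra.
    have t0 : 0 <= t by rewrite (le_trans _ at1).
    have := he_ge1 at1 => h1.
    have -> : L t = expR (- t) / a`!%:R * gphi t.
      by rewrite /L expRD /gphi -mulNr /c; field; rewrite !gt_eqF.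
    rewrite hsqE mulrA -mulrDl mulr_ge0 ?(ltW (gphi_gt0 _))//.
    rewrite mulrA -mulrDl; apply: divr_ge0; last exact: ltW.
    have : (t + 1) * expR (- t) <= 1.
      rewrite expRN ler_pdivrMr ?expR_gt0// mul1r addrC; exact: expR_ge1Dx.
    have := exprn_ege1 2 h1; lra.
  rewrite -subr_le0; apply: (cvgr_to_ge D0); near=> z.
  by apply: mono => //; near: z; exact: nbhs_pinfty_ge.
exists (Num.min c (L a.+1%:R)).
  by rewrite lt_min c0 mulr_gt0 ?expR_gt0.
move=> x x0; have [ax|xa] := leP a.+1%:R x.
  by rewrite (le_trans _ (main _ ax))// ler_pM2r ?expR_gt0// ge_min lexx.
apply: le_trans (Phi_noninc a (ltW xa)); apply: le_trans (main _ (lexx _)).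
rewrite -[leRHS]mulr1 ler_pM ?expR_ge0//.
- by rewrite le_min ltW//= mulr_ge0 ?expR_ge0// ltW.
- by rewrite ge_min lexx orbT.
- by rewrite expR_le1; have := sqr_ge0 x; lra.
Unshelve. all: by end_near. Qed.

Lemma hsq_gauss a (d : R) : d < 2^-1 ->
  exists2 C, 0 < C & forall x, hsq a x <= C * expR (- (d * x ^+ 2)).
Proof.
move=> d1; have hb : polyb (fun _ : unit => True) (fun _ (x : R) => he a x ^+ 2 / a`!%:R).
  by apply: polyb_mul; [apply: polyb_exp; exact: polyb_he|exact: polyb_cst].
have [C C0 hC] := polyb_gauss hb d1; have s0 := @sqrt2pi_gt0 R.
exists (C / Num.sqrt (2 * pi)); first by rewrite divr_gt0.
move=> x; have := hC tt x I; rewrite ger0_norm; last by rewrite divr_ge0// sqr_ge0.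
have -> : - (2^-1 * x ^+ 2) = - x ^+ 2 / 2 by ring.
rewrite -(ler_pM2r (_ : 0 < (Num.sqrt (2 * pi))^-1)) ?invr_gt0// => h.
rewrite hsqE /gphi; apply: le_trans (le_trans _ h) _.
  by rewrite !mulrA.
by rewrite le_eqVlt; apply/orP; left; apply/eqP; ring.
Qed.

(** The reverse barrier. A rate e strictly between d and 1/2 leaves room for a factor e^{-x}, by
    completing the square; then (Phi_a - L)' >= 0 for L = C B e^{-d x^2 - x}. *)
Lemma Phi_upper a (d : R) : 0 < d < 2^-1 ->
  exists2 C, 0 < C & forall x, 0 <= x -> Phi a x <= C * expR (- (d * x ^+ 2)).
Proof.
move=> /andP[d0 d1].
have [e /andP[de e1]] : exists e, d < e < 2^-1 by exists ((d + 2^-1) / 2); apply/andP; split; lra.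
have [C C0 hC] := hsq_gauss a e1.
pose B : R := expR (1 / (4 * (e - d))); have B0 : 0 < B by exact: expR_gt0.
have hB x : expR (- (e * x ^+ 2)) <= B * expR (- (d * x ^+ 2) - x).
  rewrite /B -expRD ler_expR; have ed : 0 < e - d by lra.
  rewrite -subr_ge0.
  have -> : 1 / (4 * (e - d)) + (- (d * x ^+ 2) - x) - - (e * x ^+ 2) =
     (e - d) * (x - 1 / (2 * (e - d))) ^+ 2 by field; lra.
  by rewrite mulr_ge0 ?sqr_ge0// ltW.
exists (C * B); first by rewrite mulr_gt0.
move=> x x0; pose L := fun x : R => C * B * expR (- (d * x ^+ 2) - x).
apply: (@le_trans _ _ (L x)); last first.
  by rewrite /L ler_pM2l ?mulr_gt0// ler_expR; lra.
have dD y : is_der y (fun y => Phi a y - L y) (- hsq a y + (2 * d * y + 1) * L y).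
  by have h := is_der_Phi a y; rewrite /L; der; ring.
have D0 : Phi a y - L y @[y --> +oo] --> (0:R).
  rewrite -[X in _ --> X]subr0; apply: cvgB; first exact: Phi_cvg0.
  rewrite -[X in _ --> X](mulr0 (C * B)); apply: cvgM; first exact: cvg_cst.
  apply: (@squeeze_cvgr _ _ _ _ (fun=> 0) (fun x => expR (- (d * x ^+ 2)))).
  - near=> y; rewrite expR_ge0/= ler_expR.
    have : 0 <= y by near: y; exact: nbhs_pinfty_ge.
    by move=> ?; lra.
  - exact: cvg_cst.
  - exact: expR_sqr_cvg0.
rewrite -subr_le0; apply: (cvgr_to_ge D0); near=> z.
have xz : x <= z by near: z; apply: nbhs_pinfty_ge; rewrite num_real.
apply: (@derive_ge0_le _ (fun y => Phi a y - L y)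
      (fun y => - hsq a y + (2 * d * y + 1) * L y)) => // t /andP[xt tz].
have h1 := hC t; have h2 := hB t.
have h3 : hsq a t <= L t.
  by apply: le_trans h1 _; rewrite /L -mulrA ler_pM2l.
have L0 : 0 <= L t by rewrite /L mulr_ge0 ?expR_ge0// mulr_ge0// ltW.
have : 0 <= 2 * d * t by apply: mulr_ge0; lra.
move: (2 * d * t) => u; nra.
Unshelve. all: by end_near. Qed.

End PhiA.

(** * Poisson weights and the gamma-normal comparison *)

Section Poisson.
Variable R : realType.
Implicit Types (t x y r : R).

Definition pois (k : nat) (t : R) : R := expR (- t) * t ^+ k / k`!%:R.
(** The probability that a Poisson variable of mean [t] exceeds [k]. As a function of [t] it is the
    gamma distribution function of shape k + 1, whence its derivative [pois k t]. *)
Definition ptail (k : nat) (t : R) : R := 1 - \sum_(j < k.+1) pois j t.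

Lemma fact_neq0 k : k`!%:R != 0 :> R.
Proof. by rewrite pnatr_eq0 -lt0n fact_gt0. Qed.

Lemma fact_gt0R k : 0 < k`!%:R :> R.
Proof. by rewrite ltr0n fact_gt0. Qed.

Lemma pois_ge0 k t : 0 <= t -> 0 <= pois k t.
Proof. by move=> t0; rewrite /pois divr_ge0// mulr_ge0 ?expR_ge0// exprn_ge0. Qed.

Lemma pois_gt0 k t : 0 < t -> 0 < pois k t.
Proof. by move=> t0; rewrite /pois divr_gt0 ?fact_gt0R// mulr_gt0 ?expR_gt0// exprn_gt0. Qed.

Lemma ptailS k : ptail k.+1 = fun t => ptail k t - pois k.+1 t.
Proof. by apply/funext => s; rewrite /ptail [in LHS]big_ord_recr/= opprD addrA. Qed.

Lemma is_der_ptail k t : is_der t (ptail k) (pois k t).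
Proof.
elim: k => [|k IH].
  have -> : ptail 0 = fun t : R => 1 - expR (- t).
    by apply/funext => s; rewrite /ptail big_ord_recr big_ord0/= /pois expr0 fact0; field.
  by rewrite /pois fact0 expr0; der; field.
rewrite ptailS.
have h : is_der t (pois k.+1) (pois k t - pois k.+1 t).
  rewrite /pois; der; rewrite factS natrM.
  have := fact_neq0 k; have : k.+1%:R != 0 :> R by rewrite pnatr_eq0.
  move: (k`!%:R) (k.+1%:R) => u v u0 v0; rewrite exprS.
  by field; rewrite u0 v0.
by der; ring.
Qed.

Lemma pois_le k t : 0 < t -> pois k t <= k.+1%:R / t.
Proof.
move=> t0; have := @expR_ge1Dxn R t k (ltW t0) => h.
have {h} h : t ^+ k.+1 / k.+1`!%:R <= expR t by lra.
have -> : pois k t = t ^+ k.+1 / k.+1`!%:R / expR t * (k.+1%:R / t).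
  rewrite /pois expRN factS natrM exprS.
  have := fact_neq0 k; have : k.+1%:R != 0 :> R by rewrite pnatr_eq0.
  have : expR t != 0 by rewrite gt_eqF// expR_gt0.
  move: (k`!%:R) (k.+1%:R) (expR t) => u v w w0 v0 u0.
  by field; rewrite u0 v0 w0 gt_eqF.
apply: ler_piMl; first by apply: divr_ge0 => //; exact: ltW.
by rewrite ler_pdivrMr ?expR_gt0// mul1r.
Qed.

Lemma pois_cvg0 k : pois k t @[t --> +oo] --> (0:R).
Proof.
apply: (@squeeze_cvgr _ _ _ _ (fun=> 0) (fun t => k.+1%:R * t^-1)).
- near=> t; have t0 : 0 < t by near: t; apply: nbhs_pinfty_gt; rewrite num_real.
  by rewrite pois_le// pois_ge0// ltW.
- exact: cvg_cst.
- rewrite -[X in _ --> X](mulr0 k.+1%:R); apply: cvgM; first exact: cvg_cst.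
  apply/gtr0_cvgV0; last exact: cvg_id.
  by near=> t; near: t; apply: nbhs_pinfty_gt; rewrite num_real.
Unshelve. all: by end_near. Qed.

Lemma ptail_cvg1 k : ptail k t @[t --> +oo] --> (1:R).
Proof.
elim: k => [|k IH]; last first.
  rewrite ptailS -[X in _ --> X]subr0.
  by apply: cvgB; [exact: IH|exact: pois_cvg0].
have -> : ptail 0 = fun t => 1 - pois 0 t.
  by apply/funext => s; rewrite /ptail big_ord_recr big_ord0/= add0r.
by rewrite -[X in _ --> X]subr0; apply: cvgB; [exact: cvg_cst|exact: pois_cvg0].
Qed.

Lemma ptail0 k : ptail k 0 = 0.
Proof.
rewrite /ptail big_ord_recl/= /pois oppr0 expR0 expr0 fact0 big1 => [|j _]; first by field.
by rewrite /bump/= expr0n/= mulr0 mul0r.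
Qed.

Lemma cvg_sqr_pinfty : x ^+ 2 @[x --> +oo] --> (+oo : set_system R).
Proof.
apply: (@ger_cvgy _ _ _ _ id); last exact: cvg_id.
near=> x; rewrite /= expr2 ler_peMl//; near: x; apply: nbhs_pinfty_ge; rewrite num_real//.
Unshelve. all: by end_near. Qed.

(** The primitive, vanishing at infinity, of the first order correction
    [gphi y * (y / 2 + y ^+ 3 / 12)] to the density. *)
Definition ecor (y : R) : R := - gphi y * (y ^+ 2 / 12 + 2 / 3).

Lemma is_der_ecor y : is_der y ecor (gphi y * (y / 2 + y ^+ 3 / 12)).
Proof. by rewrite /ecor; have h := is_der_gphi y; der; field. Qed.

Lemma ecorN y : ecor (- y) = ecor y.
Proof. by rewrite /ecor gphiN sqrrN. Qed.

(** Completing the square. On each half line e^{-d y^2 - |y|} is dominated by an exact derivative,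
    given by [is_der_gaussL] or [is_der_gaussR]; this is the purpose of the spare factor
    e^{-|y|}. *)
Lemma gauss_absorb (b d : R) : d < b ->
  exists2 C, 0 < C & forall y, expR (- (b * y ^+ 2)) <= C * expR (- (d * y ^+ 2) - `|y|).
Proof.
move=> db; exists (expR (1 / (4 * (b - d)))); first exact: expR_gt0.
move=> x; rewrite -expRD ler_expR; have ed : 0 < b - d by lra.
rewrite -subr_ge0 -[x ^+ 2]real_normK ?num_real//.
have -> : 1 / (4 * (b - d)) + (- (d * `|x| ^+ 2) - `|x|) - - (b * `|x| ^+ 2) =
   (b - d) * (`|x| - 1 / (2 * (b - d))) ^+ 2 by field; lra.
by rewrite mulr_ge0 ?sqr_ge0// ltW.
Qed.

Lemma gamma_density_gauss (d : R) : d < 4^-1 ->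
  exists2 C, 0 < C & forall K y, 1 <= K -> - (2 * K) < y ->
  `|(1 + y / (2 * K)) * expR (K ^+ 2 * gexp (y / (2 * K)))
    - expR (- (y ^+ 2 / 2)) * (1 + (y / 2 + y ^+ 3 / 12) / K)|
  <= C / K ^+ 2 * expR (- (d * y ^+ 2) - `|y|).
Proof.
move=> d1; have db : d < (d + 4^-1) / 2 by lra.
have b1 : (d + 4^-1) / 2 < 4^-1 by lra.
have [A A0 hA] := gauss_absorb db.
have hp : polyb (fun _ : unit => True) (fun _ (y : R) => 4 * (1 + `|y|) ^+ 9).
  by exists 4, 9%N => _ y _; rewrite ger0_norm// mulr_ge0// exprn_ge0// addr_ge0.
have [B B0 hB] := polyb_gauss hp b1.
exists (B * A); first by rewrite mulr_gt0.
move=> K y K1 yK; apply: (le_trans (gamma_density_approx K1 yK)).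
have K2 : 0 < K ^+ 2 by rewrite exprn_gt0//; lra.
have := hB tt y I; rewrite ger0_norm; last by rewrite mulr_ge0// exprn_ge0// addr_ge0.
have -> : - (4^-1 * y ^+ 2) = - (y ^+ 2 / 4) by ring.
have := hA y; rewrite -(ler_pM2l B0) => h2 h1; have := le_trans h1 h2.
rewrite -(ler_pM2l (_ : 0 < (K ^+ 2)^-1)) ?invr_gt0// => h.
apply: le_trans (le_trans _ h) _; rewrite le_eqVlt; apply/orP; left; apply/eqP; field; lra.
Qed.

Lemma der_pois_tail (k : nat) y : (0 < k)%N ->
  let K := Num.sqrt k%:R in
  is_der y (fun y => ptail k ((K + y / 2) ^+ 2)) ((K + y / 2) * pois k ((K + y / 2) ^+ 2)).
Proof.
move=> k0 K.
apply: is_der_eq.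
  apply: (@is_der_comp _ (ptail k) (fun y => (K + y / 2) ^+ 2)); first exact: is_der_ptail.
  by repeat der1.
by rewrite /predn; field.
Qed.

(** The left side is the derivative in y of the tail at t = (K + y/2)^2; the factor K + y/2 is the
    Jacobian. *)
Lemma pois_gexp (k : nat) y : (0 < k)%N ->
  let K := Num.sqrt k%:R in - (2 * K) < y ->
  (K + y / 2) * pois k ((K + y / 2) ^+ 2) =
  K * pois k k%:R * ((1 + y / (2 * K)) * expR (K ^+ 2 * gexp (y / (2 * K)))).
Proof.
move=> k0 K yK.
have K0 : 0 < K by rewrite sqrtr_gt0 ltr0n.
have K2 : K ^+ 2 = k%:R by rewrite sqr_sqrtr ?ler0n.
set z := y / (2 * K).
have z1 : 0 < 1 + z by rewrite /z -ltrBlDl sub0r ltr_pdivlMr; lra.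
have -> : K + y / 2 = K * (1 + z) by rewrite /z; field; lra.
have e1 : (1 + z) ^+ k ^+ 2 = expR (K ^+ 2 * (2 * ln (1 + z))).
  rewrite K2 expRM_natl -exprM mulnC exprM; congr (_ ^+ k).
  by rewrite -[in LHS](lnK z1) -expRM_natl.
rewrite /pois exprMn [(K ^+ 2 * _) ^+ k]exprMn -[((1 + z) ^+ 2) ^+ k]exprM mulnC exprM e1 K2.
rewrite /gexp.
have -> : k%:R * (2 * (ln (1 + z) - z) - z ^+ 2) =
   k%:R * (2 * ln (1 + z)) + (- (k%:R * (1 + z) ^+ 2) + k%:R) by ring.
rewrite !expRD [expR (- k%:R)]expRN.
have := fact_neq0 k; have : expR k%:R != 0 :> R by rewrite gt_eqF// expR_gt0.
by move: (expR k%:R) (k`!%:R) => u v u0 v0; field; rewrite u0 v0.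
Qed.

End Poisson.

(** * Comparison of the gamma and normal distribution functions *)

Section GammaNormal.
Variable R : realType.
Implicit Types (t x y r : R).

Lemma polyb_gauss_absorb (f : R -> R) (b d : R) : polyb (fun _ : unit => True) (fun _ => f) ->
  d < b -> exists2 C, 0 < C & forall y,
    `|f y| * expR (- (b * y ^+ 2)) <= C * expR (- (d * y ^+ 2) - `|y|).
Proof.
move=> hf db; have h1 : d < (d + b) / 2 by lra.
have h2 : (d + b) / 2 < b by lra.
have [A A0 hA] := gauss_absorb h1; have [B B0 hB] := polyb_gauss hf h2.
exists (B * A); first by rewrite mulr_gt0.
move=> y; apply: le_trans (hB tt y I) _.
by rewrite -[B * A * _]mulrA ler_pM2l.
Qed.

Lemma gphi_polyb_absorb (f : R -> R) (d : R) : polyb (fun _ : unit => True) (fun _ => f) ->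
  d < 2^-1 -> exists2 C, 0 < C & forall y,
    `|f y| * gphi y <= C * expR (- (d * y ^+ 2) - `|y|).
Proof.
move=> hf db; have [A A0 hA] := polyb_gauss_absorb hf db.
have s0 := @sqrt2pi_gt0 R.
exists (A / Num.sqrt (2 * pi)); first by rewrite divr_gt0.
move=> y; have := hA y.
have -> : - (2^-1 * y ^+ 2) = - y ^+ 2 / 2 by ring.
move=> h; rewrite /gphi [`|f y| * (_ / _)]mulrA [leRHS]mulrAC ler_pM2r ?invr_gt0//.
Qed.

Lemma gcdf_Phi0 y : gcdf y = Phi 0 (- y).
Proof. by rewrite Phi0N Phi0_gcdf opprB addrC subrK. Qed.

Lemma gcdf_cvg1 : gcdf x @[x --> +oo] --> (1:R).
Proof.
have -> : @gcdf R = fun x => 1 - Phi 0 x by apply/funext => x; rewrite Phi0_gcdf opprB addrC subrK.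
by rewrite -[X in _ --> X]subr0; apply: cvgB; [exact: cvg_cst|exact: Phi0_cvg0].
Qed.

Lemma ecor_cvg0 : ecor x @[x --> +oo] --> (0:R).
Proof.
have -> : @ecor R = fun x => gphi x * - (x ^+ 2 / 12 + 2 / 3).
  by apply/funext => x; rewrite /ecor mulNr mulrN.
apply: polyb_gphi_cvg0; apply: polyb_opp; apply: polyb_add; last exact: polyb_cst.
by apply: polyb_mul; [apply: polyb_exp; exact: polyb_id|exact: polyb_cst].
Qed.

Lemma is_der_gaussL (d y : R) : is_der y (fun y => expR (- (d * y ^+ 2) + y))
  ((1 - 2 * d * y) * expR (- (d * y ^+ 2) + y)).
Proof. by der; ring. Qed.

Lemma is_der_gaussR (d y : R) : is_der y (fun y => - expR (- (d * y ^+ 2) - y))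
  ((1 + 2 * d * y) * expR (- (d * y ^+ 2) - y)).
Proof. by der; ring. Qed.

Section Compare.
Variable d : R.
Hypotheses (d0 : 0 < d) (d1 : d < 4^-1).
Let G y : R := expR (- (d * y ^+ 2)).
Let Ga y : R := expR (- (d * y ^+ 2) - `|y|).

Let GaG y : Ga y <= G y.
Proof. by rewrite ler_expR; have := normr_ge0 y; lra. Qed.

Let polybT := (polyb (R := R) (fun _ : unit => True)).

Let dens (k : nat) y : R :=
  (Num.sqrt k%:R * pois k k%:R * Num.sqrt (2 * pi))^-1 *
    ((Num.sqrt k%:R + y / 2) * pois k ((Num.sqrt k%:R + y / 2) ^+ 2)) -
  gphi y * (1 + (y / 2 + y ^+ 3 / 12) / Num.sqrt k%:R).

Let dens_le : exists2 C, 0 < C & forall k y, (0 < k)%N -> - (2 * Num.sqrt k%:R) <= y ->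
  `|dens k y| <= C / k%:R * Ga y.
Proof.
have [C1 C10 hC1] := gamma_density_gauss d1.
have hp : polybT (fun _ y => y ^+ 4) by apply: polyb_exp; exact: polyb_id.
have d2 : d < 2^-1 by move: d1; lra.
have [C2 C20 hC2] := gphi_polyb_absorb hp d2.
have s0 := @sqrt2pi_gt0 R.
exists (C1 / Num.sqrt (2 * pi) + C2); first by rewrite addr_gt0// divr_gt0.
move=> k y k0; rewrite /dens; set K := Num.sqrt k%:R.
have K0 : 0 < K by rewrite sqrtr_gt0 ltr0n.
have K2 : K ^+ 2 = k%:R by rewrite sqr_sqrtr ?ler0n.
have K1 : 1 <= K by rewrite -[leLHS]sqrtr1 ler_sqrt ?ler1n// ltr0n.
have k0R : 0 < k%:R :> R by rewrite ltr0n.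
have Ga0 : 0 < Ga y by exact: expR_gt0.
rewrite le_eqVlt => /predU1P[<-|yK].
  (* At y = -2K the density vanishes, while [gexp] would involve ln 0. The Gaussian term, of size
     K^2, is bounded through y^4 = 16 K^4. *)
  rewrite (_ : K + - (2 * K) / 2 = 0); last by field.
  rewrite mul0r mulr0 sub0r normrN normrM (gtr0_norm (gphi_gt0 _)).
  have -> : 1 + (- (2 * K) / 2 + (- (2 * K)) ^+ 3 / 12) / K = - (2 / 3 * K ^+ 2).
    by field; lra.
  have := hC2 (- (2 * K)).
  rewrite (@ger0_norm _ ((- (2 * K)) ^+ 4)) ?exprn_even_ge0//.
  rewrite (normrN (2 / 3 * K ^+ 2)) (@ger0_norm _ (2 / 3 * K ^+ 2)); last by rewrite mulr_ge0// sqr_ge0.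
  rewrite -/(Ga _).
  have -> : (- (2 * K)) ^+ 4 = 16 * K ^+ 2 * K ^+ 2 by ring.
  rewrite K2 => h.
  apply: (@le_trans _ _ (C2 / k%:R * Ga (- (2 * K)))).
    rewrite [leRHS]mulrAC ler_pdivlMr//; apply: le_trans _ h.
    have := gphi_gt0 (- (2 * K)) => g0.
    have : 0 < k%:R * k%:R * gphi (- (2 * K)) by exact: mulr_gt0 (mulr_gt0 k0R k0R) g0.
    lra.
  rewrite ler_pM2r ?expR_gt0// ler_pM2r ?invr_gt0// lerDr.
  by rewrite divr_ge0// ltW.
rewrite pois_gexp// -/K.
have p0 : 0 < pois k k%:R :> R by apply: pois_gt0.
have -> : (K * pois k k%:R * Num.sqrt (2 * pi))^-1 *
    (K * pois k k%:R * ((1 + y / (2 * K)) * expR (K ^+ 2 * gexp (y / (2 * K))))) -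
    gphi y * (1 + (y / 2 + y ^+ 3 / 12) / K) =
    (Num.sqrt (2 * pi))^-1 * ((1 + y / (2 * K)) * expR (K ^+ 2 * gexp (y / (2 * K)))
    - expR (- (y ^+ 2 / 2)) * (1 + (y / 2 + y ^+ 3 / 12) / K)).
  rewrite /gphi mulNr.
  move: (expR _) (expR _) (pois k _) p0 (Num.sqrt _) s0 => u v p p0 s s0.
  by field; rewrite !gt_eqF.
rewrite normrM gtr0_norm ?invr_gt0//.
have := hC1 K y K1 yK.
rewrite -(ler_pM2l (_ : 0 < (Num.sqrt (2 * pi))^-1)) ?invr_gt0// K2 => h.
apply: le_trans h _; rewrite -/(Ga y) !mulrA ler_pM2r// ler_pM2r ?invr_gt0//.
by rewrite mulrC lerDl ltW.
Qed.

(** The prefactor c rescales the density to the value 1/sqrt(2 pi) at y = 0 and is not yet known to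
    be near 1. Estimates started at the left end, where the tail is 0, control [Delta]; estimates
    started at +oo, where it is 1, control [Delta - (c - 1)]. Their comparison at y = 0 forces c - 1
    = O(1/k). *)
Let Delta (k : nat) y : R :=
  (Num.sqrt k%:R * pois k k%:R * Num.sqrt (2 * pi))^-1 *
    ptail k ((Num.sqrt k%:R + y / 2) ^+ 2) - gcdf y - ecor y / Num.sqrt k%:R.

Let is_der_Delta k y : (0 < k)%N -> is_der y (Delta k) (dens k y).
Proof.
move=> k0; have h1 := der_pois_tail y k0; have h2 := is_der_gcdf y.
have h3 := is_der_ecor y; rewrite /= in h1.
rewrite /Delta /dens; apply: is_der_eq.
  apply: is_der_add; last by apply: is_der_opp; apply: is_der_mul h3 (is_der_cst _ _).
  apply: is_der_add; last exact: is_der_opp h2.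
  by apply: is_der_mul h1; exact: is_der_cst.
by cbv beta; ring.
Qed.

Let Gle x y : `|x| <= `|y| -> G y <= G x.
Proof.
move=> xy; rewrite ler_expR lerN2 ler_pM2l//.
by rewrite -[x ^+ 2]real_normK ?num_real// -[y ^+ 2]real_normK ?num_real// lerXn2r ?nnegrE.
Qed.

Let ecor_le : exists2 C, 0 < C & forall y, (1 + y ^+ 2) * `|ecor y| <= C * G y.
Proof.
have hp : polybT (fun _ y => (1 + y ^+ 2) * (y ^+ 2 / 12 + 2 / 3)).
  apply: polyb_mul; apply: polyb_add; try exact: polyb_cst.
    by apply: polyb_exp; exact: polyb_id.
  by apply: polyb_mul; [apply: polyb_exp; exact: polyb_id|exact: polyb_cst].
have d2 : d < 2^-1 by move: d1; lra.
have [C C0 hC] := gphi_polyb_absorb hp d2.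
exists C => // y; have := hC y; rewrite -/(Ga y) => h.
apply: le_trans (le_trans _ h) _; last by rewrite ler_pM2l.
rewrite /ecor mulNr normrN (normrM (gphi y)) (normrM (1 + y ^+ 2)) (gtr0_norm (gphi_gt0 y)).
rewrite (@ger0_norm _ (1 + _)) ?addr_ge0 ?sqr_ge0//.
by rewrite le_eqVlt; apply/orP; left; apply/eqP; ring.
Qed.

Let Phi0_le : exists2 C, 0 < C & forall y, 0 <= y -> (1 + y ^+ 2) * Phi 0 y <= C * G y.
Proof.
have b0 : 0 < (d + 2^-1) / 2 < 2^-1 by apply/andP; split; move: d0 d1; lra.
have [A A0 hA] := Phi_upper 0 b0.
have hp : polybT (fun _ y => 1 + y ^+ 2).
  by apply: polyb_add; [exact: polyb_cst|apply: polyb_exp; exact: polyb_id].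
have db : d < (d + 2^-1) / 2 by move: d0 d1; lra.
have [B B0 hB] := polyb_gauss hp db.
exists (A * B); first by rewrite mulr_gt0.
move=> y y0; have := hB tt y I; rewrite ger0_norm ?addr_ge0 ?sqr_ge0// -/(G y).
rewrite -(ler_pM2l A0) -[A * B * _]mulrA => h; apply: le_trans _ h.
rewrite [leRHS]mulrCA ler_wpM2l ?addr_ge0 ?sqr_ge0//; exact: hA.
Qed.

Let lin_le : exists2 C, 0 < C & forall K y, 1 <= K ->
  `|gphi y * (1 + (y / 2 + y ^+ 3 / 12) / K)| <= C * G y.
Proof.
have hp : polybT (fun _ y => 1 + (1 + `|y|) ^+ 3).
  apply: polyb_add; first exact: polyb_cst.
  by exists 1, 3%N => _ y _; rewrite mul1r (@ger0_norm _ ((1 + `|y|) ^+ 3))// exprn_ge0// addr_ge0.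
have d2 : d < 2^-1 by move: d1; lra.
have [C C0 hC] := gphi_polyb_absorb hp d2.
exists C => // K y K1; have := hC y; rewrite -/(Ga y) => h.
apply: le_trans (le_trans _ h) _; last by rewrite ler_pM2l.
have y0 := normr_ge0 y.
rewrite normrM (gtr0_norm (gphi_gt0 y)) mulrC ler_pM2r ?gphi_gt0//.
rewrite (@ger0_norm _ (1 + (1 + `|y|) ^+ 3)); last by rewrite addr_ge0// exprn_ge0// addr_ge0.
rewrite (le_trans (ler_normD _ _))// normr1 lerD2l normrM.
have Ki : `|K^-1| <= 1.
  by rewrite gtr0_norm ?invr_gt0 ?invf_le1//; lra.
apply: (@le_trans _ _ `|y / 2 + y ^+ 3 / 12|); first by rewrite ler_piMr.
rewrite (le_trans (ler_normD _ _))// (normrM y) (normrM (y ^+ 3)) normrX.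
rewrite (@gtr0_norm _ 2^-1) ?invr_gt0// (@gtr0_norm _ 12^-1) ?invr_gt0//.
have := exprn_ge0 3 y0; have := exprn_ge0 2 y0.
have -> : (1 + `|y|) ^+ 3 = 1 + 3 * `|y| + 3 * `|y| ^+ 2 + `|y| ^+ 3 by ring.
lra.
Qed.

Let Delta_left : exists2 C, 0 < C & forall k y, (0 < k)%N ->
  - (2 * Num.sqrt k%:R) <= y <= 0 -> `|Delta k y| <= C / k%:R * G y.
Proof.
have [C1 C10 hC1] := dens_le.
have [C2 C20 hC2] := ecor_le; have [C3 C30 hC3] := Phi0_le.
exists (C1 + C2 + C3); first by rewrite !addr_gt0.
move=> k y k0 /andP[Ky y0]; have := Ky; set K := Num.sqrt k%:R => Ky'.
have K0 : 0 < K by rewrite sqrtr_gt0 ltr0n.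
have K2 : K ^+ 2 = k%:R by rewrite sqr_sqrtr ?ler0n.
have K1 : 1 <= K by rewrite -[leLHS]sqrtr1 ler_sqrt ?ler1n// ltr0n.
have k0R : 0 < k%:R :> R by rewrite ltr0n.
have h1 : `|Delta k y - Delta k (- (2 * K))| <= C1 / k%:R * G y.
  pose g y := C1 / k%:R * expR (- (d * y ^+ 2) + y).
  have gG : g y - g (- (2 * K)) <= C1 / k%:R * G y.
    have : g y <= C1 / k%:R * G y.
      by rewrite ler_pM2l ?divr_gt0// ler_expR; lra.
    have : 0 <= g (- (2 * K)) by rewrite mulr_ge0 ?expR_ge0// divr_ge0// ltW.
    lra.
  apply: le_trans _ gG.
  apply: (@derive_norm_le _ (Delta k) (dens k) g
    (fun y => C1 / k%:R * ((1 - 2 * d * y) * expR (- (d * y ^+ 2) + y)))).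
  - by [].
  - by move=> x _; exact: is_der_Delta.
  - move=> x _; have h := is_der_gaussL d x; rewrite /g; apply: is_der_eq.
      by apply: is_der_mul h; exact: is_der_cst.
    by cbv beta; ring.
  - move=> x /andP[Kx xy]; apply: le_trans (hC1 k x k0 Kx) _.
    rewrite ler_pM2l ?divr_gt0// /Ga ler0_norm ?opprK; last by lra.
    rewrite ler_peMl ?expR_ge0//.
    have : 0 <= d * (- x) by apply: mulr_ge0; [exact: ltW|lra].
    by lra.
have h2 : `|Delta k (- (2 * K))| <= (C2 + C3) / k%:R * G (- (2 * K)).
  have -> : (C2 + C3) / k%:R * G (- (2 * K)) = C3 / k%:R * G (2 * K) + C2 / k%:R * G (2 * K).
    by rewrite /G sqrrN; ring.
  rewrite /Delta -/K (_ : K + - (2 * K) / 2 = 0); last by field.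
  rewrite expr0n/= ptail0 mulr0 sub0r gcdf_Phi0 opprK ecorN.
  rewrite -opprD normrN (le_trans (ler_normD _ _))// lerD//; last first.
    rewrite normrM (@ger0_norm _ K^-1) ?invr_ge0 ?(ltW K0)//.
    rewrite [leRHS]mulrAC ler_pdivlMr// -K2.
    apply: le_trans _ (hC2 (2 * K)).
    have e0 := normr_ge0 (ecor (2 * K)).
    have -> : `|ecor (2 * K)| / K * K ^+ 2 = K * `|ecor (2 * K)| by field; lra.
    rewrite ler_wpM2r//.
    have := sqr_ge0 (K - 1); have := sqr_ge0 K; lra.
  rewrite ger0_norm ?Phi0_ge0// [leRHS]mulrAC ler_pdivlMr// -K2.
  have K20 : 0 <= 2 * K by lra.
  apply: le_trans _ (hC3 (2 * K) K20).
  rewrite mulrC ler_wpM2r ?Phi0_ge0//.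
  have := sqr_ge0 K; lra.
have h3 : G (- (2 * K)) <= G y.
  by apply: Gle; rewrite ler0_norm// ler0_norm; lra.
have h4 : (C2 + C3) / k%:R * G (- (2 * K)) <= (C2 + C3) / k%:R * G y.
  by rewrite ler_pM2l// divr_gt0// addr_gt0.
have := ler_normD (Delta k y - Delta k (- (2 * K))) (Delta k (- (2 * K))).
rewrite subrK => h5; apply: le_trans h5 _.
have -> : (C1 + C2 + C3) / k%:R * G y = C1 / k%:R * G y + (C2 + C3) / k%:R * G y by ring.
lra.
Qed.

Let Delta_right : exists2 C, 0 < C & forall k y, (0 < k)%N -> 0 <= y ->
  `|Delta k y - ((Num.sqrt k%:R * pois k k%:R * Num.sqrt (2 * pi))^-1 - 1)| <= C / k%:R * G y.
Proof.
have [C1 C10 hC1] := dens_le.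
exists C1 => // k y k0 y0; set K := Num.sqrt k%:R; set c := (_)^-1.
have K0 : 0 < K by rewrite sqrtr_gt0 ltr0n.
have k0R : 0 < k%:R :> R by rewrite ltr0n.
have lim : Delta k z @[z --> +oo] --> c - 1.
  rewrite -[X in _ --> X]subr0 -[X in _ --> X - 0](_ : c * 1 - 1 = _); last by rewrite mulr1.
  rewrite -[X in _ --> _ - X](mul0r K^-1).
  apply: cvgB; last by apply: cvgM; [exact: ecor_cvg0|exact: cvg_cst].
  apply: cvgB; last exact: gcdf_cvg1.
  apply: cvgM; first exact: cvg_cst.
  apply: (@cvg_comp _ _ _ (fun z => (K + z / 2) ^+ 2) (ptail k) _ +oo); last exact: ptail_cvg1.
  apply: (@cvg_comp _ _ _ (fun z => K + z / 2) (fun z => z ^+ 2) _ +oo); last exact: cvg_sqr_pinfty.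
  apply: (@ger_cvgy _ _ _ _ (fun z => 2^-1 * z)).
    by near=> z; rewrite mulrC lerDr ltW.
  by apply: gt0_cvgMry; [rewrite invr_gt0|exact: cvg_id].
have lim' : `|Delta k y - Delta k z| @[z --> +oo] --> `|Delta k y - (c - 1)|.
  by apply: cvg_norm; apply: cvgB => //; exact: cvg_cst.
apply: (cvgr_to_le lim'); near=> z; rewrite distrC.
have yz : y <= z by near: z; apply: nbhs_pinfty_ge; rewrite num_real.
pose g y := C1 / k%:R * - expR (- (d * y ^+ 2) - y).
have gG : g z - g y <= C1 / k%:R * G y.
  have : - g y <= C1 / k%:R * G y.
    by rewrite /g mulrN opprK ler_pM2l ?divr_gt0// ler_expR; lra.
  have : 0 <= - g z by rewrite /g mulrN opprK mulr_ge0 ?expR_ge0// divr_ge0// ltW.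
  lra.
apply: le_trans _ gG.
apply: (@derive_norm_le _ (Delta k) (dens k) g
    (fun y => C1 / k%:R * ((1 + 2 * d * y) * expR (- (d * y ^+ 2) - y)))).
- by [].
- by move=> x _; exact: is_der_Delta.
- move=> x _; have h := is_der_gaussR d x; rewrite /g; apply: is_der_eq.
    by apply: is_der_mul h; exact: is_der_cst.
  by cbv beta; ring.
- move=> x /andP[yx xz].
  have Kx : - (2 * K) <= x by lra.
  apply: le_trans (hC1 k x k0 Kx) _.
  rewrite ler_pM2l ?divr_gt0// /Ga ger0_norm; last by lra.
  rewrite ler_peMl ?expR_ge0//.
  have : 0 <= d * x by apply: mulr_ge0; [exact: ltW|lra].
  by lra.
Unshelve. all: by end_near. Qed.

Theorem gamma_normal_approx : exists C k0, 0 < C /\ forall k r, (k0 <= k)%N -> 0 <= r ->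
  let y := 2 * (r - Num.sqrt k%:R) in
  `|ptail k (r ^+ 2) - gcdf y - ecor y / Num.sqrt k%:R| <= C / k%:R * expR (- (d * y ^+ 2)) /\
  `|r * pois k (r ^+ 2) - gphi y * (1 + (y / 2 + y ^+ 3 / 12) / Num.sqrt k%:R)|
     <= C / k%:R * expR (- (d * y ^+ 2)).
Proof.
have [CL CL0 hL] := Delta_left; have [CR CR0 hR] := Delta_right.
have [CD CD0 hD] := dens_le; have [CE CE0 hE] := ecor_le.
have [CP CP0 hP] := Phi0_le; have [CN CN0 hN] := lin_le.
pose C8 := CL + CR.
pose M := 2 * (CL + CR + CE + CP).
exists (C8 * M + CL + CR + 2 * CD + 2 * C8 * CN), (Num.trunc (2 * C8)).+1.
have C80 : 0 < C8 by rewrite addr_gt0.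
have M0 : 0 < M by rewrite mulr_gt0// !addr_gt0.
split; first by have := mulr_gt0 C80 M0; have := mulr_gt0 C80 CN0; lra.
move=> k r kk r0 y.
have k0 : (0 < k)%N by rewrite (leq_trans _ kk).
set K := Num.sqrt k%:R in y *.
have K0 : 0 < K by rewrite sqrtr_gt0 ltr0n.
have K1 : 1 <= K by rewrite -[leLHS]sqrtr1 ler_sqrt ?ler1n// ltr0n.
have k0R : 0 < k%:R :> R by rewrite ltr0n.
have k1R : k%:R^-1 <= 1 :> R by rewrite invf_le1// ler1n.
have ki0 : 0 < k%:R^-1 :> R by rewrite invr_gt0.
have yK : - (2 * K) <= y by rewrite /y; lra.
have rE : K + y / 2 = r by rewrite /y; field.
set E := expR _; have E0 : 0 < E by exact: expR_gt0.
have GE : G y = E by [].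
pose c := (K * pois k k%:R * Num.sqrt (2 * pi))^-1.
have G0E : G 0 = 1 by rewrite /G expr0n/= mulr0 oppr0 expR0.
have c1 : `|c - 1| <= C8 / k%:R.
  have := hR k 0 k0 (lexx _); have := hL k 0 k0.
  rewrite -/K -/c lexx andbT oppr_le0 mulr_ge0 ?(ltW K0)// => /(_ isT).
  rewrite G0E !mulr1 (distrC (Delta k 0) (c - 1)) => h1 h2.
  have := ler_normD (c - 1 - Delta k 0) (Delta k 0); rewrite subrK => h3.
  by rewrite /C8 mulrDl; lra.
(* The choice of the threshold for k: once |c - 1| <= 1/2, dividing by c costs at most a factor
   2. *)
have c2 : C8 / k%:R <= 2^-1.
  rewrite ler_pdivrMr// mulrC ler_pdivlMr// mulrC.
  apply: le_trans (ltW (Num.Theory.truncnS_gt (2 * C8))) _.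
  by rewrite ler_nat.
have c3 : 2^-1 <= c by move: c1; rewrite ler_norml => /andP[? ?]; lra.
have e1 : `|ecor y / K| <= CE * E.
  rewrite normrM (@gtr0_norm _ K^-1) ?invr_gt0//.
  apply: le_trans _ (hE y).
  have e0 := normr_ge0 (ecor y); have := sqr_ge0 y => y2.
  apply: (@le_trans _ _ `|ecor y|); first by rewrite ler_piMr// invf_le1.
  by rewrite ler_peMl//; lra.
have DE : Delta k y = c * ptail k (r ^+ 2) - gcdf y - ecor y / K by rewrite /Delta -/K rE.
split.
  set V := ptail k (r ^+ 2) in DE *; set n := gcdf y in DE *; set e := ecor y / K in e1 DE *.
  (* Replacing c by 1 costs (1 - c) V, which has Gaussian decay only on the side where V is small;
     for y > 0 the complement 1 - V takes its place. *)
  have [y0|y0] := leP y 0.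
    have n1 : `|n| <= CP * E.
      rewrite /n gcdf_Phi0 ger0_norm ?Phi0_ge0//.
      have y0' : 0 <= - y by lra.
      have := hP _ y0'; rewrite /G sqrrN -/E => h; apply: le_trans _ h.
      by rewrite ler_peMl ?Phi0_ge0//; have := sqr_ge0 y; lra.
    have hD' : `|Delta k y| <= CL / k%:R * E.
      by have := hL k y k0; rewrite -/K yK y0 GE => /(_ isT).
    have hD'' : `|Delta k y| <= CL * E.
      by apply: le_trans hD' _; rewrite ler_pM2r// ler_pdivrMr// ler_peMr// ?ler1n// ltW.
    have V1 : `|V| <= M * E.
      have cV : c * `|V| <= `|Delta k y| + `|n| + `|e|.
        have -> : c * `|V| = `|c * V| by rewrite normrM (@ger0_norm _ c)//; lra.
        have -> : c * V = Delta k y + n + e by rewrite DE; ring.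
        by rewrite (le_trans (ler_normD _ _))// lerD2r ler_normD.
      have : 2^-1 * `|V| <= c * `|V| by rewrite ler_wpM2r.
      have := mulr_ge0 (ltW CR0) (ltW E0).
      rewrite /M; lra.
    have -> : V - n - e = (1 - c) * V + Delta k y by rewrite DE; ring.
    rewrite (le_trans (ler_normD _ _))// normrM distrC.
    have : `|c - 1| * `|V| <= C8 / k%:R * (M * E) by apply: ler_pM.
    have : 0 <= (CR + 2 * CD + 2 * C8 * CN) / k%:R * E.
      by rewrite mulr_ge0 ?(ltW E0)// divr_ge0 ?(ltW k0R)// !addr_ge0 ?mulr_ge0 ?(ltW CR0) ?(ltW CD0) ?(ltW C80) ?(ltW CN0).
    have -> : (C8 * M + CL + CR + 2 * CD + 2 * C8 * CN) / k%:R * E =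
      C8 / k%:R * (M * E) + CL / k%:R * E + (CR + 2 * CD + 2 * C8 * CN) / k%:R * E by ring.
    lra.
  have y0' := ltW y0.
  have n1 : `|1 - n| <= CP * E.
    rewrite /n -Phi0_gcdf ger0_norm ?Phi0_ge0//.
    apply: le_trans _ (hP _ y0').
    by rewrite ler_peMl ?Phi0_ge0//; have := sqr_ge0 y; lra.
  have hD' : `|Delta k y - (c - 1)| <= CR / k%:R * E.
    by have := hR k y k0 y0'.
  have hD'' : `|Delta k y - (c - 1)| <= CR * E.
    by apply: le_trans hD' _; rewrite ler_pM2r// ler_pdivrMr// ler_peMr// ?ler1n// ltW.
  have V1 : `|1 - V| <= M * E.
    have cV : c * `|1 - V| <= `|Delta k y - (c - 1)| + `|1 - n| + `|e|.
      have -> : c * `|1 - V| = `|c * (1 - V)| by rewrite normrM (@ger0_norm _ c)//; lra.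
      have -> : c * (1 - V) = - (Delta k y - (c - 1)) + (1 - n) - e by rewrite DE; ring.
      rewrite (le_trans (ler_normB _ _))// lerD2r (le_trans (ler_normD _ _))//.
      by rewrite normrN.
    have : 2^-1 * `|1 - V| <= c * `|1 - V| by rewrite ler_wpM2r.
    have := mulr_ge0 (ltW CL0) (ltW E0).
    rewrite /M; lra.
  have -> : V - n - e = (c - 1) * (1 - V) + (Delta k y - (c - 1)) by rewrite DE; ring.
  rewrite (le_trans (ler_normD _ _))// normrM.
  have : `|c - 1| * `|1 - V| <= C8 / k%:R * (M * E) by apply: ler_pM.
  have : 0 <= (CL + 2 * CD + 2 * C8 * CN) / k%:R * E.
    by rewrite mulr_ge0 ?(ltW E0)// divr_ge0 ?(ltW k0R)// !addr_ge0 ?mulr_ge0 ?(ltW CL0) ?(ltW CD0) ?(ltW C80) ?(ltW CN0).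
  have -> : (C8 * M + CL + CR + 2 * CD + 2 * C8 * CN) / k%:R * E =
    C8 / k%:R * (M * E) + CR / k%:R * E + (CL + 2 * CD + 2 * C8 * CN) / k%:R * E by ring.
  lra.
have hn := hN K y K1; rewrite GE in hn.
have hd : `|dens k y| <= CD / k%:R * E.
  by apply: le_trans (hD k y k0 yK) _; rewrite ler_pM2l ?divr_gt0// -GE GaG.
have dE : dens k y = c * (r * pois k (r ^+ 2)) - gphi y * (1 + (y / 2 + y ^+ 3 / 12) / K).
  by rewrite /dens -/K rE.
set A := gphi y * _ in hn dE *; set B := r * _ in dE *.
have c0 : 0 < c by lra.
have ci : c^-1 <= 2 by rewrite invf_ple ?posrE//.
have ci0 : 0 < c^-1 by rewrite invr_gt0.
have -> : B - A = c^-1 * (dens k y) + c^-1 * ((1 - c) * A) by rewrite dE; field; rewrite gt_eqF.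
rewrite (le_trans (ler_normD _ _))// (normrM c^-1 (dens k y)) (normrM c^-1 ((1 - c) * A)).
rewrite (normrM (1 - c) A) (gtr0_norm ci0) (distrC 1 c).
have : c^-1 * `|dens k y| <= 2 * (CD / k%:R * E) by apply: ler_pM => //; exact: ltW.
have : c^-1 * (`|c - 1| * `|A|) <= 2 * (C8 / k%:R * (CN * E)).
  by apply: ler_pM; [exact: ltW|exact: mulr_ge0|exact: ci|exact: ler_pM].
have : 0 <= (C8 * M + CL + CR) / k%:R * E.
  apply: mulr_ge0; last exact: ltW.
  by apply: divr_ge0; [have := mulr_gt0 C80 M0; lra|exact: ltW].
have -> : (C8 * M + CL + CR + 2 * CD + 2 * C8 * CN) / k%:R * E =
    2 * (CD / k%:R * E) + 2 * (C8 / k%:R * (CN * E)) + (C8 * M + CL + CR) / k%:R * E by ring.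
lra.
Qed.

End Compare.
End GammaNormal.

(** * Expansion of the eigenvalues *)

Section Charlier.
Variable R : realType.
Implicit Types (e x r : R).

(** Rescaled Charlier polynomials: at e = 1/r and x = (k - r^2)/r they are [ito n k 1 (r ^+ 2)] up
    to the factor (-1)^n r^n. At e = 0 the recurrence is that of [he2]. *)
Fixpoint ch2 (n : nat) (e x : R) : R * R :=
  match n with
  | 0 => (1, x)
  | k.+1 => let p := ch2 k e x in (p.2, (x - k.+1%:R * e) * p.2 - k.+1%:R * p.1)
  end.
Definition chp (n : nat) (e x : R) : R := (ch2 n e x).1.
Definition chcor (a : nat) (e x : R) : R :=
  \sum_(i < a) chp i e x * chp i.+1 e x / (i.+1)`!%:R.

Lemma chp0 e x : chp 0 e x = 1. Proof. by []. Qed.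
Lemma chp1 e x : chp 1 e x = x. Proof. by []. Qed.
Lemma chpSS a e x :
  chp a.+2 e x = (x - a.+1%:R * e) * chp a.+1 e x - a.+1%:R * chp a e x.
Proof. by []. Qed.

(** The closed form is analysed first and identified with the eigenvalue only later, through
    [glam_lam], [ip_diag] and [Kop_Hf]. Until then only 0 <= [lam] <= 1 is assumed about it. *)
Definition lam (a k : nat) (r : R) : R :=
  ptail k (r ^+ 2) + r * pois k (r ^+ 2) * chcor a r^-1 ((k%:R - r ^+ 2) / r).

Let P (e : R) : Prop := 0 < e <= 1.
(** First order expansion in e = 1/r. The remainder [Z] is polynomially bounded in x uniformly in e,
    so that a Gaussian can absorb it. *)
Definition expn (f : R -> R -> R) (f0 f1 : R -> R) :=
  [/\ polyb P (fun _ => f0), polyb P (fun _ => f1) &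
    exists2 Z, polyb P Z & forall e x, f e x = f0 x + e * f1 x + e ^+ 2 * Z e x].

Let polyb_e : polyb P (fun e _ => e).
Proof. by apply: polyb_param => e /andP[e0 e1]; rewrite ger0_norm// ltW. Qed.

Lemma expn_cst (c : R) : expn (fun _ _ => c) (fun=> c) (fun=> 0).
Proof.
split; [exact: polyb_cst|exact: polyb_cst|exists (fun _ _ => 0); first exact: polyb_cst].
by move=> e x; ring.
Qed.

Lemma expn_param : expn (fun e _ => e) (fun=> 0) (fun=> 1).
Proof.
split; [exact: polyb_cst|exact: polyb_cst|exists (fun _ _ => 0); first exact: polyb_cst].
by move=> e x; ring.
Qed.

(** With e = 1/r and X = 2 (sqrt k - r), this is the Charlier variable: (k - r^2)/r = X + X^2/(4
    r). *)
Lemma expn_quad : expn (fun e x => x + e * (x ^+ 2 / 4)) id (fun x => x ^+ 2 / 4).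
Proof.
split; first exact: polyb_id.
  by apply: polyb_mul; [apply: polyb_exp; exact: polyb_id|exact: polyb_cst].
exists (fun _ _ => 0); first exact: polyb_cst.
by move=> e x; ring.
Qed.

Lemma expn_add f g f0 f1 g0 g1 : expn f f0 f1 -> expn g g0 g1 ->
  expn (fun e x => f e x + g e x) (fun x => f0 x + g0 x) (fun x => f1 x + g1 x).
Proof.
move=> [hf0 hf1 [Zf hZf hf]] [hg0 hg1 [Zg hZg hg]].
split; [exact: polyb_add|exact: polyb_add|].
exists (fun e x => Zf e x + Zg e x); first exact: polyb_add.
by move=> e x; rewrite hf hg; ring.
Qed.

Lemma expn_mul f g f0 f1 g0 g1 : expn f f0 f1 -> expn g g0 g1 ->
  expn (fun e x => f e x * g e x) (fun x => f0 x * g0 x)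
       (fun x => f0 x * g1 x + f1 x * g0 x).
Proof.
move=> [hf0 hf1 [Zf hZf hf]] [hg0 hg1 [Zg hZg hg]].
split; first exact: polyb_mul.
  by apply: polyb_add; exact: polyb_mul.
exists (fun e x => f0 x * Zg e x + f1 x * g1 x + Zf e x * g0 x +
   e * (f1 x * Zg e x + Zf e x * g1 x) + e * (e * (Zf e x * Zg e x))).
  do ![apply: polyb_add | apply: polyb_mul => //].
by move=> e x; rewrite hf hg; ring.
Qed.

Lemma expn_ext f g f0 g0 f1 g1 : expn f f0 f1 -> f =2 g -> f0 =1 g0 -> f1 =1 g1 ->
  expn g g0 g1.
Proof.
move=> h fg fg0 fg1.
have -> : g = f by apply/funext => e; apply/funext => x; rewrite fg.
have -> : g0 = f0 by apply/funext => x; rewrite fg0.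
by have -> : g1 = f1 by apply/funext => x; rewrite fg1.
Qed.

(** The first order coefficient has the parity opposite to that of [he a]: both sources of a factor
    e, the shift (a+1) e in the recurrence and x^2/4 in the variable, replace an odd factor x by an
    even one. *)
Lemma expn_chp a : exists D, [/\ expn (fun e x => chp a e (x + e * (x ^+ 2 / 4))) (he a) D,
  forall x, D (- x) = - (-1) ^+ a * D x & continuous D].
Proof.
pose Q a := exists D, [/\ expn (fun e x => chp a e (x + e * (x ^+ 2 / 4))) (he a) D,
  forall x, D (- x) = - (-1) ^+ a * D x & continuous D].
suff : Q a /\ Q a.+1 by case.
elim: a => [|a [[D1 [h1 p1 c1]] [D2 [h2 p2 c2]]]].
  split.
    exists (fun=> 0); split => [|x|]; last exact: cst_continuous.
      by apply: expn_ext (expn_cst 1) _ _ _.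
    by rewrite mulr0.
  exists (fun x => x ^+ 2 / 4); split => [|x|].
  - by apply: expn_ext expn_quad _ _ _.
  - by rewrite sqrrN expr1; ring.
  - by move=> x; apply: cvgM; [exact: exprn_continuous|exact: cvg_cst].
split; first by exists D2.
have := expn_add (expn_mul (expn_add expn_quad (expn_mul (expn_cst (- a.+1%:R)) expn_param)) h2)
   (expn_mul (expn_cst (- a.+1%:R)) h1).
set E := (X in expn _ _ X) => h.
exists E; split.
- apply: expn_ext h _ _ _ => [e x|x|//].
  + by rewrite chpSS mulNr [_ * e]mulrC; ring.
  + by rewrite heSS; ring.
- move=> x; rewrite /E p1 p2 !heN sqrrN !exprS; ring.
- move=> x; rewrite /E.
  do ![exact: cvg_cst | exact: cvg_id | exact: c1 | exact: c2 | exact: exprn_continuous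
    | exact: continuous_he | apply: cvgD | apply: cvgM ].
Qed.

(** Products of consecutive degrees are odd at leading order, hence even at first order. *)
Lemma expn_chcor a : exists D, [/\ expn (fun e x => chcor a e (x + e * (x ^+ 2 / 4))) (hecor a) D,
  forall x, D (- x) = D x & continuous D].
Proof.
elim: a => [|a [D [hD pD cD]]].
  exists (fun=> 0); split => //; last exact: cst_continuous.
  apply: expn_ext (expn_cst 0) _ _ _ => [e x|x|//].
    by rewrite /chcor big_ord0.
  by rewrite /hecor big_ord0.
have [D1 [h1 p1 c1]] := expn_chp a; have [D2 [h2 p2 c2]] := expn_chp a.+1.
have := expn_add hD (expn_mul (expn_mul h1 h2) (expn_cst (a.+1)`!%:R^-1)).
set E := (X in expn _ _ X) => h.
exists E; split; last first.
- move=> x; rewrite /E.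
  do ![exact: cvg_cst | exact: cvg_id | exact: c1 | exact: c2 | exact: cD
    | exact: continuous_he | apply: cvgD | apply: cvgM ].
- move=> x; rewrite /E pD p1 p2 !heN exprS.
  have e1 : (-1) ^+ a * (-1) ^+ a = 1 :> R by rewrite -expr2 sqrr_sign.
  congr (_ + _); rewrite !mulr0 !add0r; congr (_ * _).
  have -> : forall u v w z : R, (-1) ^+ a * u * (- (-1 * (-1) ^+ a) * v) +
   - (-1) ^+ a * w * (-1 * (-1) ^+ a * z) = ((-1) ^+ a * (-1) ^+ a) * (u * v + w * z).
    by move=> *; ring.
  by rewrite e1 mul1r.
- apply: expn_ext h _ _ _ => [e x|x|//].
  + by rewrite /chcor big_ord_recr.
  + by rewrite /hecor big_ord_recr.
Qed.

Let polyb_abs f : polyb P f -> polyb P (fun e x => `|f e x|).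
Proof. by move=> [C [n h]]; exists C, n => e x Pe; rewrite normr_id h. Qed.

(** [E1] collects the 1/sqrt k terms of the gamma comparison and [E2] the 1/r terms of the Charlier
    polynomials. The condition r^2/4 <= k makes 1/sqrt k <= 2/r, so both are of order 1/r. The
    evenness of the two corrections will make the limiting error odd. *)
Theorem lam_expansion a : exists E1 E2 : R -> R,
  [/\ (forall x, E1 (- x) = E1 x) /\ (forall x, E2 (- x) = E2 x),
   continuous E1 /\ continuous E2,
   forall d, 0 < d < 4^-1 -> exists2 C, 0 < C & forall x,
     `|E1 x| <= C * expR (- (d * x ^+ 2)) /\ `|E2 x| <= C * expR (- (d * x ^+ 2)) &
   forall d, 0 < d < 4^-1 -> exists C r0, [/\ 0 < C, 1 <= r0 &
     forall k r X, r0 <= r -> r ^+ 2 / 4 <= k%:R -> X = 2 * (Num.sqrt k%:R - r) ->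
     `|lam a k r - Phi a X - E1 X / Num.sqrt k%:R - E2 X / r| <=
       C / r ^+ 2 * expR (- (d * X ^+ 2))]].
Proof.
have [D [hD pD cD]] := expn_chcor a.
(* The minus sign appears because the gamma comparison is stated in y = -X. *)
pose u x : R := - (x / 2 + x ^+ 3 / 12).
have hu : polyb P (fun _ => u).
  apply: polyb_opp; apply: polyb_add; apply: polyb_mul; try exact: polyb_cst.
    exact: polyb_id.
  by apply: polyb_exp; exact: polyb_id.
pose E1 x := ecor x + gphi x * (u x * hecor a x).
pose E2 x := gphi x * D x.
have [hh hD1 [Z hZ hZE]] := hD.
have s0 := @sqrt2pi_gt0 R.
exists E1, E2; split.
- split=> x; last by rewrite /E2 gphiN pD.
  rewrite /E1 ecorN gphiN hecorN /u; congr (_ + _ * _); ring.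
- split=> x; last by apply: cvgM; [exact: continuous_gphi|exact: cD].
  apply: cvgD; first exact: (continuous_of_der (f' := fun x => _) (@is_der_ecor R)).
  apply: cvgM; first exact: continuous_gphi.
  apply: cvgM; last first.
    exact: continuous_hecor.
  apply: cvgN; apply: cvgD; apply: cvgM; try exact: cvg_cst; first exact: cvg_id.
  exact: exprn_continuous.
- move=> d /andP[d0 d1]; have d2 : d < 2^-1 by lra.
  have h1 : polyb P (fun _ x => `|x ^+ 2 / 12 + 2 / 3| + `|u x * hecor a x| + `|D x|).
    apply: polyb_add; last exact: polyb_abs.
    apply: polyb_add; apply: polyb_abs; last exact: polyb_mul.
    apply: polyb_add; last exact: polyb_cst.
    by apply: polyb_mul; [apply: polyb_exp; exact: polyb_id|exact: polyb_cst].
  have [C C0 hC] := polyb_gauss h1 d2.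
  exists (C / Num.sqrt (2 * pi)); first by rewrite divr_gt0.
  move=> x; have P1 : P 1 by rewrite /P ltr01 lexx.
  have := hC 1 x P1.
  have -> : - (2^-1 * x ^+ 2) = - x ^+ 2 / 2 by ring.
  rewrite -(ler_pM2r (_ : 0 < (Num.sqrt (2 * pi))^-1)) ?invr_gt0//.
  set W := _ + `|D x|; set T := `|W| * _ / _.
  have -> : T = W * gphi x by rewrite /T ger0_norm ?addr_ge0// /gphi mulrA.
  rewrite [C * _ / _]mulrAC => h; have g0 := gphi_gt0 x.
  split; apply: le_trans _ h; rewrite /W mulrC.
    rewrite (le_trans (ler_normD _ _))// /ecor mulNr normrN (normrM (gphi x)).
    rewrite (normrM (gphi x)) (gtr0_norm g0) -mulrDr ler_pM2l//.
    by rewrite lerDl.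
  rewrite /E2 (normrM (gphi x)) (gtr0_norm g0) ler_pM2l//.
  by rewrite lerDr addr_ge0.
- move=> d /andP[d0 d1].
  pose d' := (d + 4^-1) / 2.
  have d'0 : 0 < d' by rewrite /d'; lra.
  have d'1 : d' < 4^-1 by rewrite /d'; lra.
  have dd' : d < d' by rewrite /d'; lra.
  have [C1 [k0 [C10 hC1]]] := gamma_normal_approx d'0 d'1.
  have hB1 : polyb P (fun e x => `|Z e x| + 2 * (`|u x| * (`|D x| + `|Z e x|))).
    do ![apply: polyb_add | apply: polyb_mul | exact: polyb_cst | exact: polyb_abs].
  have hB2 : polyb P (fun e x => `|hecor a x| + `|D x| + `|Z e x|).
    do ![apply: polyb_add | exact: polyb_abs].
  have dh : d < 2^-1 by lra.
  have [C2 C20 hC2] := polyb_gauss hB1 dh.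
  have [C3 C30 hC3] := polyb_gauss hB2 dd'.
  exists (4 * C1 + C2 / Num.sqrt (2 * pi) + 4 * C1 * C3), (2 + 2 * k0%:R); split.
  + have := divr_gt0 C20 s0; have := mulr_gt0 C10 C30; lra.
  + by have := ler0n R k0; lra.
  move=> k r X rr kr XE.
  have k0R := ler0n R k0.
  have r2 : 2 <= r by lra.
  have r0 : 0 < r by lra.
  have kk0 : (k0 <= k)%N.
    by rewrite -(ler_nat R); apply: le_trans _ kr; nra.
  have k1 : 0 < k%:R :> R by apply: lt_le_trans kr; nra.
  set K := Num.sqrt k%:R in XE *.
  have K0 : 0 < K by rewrite sqrtr_gt0.
  have K2 : K ^+ 2 = k%:R by rewrite sqr_sqrtr ?ler0n.
  have Kr : r / 2 <= K.
    rewrite -(@ler_pXn2r _ 2) ?nnegrE//; [by rewrite K2; lra|lra|lra].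
  have dK : K^-1 <= 2 / r.
    by rewrite -[2 / r]invrK lef_pV2 ?posrE ?invr_gt0 ?divr_gt0// invf_div.
  have := hC1 k r kk0 (ltW r0); rewrite -/K.
  have -> : 2 * (r - K) = - X by rewrite XE; ring.
  move=> /= [].
  rewrite gcdf_Phi0 opprK ecorN gphiN sqrrN.
  have -> : - X / 2 + (- X) ^+ 3 / 12 = u X by rewrite /u; ring.
  set V := ptail k _; set Q := r * pois k _; set G' := expR (- (d' * X ^+ 2)).
  set G := expR (- (d * X ^+ 2)).
  have Pe : P r^-1 by rewrite /P invr_gt0 r0 invf_le1//; lra.
  have e0 : 0 < r^-1 by rewrite invr_gt0.
  have hv := hZE r^-1 X.
  have lE : lam a k r = V + Q * (hecor a X + r^-1 * D X + r^-1 ^+ 2 * Z r^-1 X).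
    rewrite -hv /lam -/V -/Q; congr (_ + _ * chcor _ _ _).
    by rewrite -K2 XE; field; lra.
  rewrite (PhiE a X) lE /E1 /E2.
  set h := hecor a X; set D' := D X; set z := Z _ _; set g := gphi X; set e := r^-1 in e0 *.
  set w := u X; set n := Phi 0 X; set c := ecor X.
  move=> hV hQ.
  pose rho1 := V - n - c / K; pose rho2 := Q - g * (1 + w / K).
  (* What remains is the error of the tail, the products of second order, and the error of the
     Poisson weight times the full polynomial factor. *)
  have -> : V + Q * (h + e * D' + e ^+ 2 * z) - (n + g * h) - (c + g * (w * h)) / K - g * D' * e
    = rho1 + (g * (e ^+ 2 * z + w / K * e * (D' + e * z)) + rho2 * (h + e * D' + e ^+ 2 * z)).
    by rewrite /rho1 /rho2; ring.
  have G'G : G' <= G.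
    rewrite ler_expR lerN2 ler_wpM2r ?sqr_ge0//; exact: ltW.
  have ki : k%:R^-1 <= 4 * e ^+ 2.
    rewrite -[leRHS]invrK lef_pV2 ?posrE//; last by rewrite invr_gt0 mulr_gt0// exprn_gt0.
    by rewrite invfM -exprVn /e invrK; lra.
  have ki0 : 0 < k%:R^-1 :> R by rewrite invr_gt0.
  have e20 : 0 < e ^+ 2 by rewrite exprn_gt0.
  have G0 : 0 < G by exact: expR_gt0.
  have G'0 : 0 < G' by exact: expR_gt0.
  have g0 : 0 < g by exact: gphi_gt0.
  have e1 : e <= 1 by case/andP: Pe.
  have b1 : `|rho1| <= e ^+ 2 * (4 * C1 * G).
    apply: le_trans hV _.
    have : C1 / k%:R <= C1 * (4 * e ^+ 2) by rewrite ler_pM2l.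
    have -> : e ^+ 2 * (4 * C1 * G) = C1 * (4 * e ^+ 2) * G by ring.
    move=> h1; apply: ler_pM => //; [by apply: mulr_ge0; exact: ltW|exact: ltW].
  have z0 := normr_ge0 z; have D0 := normr_ge0 D'; have h0 := normr_ge0 h.
  have w0 := normr_ge0 w.
  have b2 : `|g * (e ^+ 2 * z + w / K * e * (D' + e * z))| <= e ^+ 2 * (C2 / Num.sqrt (2 * pi) * G).
    apply: (@le_trans _ _ (e ^+ 2 * (g * (`|z| + 2 * (`|w| * (`|D'| + `|z|)))))).
      rewrite normrM (gtr0_norm g0) mulrCA ler_pM2l// (le_trans (ler_normD _ _))//.
      rewrite [leRHS]mulrDr lerD//; first by rewrite normrM (gtr0_norm e20).
      have -> : `|w / K * e * (D' + e * z)| = K^-1 * e * (`|w| * `|D' + e * z|).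
        have p1 : 0 < K^-1 * e by rewrite mulr_gt0// invr_gt0.
        have -> : w / K * e * (D' + e * z) = (K^-1 * e) * (w * (D' + e * z)) by ring.
        by rewrite (normrM (K^-1 * e)) (normrM w) (gtr0_norm p1).
      have -> : e ^+ 2 * (2 * (`|w| * (`|D'| + `|z|))) = 2 / r * e * (`|w| * (`|D'| + `|z|)).
        by rewrite /e; ring.
      apply: ler_pM.
      + by apply: mulr_ge0; [rewrite invr_ge0; exact: ltW|exact: ltW].
      + exact: mulr_ge0.
      + by rewrite ler_pM2r.
      + rewrite ler_wpM2l// (le_trans (ler_normD _ _))// lerD2l normrM (gtr0_norm e0).
        by rewrite ler_piMl.
    rewrite ler_pM2l//.
    have := hC2 e X Pe; rewrite -/G -/z.
    have -> : - (2^-1 * X ^+ 2) = - X ^+ 2 / 2 by ring.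
    rewrite -(ler_pM2r (_ : 0 < (Num.sqrt (2 * pi))^-1)) ?invr_gt0//.
    rewrite (@ger0_norm _ (`|z| + _)); last first.
      by apply: addr_ge0 => //; apply: mulr_ge0 => //; apply: mulr_ge0 => //; exact: addr_ge0.
    rewrite [C2 * G / _]mulrAC => hh2; apply: le_trans _ hh2.
    by rewrite le_eqVlt; apply/orP; left; apply/eqP; rewrite /g /gphi; ring.
  have b3 : `|rho2 * (h + e * D' + e ^+ 2 * z)| <= e ^+ 2 * (4 * C1 * C3 * G).
    rewrite normrM.
    apply: (@le_trans _ _ (C1 * (4 * e ^+ 2) * G' * (`|h| + `|D'| + `|z|))).
      apply: ler_pM => //.
        by apply: le_trans hQ _; rewrite ler_pM2r// ler_pM2l.
      rewrite (le_trans (ler_normD _ _))// lerD//.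
        rewrite (le_trans (ler_normD _ _))// lerD2l normrM (gtr0_norm e0).
        by rewrite ler_piMl.
      rewrite normrM (gtr0_norm e20) ler_piMl// expr_le1//; exact: ltW.
    have := hC3 e X Pe; rewrite -/G -/G' -/z (@ger0_norm _ (_ + `|z|)) ?addr_ge0// => hh3.
    have -> : e ^+ 2 * (4 * C1 * C3 * G) = C1 * (4 * e ^+ 2) * (C3 * G) by ring.
    rewrite -mulrA ler_pM2l; first by rewrite mulrC.
    by rewrite !mulr_gt0.
  rewrite (le_trans (ler_normD _ _))//.
  have := ler_normD (g * (e ^+ 2 * z + w / K * e * (D' + e * z))) (rho2 * (h + e * D' + e ^+ 2 * z)).
  have -> : (4 * C1 + C2 / Num.sqrt (2 * pi) + 4 * C1 * C3) / r ^+ 2 * G =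
    e ^+ 2 * (4 * C1 * G) + e ^+ 2 * (C2 / Num.sqrt (2 * pi) * G) + e ^+ 2 * (4 * C1 * C3 * G).
    by rewrite /e; field; rewrite !gt_eqF.
  lra.
Qed.

End Charlier.

(** * The entropy functions *)

Section Fbeta.
Variable R : realType.
Implicit Types (x y p q : R).

Lemma is_der_powR (c x : R) : 0 < x -> is_der x (fun y => y `^ c) (c * x `^ (c - 1)).
Proof.
move=> x0; have xi : x \in `]0, +oo[%R by rewrite in_itv/= x0.
apply: DeriveDef; first exact: derivable_powR.
by rewrite -derive1E powR_derive1.
Qed.

Lemma is_der_powR_onem (c x : R) : x < 1 ->
  is_der x (fun y => (1 - y) `^ c) (- (c * (1 - x) `^ (c - 1))).
Proof.
move=> x1; apply: is_der_eq.
  apply: (@is_der_comp _ (fun y => y `^ c) (fun y => 1 - y)).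
    by apply: is_der_powR; lra.
  by repeat der1.
ring.
Qed.

Lemma powR_expo_le p (c d : R) : 0 < p <= 1 -> c <= d -> p `^ d <= p `^ c.
Proof. by move=> hp cd; apply: ger_powR. Qed.

Lemma powR_le1 p (c : R) : 0 <= p <= 1 -> 0 < c -> p `^ c <= 1.
Proof.
move=> /andP[p0 p1] c0; have -> : 1 = 1 `^ c :> R by rewrite powR1.
by apply: ge0_ler_powR => //; rewrite ?nnegrE// ltW.
Qed.

Lemma powR_le_base (c x y : R) : 0 <= c -> 0 <= x -> x <= y -> x `^ c <= y `^ c.
Proof. by move=> c0 x0 xy; apply: ge0_ler_powR; rewrite ?nnegrE//; lra. Qed.

(** Writing p^g = p p^(g-1), with p^(g-1) decreasing, puts the whole weight at [q] with constant 1.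
    Later [p] is an eigenvalue, for which no quantitative lower bound is at hand, and [q] a value of
    [Phi]. *)
Lemma powR_diff_le (g p q : R) : 0 < g < 1 -> 0 < p -> 0 < q ->
  `|p `^ g - q `^ g| <= `|p - q| * q `^ (g - 1).
Proof.
move=> /andP[g0 g1] p0 q0.
rewrite -(mulr_powRB1 (ltW p0) g0) -(mulr_powRB1 (ltW q0) g0).
have mono x y : 0 < x -> x <= y -> y `^ (g - 1) <= x `^ (g - 1).
  move=> x0 xy; have y0 : 0 < y by lra.
  rewrite -opprB !powRN lef_pV2 ?posrE ?powR_gt0//.
  by apply: ge0_ler_powR; rewrite ?nnegrE//; lra.
have P0 := powR_gt0 (g - 1) p0; have Q0 := powR_gt0 (g - 1) q0.
have [pq|qp] := leP p q.
  have := mono _ _ p0 pq => h.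
  have h1 : p * p `^ (g - 1) <= q * q `^ (g - 1).
    rewrite (mulr_powRB1 (ltW p0) g0) (mulr_powRB1 (ltW q0) g0).
    by apply: ge0_ler_powR; rewrite ?nnegrE//; lra.
  rewrite ler0_norm; last by lra.
  rewrite (@ler0_norm _ (p - q)); last by lra.
  have : p * q `^ (g - 1) <= p * p `^ (g - 1) by rewrite ler_pM2l.
  lra.
have := mono _ _ q0 (ltW qp) => h.
have h1 : q * q `^ (g - 1) <= p * p `^ (g - 1).
  rewrite (mulr_powRB1 (ltW p0) g0) (mulr_powRB1 (ltW q0) g0).
  by apply: ge0_ler_powR; rewrite ?nnegrE//; lra.
rewrite ger0_norm; last by lra.
rewrite (@ger0_norm _ (p - q)); last by lra.
have : p * p `^ (g - 1) <= p * q `^ (g - 1) by rewrite ler_pM2l.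
lra.
Qed.

Section B.
Variable b : R.
Hypothesis hb : 1 / 2 < b.

Let u p : R := p `^ b + (1 - p) `^ b.

Definition dfbeta p : R :=
  if b == 1 then ln (1 - p) - ln p
  else b * (p `^ (b - 1) - (1 - p) `^ (b - 1)) / (u p * (1 - b)).

(** The cap is a number strictly between 1/2 and 1, here the one for which the logarithm at b = 1
    obeys -ln p <= 4 p^(-1/4). *)
Definition gam : R := Num.min b (3 / 4).

Lemma gam_bounds : 1 / 2 < gam < 1.
Proof. by rewrite /gam lt_min hb gt_min; apply/andP; split; lra. Qed.

Lemma gam_le : gam <= b. Proof. by rewrite /gam ge_min lexx. Qed.

Let b0 : 0 < b. Proof. by move: hb; lra. Qed.

Let u_ge p : 0 <= p <= 1 -> 2^-1 `^ b <= u p.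
Proof.
move=> /andP[p0 p1]; rewrite /u.
have := powR_ge0 p b; have := powR_ge0 (1 - p) b.
have [h|h] := leP (2^-1) p.
  have : 2^-1 `^ b <= p `^ b by apply: powR_le_base => //; exact: ltW.
  lra.
have : 2^-1 `^ b <= (1 - p) `^ b by apply: powR_le_base; [exact: ltW| |lra].
lra.
Qed.

Let u0_gt0 : 0 < 2^-1 `^ b. Proof. by rewrite powR_gt0. Qed.

Let u_gt0 p : 0 <= p <= 1 -> 0 < u p.
Proof. by move=> /u_ge; exact: lt_le_trans. Qed.

Lemma fbeta_onem p : fbeta b (1 - p) = fbeta b p.
Proof.
rewrite /fbeta opprB addrCA subrr addr0; case: ifPn => _; first by ring.
by rewrite [X in ln X]addrC.
Qed.

Lemma fbeta0 : fbeta b 0 = 0.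
Proof.
rewrite /fbeta subr0 ln1; case: ifPn => _; first by ring.
by rewrite powR0 ?gt_eqF// powR1 add0r ln1 mul0r.
Qed.

Lemma fbeta1 : fbeta b 1 = 0.
Proof. by rewrite -fbeta_onem subrr fbeta0. Qed.

Lemma is_der_fbeta p : 0 < p < 1 -> is_der p (fbeta b) (dfbeta p).
Proof.
move=> /andP[p0 p1]; rewrite /fbeta /dfbeta; case: ifPn => [/eqP b1|b1].
  have -> : (fun p => - p * ln p - (1 - p) * ln (1 - p)) =
    fun p : R => - (p * ln p) - (1 - p) * ln (1 - p) by apply/funext => y; ring.
  der; cbv beta; first by rewrite subr_gt0.
  by field; rewrite subr_eq0 eq_sym (lt_eqF p1) gt_eqF.
have h1 := is_der_powR b p0; have h2 := is_der_powR_onem b p1.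
have up : 0 < u p by apply: u_gt0; lra.
apply: is_der_eq.
  apply: is_der_mul; last exact: is_der_cst.
  apply: is_der_ln; first exact: up.
  by apply: is_der_add; [exact: h1|exact: h2].
rewrite -/(u p); move: b1; rewrite -subr_eq0 -oppr_eq0 opprB => b1.
by cbv beta; rewrite -/(u p); field; rewrite b1 gt_eqF.
Qed.

Lemma dfbeta_onem p : dfbeta (1 - p) = - dfbeta p.
Proof.
rewrite /dfbeta /u opprB addrCA subrr addr0; case: ifPn => _; first by ring.
by rewrite [(1 - p) `^ b + _]addrC; ring.
Qed.

Lemma dfbeta_continuous p : 0 < p < 1 -> {for p, continuous dfbeta}.
Proof.
move=> /andP[p0 p1].
have cp c : {for p, continuous (fun y : R => y `^ c)}.
  apply/differentiable_continuous/derivable1_diffP.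
  by have [] := is_der_powR c p0.
have cq c : {for p, continuous (fun y : R => (1 - y) `^ c)}.
  apply/differentiable_continuous/derivable1_diffP.
  by have [] := is_der_powR_onem c p1.
have [b1|b1] := eqVneq b 1.
  have -> : dfbeta = fun y => ln (1 - y) - ln y.
    by apply/funext => y; rewrite /dfbeta b1 eqxx.
  have [] : is_der p (fun y => ln (1 - y) - ln y) ((1 - p)^-1 * -1 - p^-1).
    by der; [rewrite subr_gt0|cbv beta; ring].
  by move=> /derivable1_diffP/differentiable_continuous.
have -> : dfbeta = fun p => b * (p `^ (b - 1) - (1 - p) `^ (b - 1)) / (u p * (1 - b)).
  by apply/funext => y; rewrite /dfbeta (negbTE b1).
apply: cvgM.
  by apply: cvgM; [exact: cvg_cst|apply: cvgB; [exact: cp|exact: cq]].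
apply: cvgV.
  have up : 0 < u p by apply: u_gt0; lra.
  by rewrite mulf_neq0 ?(gt_eqF up)// subr_eq0 eq_sym.
by apply: cvgM; [apply: cvgD; [exact: cp|exact: cq]|exact: cvg_cst].
Qed.

Lemma ln_powR_le p : 0 < p <= 1 -> - ln p <= 4 * p `^ (3 / 4 - 1).
Proof.
move=> /andP[p0 p1].
have -> : - ln p = 4 * ln (p `^ (3 / 4 - 1)) by rewrite ln_powR; field.
by rewrite ler_pM2l// ltW// ln_sublinear// powR_gt0.
Qed.

Lemma dfbeta_le : exists2 C, 0 < C & forall p, 0 < p < 1 ->
  `|dfbeta p| <= C * (p `^ (gam - 1) + (1 - p) `^ (gam - 1)).
Proof.
have /andP[g0 g1] := gam_bounds.
have gb := gam_le.
have [b1|b1] := eqVneq b 1.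
  exists 4 => // p /andP[p0 p1].
  have -> : gam = 3 / 4 by rewrite /gam b1; apply/min_idPr; lra.
  rewrite /dfbeta b1 eqxx mulrDr.
  have h1 := @ln_powR_le p; have h2 := @ln_powR_le (1 - p).
  have l1 : ln p <= 0 by apply: ln_le0; lra.
  have l2 : ln (1 - p) <= 0 by apply: ln_le0; lra.
  have := h1 ltac:(lra); have := h2 ltac:(lra).
  by rewrite ler_norml => ? ?; apply/andP; split; lra.
have B0 : 0 < `|1 - b| by rewrite normr_gt0 subr_eq0 eq_sym.
exists (b / (2^-1 `^ b * `|1 - b|)); first by rewrite divr_gt0// mulr_gt0.
move=> p /andP[p0 p1]; rewrite /dfbeta (negbTE b1).
have hu : 2^-1 `^ b <= u p by apply: u_ge; lra.
have up : 0 < u p by apply: lt_le_trans hu.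
rewrite !normrM normfV normrM (gtr0_norm b0) (gtr0_norm up).
have h1 : p `^ (b - 1) <= p `^ (gam - 1) by apply: powR_expo_le; lra.
have h2 : (1 - p) `^ (b - 1) <= (1 - p) `^ (gam - 1) by apply: powR_expo_le; lra.
have p1' := powR_ge0 p (b - 1); have p2' := powR_ge0 (1 - p) (b - 1).
rewrite mulrAC; apply: ler_pM.
- by rewrite divr_ge0// ?mulr_ge0// ltW.
- exact: normr_ge0.
- by rewrite ler_pM2l// lef_pV2 ?posrE ?mulr_gt0// ler_pM2r.
- by rewrite ler_norml; apply/andP; split; lra.
Qed.

(** For b < 1 the argument of ln is at least 1, and ln (1 + x) <= x gives p^b. For b > 1 it is at
    most 1, and Bernoulli's inequality with an integer n >= b bounds 1 - (1 - p)^b by n p. For b = 1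
    the term p ln p costs the power 3/4. *)
Lemma fbeta_le : exists2 C, 0 < C & forall p, 0 <= p <= 1 -> 0 <= fbeta b p <= C * p `^ gam.
Proof.
have /andP[g0 g1] := gam_bounds.
have gb := gam_le.
have gg : 0 < gam by lra.
have pg p : 0 <= p <= 1 -> p <= p `^ gam.
  move=> /andP[]; rewrite le_eqVlt => /predU1P[<- _|p0 p1]; first exact: powR_ge0.
  by apply: ger1_powR; lra.
have bg p : 0 <= p <= 1 -> p `^ b <= p `^ gam.
  move=> /andP[]; rewrite le_eqVlt => /predU1P[<- _|p0 p1]; last by apply: powR_expo_le; lra.
  by rewrite !powR0// ?gt_eqF.
have case0 (C : R) : 0 < C -> 0 <= fbeta b 0 <= C * 0 `^ gam.
  by move=> C0; rewrite fbeta0 lexx powR0 ?mulr0 ?lexx // lt0r_neq0.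
have case1 (C : R) : 0 < C -> 0 <= fbeta b 1 <= C * 1 `^ gam.
  by move=> C0; rewrite fbeta1 lexx powR1 mulr1 ltW.
have [b1|b1|b1] := ltgtP b 1.
- exists (1 - b)^-1; first by rewrite invr_gt0; lra.
  move=> p p01; rewrite /fbeta lt_eqF// -/(u p).
  have /andP[p0 p1] := p01; have up := u_gt0 p01.
  have u1 : 1 <= u p.
    have q01 : 0 <= 1 - p <= 1 by lra.
    have h x : 0 <= x <= 1 -> x <= x `^ b.
      move=> /andP[]; rewrite le_eqVlt => /predU1P[<- _|x0 x1]; first exact: powR_ge0.
      by apply: ger1_powR; lra.
    have := h _ p01; have := h _ q01; rewrite /u; lra.
  have h1 : ln (u p) <= p `^ b.
    have -> : u p = 1 + (u p - 1) by ring.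
    apply: le_trans (le_ln1Dx _) _; first by lra.
    have : (1 - p) `^ b <= 1 by apply: powR_le1; lra.
    by rewrite /u; lra.
  apply/andP; split; first by rewrite divr_ge0 ?ln_ge0//; lra.
  rewrite mulrC ler_pM2l ?invr_gt0; last by lra.
  exact: le_trans h1 (bg _ p01).
- pose n := (Num.trunc b).+1.
  have nb : b <= n%:R by apply: ltW; exact: truncnS_gt.
  exists ((2^-1 `^ b)^-1 * n%:R / (b - 1)).
    by rewrite divr_gt0 ?mulr_gt0 ?invr_gt0//; lra.
  move=> p p01; have /andP[p0 p1] := p01.
  have [->|p1n] := eqVneq p 1.
    by apply: case1; rewrite divr_gt0 ?mulr_gt0 ?invr_gt0//; lra.
  have p1' : p < 1 by rewrite lt_neqAle p1n.
  rewrite /fbeta gt_eqF// -/(u p).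
  have up := u_gt0 p01; have hu := u_ge p01.
  have u1 : u p <= 1.
    have q01 : 0 <= 1 - p <= 1 by lra.
    have h x : 0 <= x <= 1 -> x `^ b <= x.
      move=> /andP[]; rewrite le_eqVlt => /predU1P[<- _|x0 x1]; first by rewrite powR0// gt_eqF.
      by apply: ge1r_powR; lra.
    have := h _ p01; have := h _ q01; rewrite /u; lra.
  have Bern m : 1 - m%:R * p <= (1 - p) ^+ m.
    elim: m => [|m IH]; first by rewrite expr0; lra.
    rewrite exprSr -natr1.
    have : (1 - m%:R * p) * (1 - p) <= (1 - p) ^+ m * (1 - p) by rewrite ler_wpM2r//; lra.
    have : 0 <= m%:R * p * p by apply: mulr_ge0 => //; apply: mulr_ge0.
    lra.
  have h2 : 1 - n%:R * p <= (1 - p) `^ b.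
    apply: le_trans (Bern n) _; rewrite -powR_mulrn; last by lra.
    by apply: powR_expo_le => //; lra.
  have h1 : - ln (u p) <= (2^-1 `^ b)^-1 * (n%:R * p).
    rewrite -lnV ?posrE//.
    have -> : (u p)^-1 = 1 + ((u p)^-1 - 1) by ring.
    have : 1 <= (u p)^-1 by rewrite invf_ge1.
    move=> ui; apply: le_trans (le_ln1Dx _) _; first by lra.
    have -> : (u p)^-1 - 1 = (u p)^-1 * (1 - u p) by field; rewrite gt_eqF.
    apply: ler_pM; [by rewrite invr_ge0 ltW|lra|by rewrite lef_pV2|].
    by have := powR_ge0 p b; rewrite /u; lra.
  have -> : ln (u p) / (1 - b) = - ln (u p) / (b - 1).
    by field; rewrite !subr_eq0 (gt_eqF b1) eq_sym (gt_eqF b1).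
  have l0 : 0 <= - ln (u p) by rewrite oppr_ge0 ln_le0.
  apply/andP; split; first by rewrite divr_ge0//; lra.
  rewrite [leRHS]mulrAC ler_pM2r ?invr_gt0; last by lra.
  apply: le_trans h1 _; rewrite -mulrA ler_pM2l ?invr_gt0//.
  by rewrite ler_wpM2l// pg.
- exists 5 => // p p01; have /andP[p0 p1] := p01.
  have [->|p1n] := eqVneq p 1; first exact: case1.
  have p1' : p < 1 by rewrite lt_neqAle p1n.
  have [->|p0n] := eqVneq p 0; first exact: case0.
  have p0' : 0 < p by rewrite lt_neqAle eq_sym p0n.
  rewrite /fbeta b1 eqxx.
  have l1 : ln p <= 0 by apply: ln_le0; lra.
  have l2 : ln (1 - p) <= 0 by apply: ln_le0; lra.
  apply/andP; split.
    have : 0 <= p * - ln p by apply: mulr_ge0; lra.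
    have : 0 <= (1 - p) * - ln (1 - p) by apply: mulr_ge0; lra.
    lra.
  have ge : gam = 3 / 4 by rewrite /gam b1; apply/min_idPr; lra.
  have h1 : p * - ln p <= 4 * p `^ gam.
    rewrite -(mulr_powRB1 p0 gg) mulrCA ler_wpM2l// ge; apply: ln_powR_le; lra.
  have h2 : (1 - p) * - ln (1 - p) <= p.
    rewrite -lnV ?posrE; last by lra.
    have -> : (1 - p)^-1 = 1 + p / (1 - p) by field; lra.
    apply: (@le_trans _ _ ((1 - p) * (p / (1 - p)))); last by rewrite le_eqVlt; apply/orP; left; apply/eqP; field; lra.
    rewrite ler_pM2l; last by lra.
    apply: le_ln1Dx; have : 0 <= p / (1 - p) by apply: divr_ge0; lra.
    lra.
  have := pg _ p01; lra.
Qed.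

(** The bound on [dfbeta] is integrated to a difference of powers, and [powR_diff_le] moves the
    singular weight to [q]. The end points p = 0 and p = 1, which the bounds on the eigenvalues
    allow, are treated apart because [dfbeta] is a derivative only in the open interval. *)
Lemma fbeta_diff : exists2 C, 0 < C & forall p q, 0 <= p <= 1 -> 0 < q < 1 ->
  `|fbeta b p - fbeta b q| <= C * `|p - q| * (q `^ (gam - 1) + (1 - q) `^ (gam - 1)).
Proof.
have /andP[g0 g1] := gam_bounds.
have gg : 0 < gam by lra.
have [C1 C10 h1] := dfbeta_le; have [C2 C20 h2] := fbeta_le.
pose C := C1 / gam.
have C0 : 0 < C by rewrite divr_gt0.
exists (C + C2); first by rewrite addr_gt0.
move=> p q p01 q01.
have qq : 0 <= q <= 1 by lra.
have oq : 0 <= 1 - q <= 1 by lra.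
have /andP[f0 f1] := h2 _ qq; have /andP[_ f2] := h2 _ oq; rewrite fbeta_onem in f2.
have W1 := powR_ge0 q (gam - 1); have W2 := powR_ge0 (1 - q) (gam - 1).
have pq0 := normr_ge0 (p - q).
have [p0|p0] := eqVneq p 0.
  rewrite p0 fbeta0 !sub0r !normrN (ger0_norm f0) ger0_norm; last by lra.
  apply: le_trans f1 _; rewrite -(mulr_powRB1 _ gg); last by lra.
  have := mulr_ge0 (ltW C0) W1; have := mulr_ge0 (ltW C0) W2; have := mulr_ge0 (ltW C20) W2.
  rewrite mulrA; move: (q `^ _) W1 ((1 - q) `^ _) W2 => X X0 Y Y0; nra.
have [p1|p1] := eqVneq p 1.
  rewrite p1 fbeta1 sub0r normrN (ger0_norm f0) ger0_norm; last by lra.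
  apply: le_trans f2 _; rewrite -(mulr_powRB1 _ gg); last by lra.
  rewrite mulrA; move: (q `^ _) W1 ((1 - q) `^ _) W2 => X X0 Y Y0.
  have o0 : 0 <= 1 - q by lra.
  have := mulr_ge0 (mulr_ge0 (ltW C20) o0) X0.
  have := mulr_ge0 (mulr_ge0 (ltW C0) o0) X0.
  have := mulr_ge0 (mulr_ge0 (ltW C0) o0) Y0.
  lra.
have pp : 0 < p < 1 by move: p0 p1 p01; rewrite !lt_neqAle eq_sym => -> -> /andP[-> ->].
pose g x := C * (x `^ gam - (1 - x) `^ gam).
pose g' x := C1 * (x `^ (gam - 1) + (1 - x) `^ (gam - 1)).
have dg x : 0 < x < 1 -> is_der x g (g' x).
  move=> /andP[x0 x1]; rewrite /g /g'; apply: is_der_eq.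
    apply: is_der_mul; first exact: is_der_cst.
    by apply: is_der_add; [exact: is_der_powR|apply: is_der_opp; exact: is_der_powR_onem].
  by cbv beta; rewrite /C; field; lra.
have key x y : 0 < x < 1 -> 0 < y < 1 -> x <= y ->
    `|fbeta b y - fbeta b x| <= g y - g x.
  move=> x01 y01 xy.
  apply: (@derive_norm_le _ (fbeta b) dfbeta g g') => // t txy.
  - by apply: is_der_fbeta; lra.
  - by apply: dg; lra.
  - by apply: h1; lra.
have hg : `|fbeta b p - fbeta b q| <= `|g p - g q|.
  have [pq|qp] := leP p q; last first.
    by apply: le_trans (key _ _ q01 pp (ltW qp)) _; exact: ler_norm.
  rewrite distrC (distrC (g p)).
  by apply: le_trans (key _ _ pp q01 pq) _; exact: ler_norm.
apply: le_trans hg _.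
have -> : g p - g q = C * ((p `^ gam - q `^ gam) - ((1 - p) `^ gam - (1 - q) `^ gam)).
  by rewrite /g; ring.
rewrite normrM (gtr0_norm C0).
apply: (@le_trans _ _ (C * (`|p - q| * (q `^ (gam - 1) + (1 - q) `^ (gam - 1))))).
  rewrite ler_pM2l// (le_trans (ler_normB _ _))// mulrDr lerD//.
    by apply: powR_diff_le; lra.
  have -> : `|p - q| = `|1 - p - (1 - q)|.
    by rewrite distrC; congr (`|_|); ring.
  by apply: powR_diff_le; lra.
rewrite mulrA ler_wpM2r ?addr_ge0// ler_wpM2r//; lra.
Qed.

End B.
End Fbeta.

(** * The profile f_beta(Phi_a) and its distance from f_beta of the eigenvalues *)

Section Profile.
Variables (R : realType) (a : nat) (b : R).
Hypothesis hb : 1 / 2 < b.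
Implicit Types (x y p q r : R).

Definition prof x : R := fbeta b (Phi a x).
Definition dprof x : R := - dfbeta b (Phi a x) * hsq a x.
Local Notation gm := (gam b).

Let gm1 : 1 / 2 < gm. Proof. by case/andP: (gam_bounds hb). Qed.
Let gm2 : gm < 1. Proof. by case/andP: (gam_bounds hb). Qed.

Lemma Phi_lower2 : exists2 c : R, 0 < c & forall x,
  c * expR (- (x ^+ 2 / 2) - `|x|) <= Phi a x /\
  c * expR (- (x ^+ 2 / 2) - `|x|) <= 1 - Phi a x.
Proof.
have [c c0 hc] := @Phi_lower R a; exists c => // x.
wlog x0 : x / 0 <= x.
  move=> h; have [x0|x0] := leP 0 x; first exact: h.
  have /h : 0 <= - x by lra.
  by rewrite sqrrN normrN PhiN opprB addrCA subrr addr0 => -[].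
rewrite ger0_norm//; have := hc x x0 => h; split => //.
rewrite -PhiN; apply: le_trans h _; apply: Phi_noninc; lra.
Qed.

Lemma Phi_in01 x : 0 < Phi a x < 1.
Proof.
have [c c0 /(_ x)[h1 h2]] := Phi_lower2.
have := mulr_gt0 c0 (expR_gt0 (- (x ^+ 2 / 2) - `|x|)); lra.
Qed.

Lemma is_der_prof x : is_der x prof (dprof x).
Proof.
apply: is_der_eq; first apply: (@is_der_comp _ (fbeta b) (Phi a)).
- exact: (is_der_fbeta hb (Phi_in01 x)).
- exact: is_der_Phi.
by rewrite /dprof; ring.
Qed.

Lemma prof_even x : prof (- x) = prof x.
Proof. by rewrite /prof PhiN fbeta_onem. Qed.

Lemma dprof_odd x : dprof (- x) = - dprof x.
Proof. by rewrite /dprof PhiN dfbeta_onem hsqN; ring. Qed.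

Lemma continuous_Phi : continuous (@Phi R a).
Proof. exact: (continuous_of_der (f' := fun x => - hsq a x) (is_der_Phi a)). Qed.

Lemma continuous_dprof : continuous dprof.
Proof.
move=> x; apply: cvgM; last exact: continuous_hsq.
apply: cvgN; apply: (@cvg_comp _ _ _ (Phi a) (dfbeta b)); first exact: continuous_Phi.
exact: (dfbeta_continuous hb (Phi_in01 x)).
Qed.

(** The lower bound on [Phi] has rate 1/2, so its power gm - 1 has rate (1 - gm)/2; a slightly
    larger k absorbs the linear term in |x|. *)
Lemma weight_le (k : R) : (1 - gm) / 2 < k -> exists2 C, 0 < C & forall x,
  Phi a x `^ (gm - 1) + (1 - Phi a x) `^ (gm - 1) <= C * expR (k * x ^+ 2).
Proof.
move=> hk; have [c c0 hc] := Phi_lower2; have [A A0 hA] := gauss_absorb hk.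
have m0 : 0 < 1 - gm by move: gm2; lra.
exists (2 * (c `^ (gm - 1) * A)); first by rewrite !mulr_gt0// powR_gt0.
move=> x; have [h1 h2] := hc x.
have key p : c * expR (- (x ^+ 2 / 2) - `|x|) <= p -> p `^ (gm - 1) <= c `^ (gm - 1) * (A * expR (k * x ^+ 2)).
  set t := expR _ => h; have t0 : 0 < t by exact: expR_gt0.
  have ct0 : 0 < c * t by rewrite mulr_gt0.
  have p0 : 0 < p by exact: lt_le_trans h.
  apply: (@le_trans _ _ ((c * t) `^ (gm - 1))).
    rewrite -opprB !powRN lef_pV2 ?posrE ?powR_gt0//.
    by apply: powR_le_base => //; exact: ltW.
  rewrite powRM ?(ltW c0) ?(ltW t0)// ler_pM2l ?powR_gt0//.
  rewrite /t -expRM.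
  have := hA x.
  have -> : - ((1 - gm) / 2 * x ^+ 2) - `|x| = - ((1 - gm) / 2 * x ^+ 2 + `|x|) by ring.
  rewrite !expRN ler_pdivlMr ?expR_gt0// mulrC ler_pdivrMr ?expR_gt0//.
  move=> h3; apply: le_trans _ h3; rewrite ler_expR.
  have : gm * `|x| >= 0 by apply: mulr_ge0 => //; move: gm1; lra.
  lra.
have := key _ h1; have := key _ h2.
have -> : 2 * (c `^ (gm - 1) * A) * expR (k * x ^+ 2) = 2 * (c `^ (gm - 1) * (A * expR (k * x ^+ 2))) by ring.
lra.
Qed.

Lemma dprof_le : exists c C, [/\ 0 < c, 0 < C & forall x, `|dprof x| <= C * expR (- (c * x ^+ 2))].
Proof.
pose k := ((1 - gm) / 2 + 4^-1) / 2.
have k1 : (1 - gm) / 2 < k by rewrite /k; move: gm1; lra.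
have k2 : k < 4^-1 by rewrite /k; move: gm1; lra.
have [C1 C10 h1] := dfbeta_le hb; have [C2 C20 h2] := weight_le k1.
have d2 : 4^-1 < 2^-1 :> R by lra.
have [C3 C30 h3] := hsq_gauss a d2.
exists (4^-1 - k), (C1 * C2 * C3); split; first by lra.
  by rewrite !mulr_gt0.
move=> x; rewrite /dprof normrM normrN (ger0_norm (hsq_ge0 _ _)).
have -> : C1 * C2 * C3 * expR (- ((4^-1 - k) * x ^+ 2)) =
   C1 * (C2 * expR (k * x ^+ 2)) * (C3 * expR (- (4^-1 * x ^+ 2))).
  have -> : - ((4^-1 - k) * x ^+ 2) = k * x ^+ 2 + - (4^-1 * x ^+ 2) by ring.
  by rewrite expRD; ring.
apply: ler_pM => //; first exact: hsq_ge0.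
apply: le_trans (h1 _ (Phi_in01 x)) _.
by rewrite ler_pM2l.
Qed.

Lemma prof_le : exists c C, [/\ 0 < c, 0 < C & forall x, 0 <= prof x <= C * expR (- (c * x ^+ 2))].
Proof.
have [C1 C10 h1] := fbeta_le hb.
have d2 : 0 < (4^-1 : R) < 2^-1 by apply/andP; split; lra.
have [C2 C20 h2] := Phi_upper a d2.
exists (4^-1 * gm), (C1 * C2 `^ gm); split; first by move: gm1; lra.
  by rewrite mulr_gt0// powR_gt0.
move=> x; wlog x0 : x / 0 <= x.
  move=> h; have [x0|x0] := leP 0 x; first exact: h.
  have /h : 0 <= - x by lra.
  by rewrite sqrrN prof_even.
have p01 : 0 <= Phi a x <= 1 by rewrite Phi_ge0 Phi_le1.
have /andP[-> h3] /= := h1 _ p01.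
apply: le_trans h3 _; rewrite -mulrA ler_pM2l//.
have := h2 _ x0; set t := expR _ => h4.
apply: (@le_trans _ _ ((C2 * t) `^ gm)).
  by apply: powR_le_base => //; [move: gm1; lra|exact: Phi_ge0].
rewrite powRM ?(ltW C20) ?expR_ge0// ler_pM2l ?powR_gt0//.
by rewrite /t -expRM ler_expR; have := sqr_ge0 x; lra.
Qed.

Hypothesis Hlam : forall k r, 0 < r -> 0 <= lam a k r <= 1.

Lemma fbeta_lam_close : exists c C r0, [/\ 0 < c, 0 < C, 1 <= r0 &
  forall k r X, r0 <= r -> r ^+ 2 / 4 <= k%:R -> X = 2 * (Num.sqrt k%:R - r) ->
  `|fbeta b (lam a k r) - prof X| <= C / r * expR (- (c * X ^+ 2))].
Proof.
(* [k0] lies strictly between (1 - gm)/2 and 1/4, an interval that is non-empty because gm > 1/2.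
   With [d] between [k0] and 1/4, the decay left over is d - k0. *)
pose k0 := ((1 - gm) / 2 + 4^-1) / 2.
have k1 : (1 - gm) / 2 < k0 by rewrite /k0; move: gm1; lra.
have k2 : k0 < 4^-1 by rewrite /k0; move: gm1; lra.
pose d := (k0 + 4^-1) / 2.
have d1 : 0 < d < 4^-1 by rewrite /d; apply/andP; split; move: gm2; lra.
have dk : k0 < d by rewrite /d; lra.
have [C1 C10 h1] := fbeta_diff hb; have [C2 C20 h2] := weight_le k1.
have [E1 [E2 [_ _ hE hl]]] := @lam_expansion R a.
have [C3 C30 h3] := hE d d1; have [C4 [r0 [C40 r01 h4]]] := hl d d1.
exists (d - k0), (C1 * (3 * C3 + C4) * C2), r0; split => //; first by lra.
  by rewrite !mulr_gt0// addr_gt0// mulr_gt0.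
move=> k r X rr kr XE.
have r1 : 1 <= r by lra.
have r00 : 0 < r by lra.
apply: le_trans (h1 _ _ (Hlam k r00) (Phi_in01 X)) _.
have -> : C1 * (3 * C3 + C4) * C2 / r * expR (- ((d - k0) * X ^+ 2)) =
  C1 * ((3 * C3 + C4) / r * expR (- (d * X ^+ 2))) * (C2 * expR (k0 * X ^+ 2)).
  have -> : - ((d - k0) * X ^+ 2) = - (d * X ^+ 2) + k0 * X ^+ 2 by ring.
  by rewrite expRD; ring.
apply: ler_pM => //; first by apply: mulr_ge0 => //; exact: ltW.
  by apply: addr_ge0; exact: powR_ge0.
rewrite ler_pM2l//.
have [e1 e2] := h3 X; have := h4 k r X rr kr XE.
set G := expR _ in e1 e2 *; have G0 : 0 < G by exact: expR_gt0.
have K0 : 0 < k%:R :> R by apply: lt_le_trans kr; nra.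
set K := Num.sqrt k%:R.
have K0' : 0 < K by rewrite sqrtr_gt0.
have Kr : r / 2 <= K.
  by rewrite -(@ler_pXn2r _ 2) ?nnegrE ?sqr_sqrtr ?ler0n//; lra.
have dK : K^-1 <= 2 / r.
  by rewrite -[2 / r]invrK lef_pV2 ?posrE ?invr_gt0 ?divr_gt0// invf_div.
move=> h5.
have b1 : `|E1 X / K| <= C3 * G * (2 / r).
  rewrite normrM (@ger0_norm _ K^-1); last by rewrite invr_ge0 ltW.
  by apply: ler_pM => //; rewrite invr_ge0 ltW.
have b2 : `|E2 X / r| <= C3 * G / r.
  rewrite normrM (@ger0_norm _ r^-1); last by rewrite invr_ge0 ltW.
  by rewrite ler_pM2r ?invr_gt0.
have b3 : C4 / r ^+ 2 * G <= C4 / r * G.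
  rewrite ler_pM2r// ler_pM2l// lef_pV2 ?posrE ?exprn_gt0//; nra.
have -> : lam a k r - Phi a X = (lam a k r - Phi a X - E1 X / K - E2 X / r) + (E1 X / K + E2 X / r) by ring.
rewrite (le_trans (ler_normD _ _))//.
have := ler_normD (E1 X / K) (E2 X / r).
have -> : (3 * C3 + C4) / r * G = C3 * G * (2 / r) + C3 * G / r + C4 / r * G by ring.
lra.
Qed.

(** Splitting T^k = 2^k (T/2)^k gives the bound e^{-T} e^{T/4} e^{T/2}, since 2^k <= e^k <=
    e^{T/4}. *)
Lemma pois_low k (T : R) : k%:R <= T / 4 -> 0 <= T -> pois k T <= expR (- (T / 4)).
Proof.
move=> kT T0.
have h1 : (T / 2) ^+ k / k`!%:R <= expR (T / 2).
  case: k {kT} => [|k]; first by rewrite expr0 fact0 divr1; have := expR_ge1Dx (T / 2); lra.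
  by have := @expR_ge1Dxn R (T / 2) k ltac:(lra); lra.
have h2 : 2 ^+ k <= expR (T / 4).
  apply: (@le_trans _ _ (expR k%:R)); last by rewrite ler_expR.
  rewrite -[k%:R]mulr1 expRM_natl lerXn2r ?nnegrE ?expR_ge0//.
  by have := expR_ge1Dx (1 : R); lra.
have -> : pois k T = expR (- T) * (2 ^+ k * ((T / 2) ^+ k / k`!%:R)).
  by rewrite /pois -!mulrA; congr (_ * _); rewrite mulrA -exprMn; congr (_ ^+ _ * _); field.
have -> : - (T / 4) = - T + (T / 4 + T / 2) by field.
rewrite expRD (expRD (T / 4)) ler_pM2l ?expR_gt0//.
apply: ler_pM => //.
by rewrite divr_ge0// exprn_ge0// divr_ge0.
Qed.

(** Serves the range k <= r^2/4, outside that of [lam_expansion]. There 1 - ptail is a sum of at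
    most r^2/4 + 1 small weights, and the Charlier factor is polynomial in r because |X| <= 2 r. *)
Lemma lam_low : exists2 C, 0 < C & forall k r, 1 <= r -> k%:R <= r ^+ 2 / 4 ->
  1 - lam a k r <= C * expR (- (r ^+ 2 / 8)).
Proof.
pose P (e : R) : Prop := 0 < e <= 1.
have hp : polyb P (fun e x => chcor a e (x + e * (x ^+ 2 / 4))).
  have [D' [[p1 p2 [Z' p3 p4]] _ _]] := @expn_chcor R a.
  rewrite (_ : (fun e x => _) = fun e x => hecor a x + e * D' x + e ^+ 2 * Z' e x); last first.
    by apply/funext => e; apply/funext => x; exact: p4.
  have pe : polyb P (fun e (_ : R) => e).
    by apply: polyb_param => e /andP[e0 e1]; rewrite ger0_norm// ltW.
  do ![apply: polyb_add | apply: polyb_mul | apply: polyb_exp | exact: pe | exact: p1 | exact: p2 | exact: p3].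
have [C [n hC]] := hp.
(* At x = 2 r the exponent is r^2/8, half of the r^2/4 that the Poisson weight supplies. *)
have [A A0 hA] := @poly_le_expR R (n + 2) (8^-1 / 4) ltac:(lra).
exists (A * (2 + `|C|)); first by rewrite mulr_gt0// ltr_pwDl.
move=> k r r1 kr; have r0 : 0 < r by lra.
have r20 : 0 <= r ^+ 2 by exact: sqr_ge0.
pose K : R := Num.sqrt k%:R; pose X := 2 * (K - r).
have K2 : K ^+ 2 = k%:R by rewrite sqr_sqrtr ?ler0n.
have K0 : 0 <= K by exact: sqrtr_ge0.
have Kr : K <= r / 2 by rewrite -(@ler_pXn2r _ 2) ?nnegrE ?K2//; lra.
have lE : lam a k r = ptail k (r ^+ 2) + r * pois k (r ^+ 2) * chcor a r^-1 (X + r^-1 * (X ^+ 2 / 4)).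
  rewrite /lam; congr (_ + _ * chcor _ _ _).
  by rewrite -K2 /X; field; lra.
have Pe : P r^-1 by rewrite /P invr_gt0 r0 invf_le1.
have := hC r^-1 X Pe; rewrite lE; set ch := chcor _ _ _ => hch.
set T := r ^+ 2; set q := expR (- (T / 4)).
have q0 : 0 < q by exact: expR_gt0.
have h1 : 1 - ptail k T <= (T / 4 + 1) * q.
  rewrite /ptail opprB addrCA subrr addr0.
  apply: (@le_trans _ _ (\sum_(j < k.+1) q)).
    apply: ler_sum => j _; apply: pois_low => //.
    by apply: le_trans kr; rewrite ler_nat -ltnS.
  rewrite sumr_const card_ord -[q *+ _]mulr_natl ler_pM2r//.
  have e1 : k.+1%:R = k%:R + 1 :> R by rewrite natr1.
  by rewrite e1; rewrite -/T in kr; lra.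
have pk : 0 <= pois k T <= q by rewrite pois_ge0//= pois_low.
have X2 : `|X| <= 2 * r by rewrite ler0_norm /X; lra.
set B := 1 + 2 * r.
have B1 : 1 <= B by rewrite /B; lra.
have h2 : `|ch| <= `|C| * B ^+ n.
  apply: le_trans hch _; apply: (@le_trans _ _ (`|C| * (1 + `|X|) ^+ n)).
    by rewrite ler_wpM2r ?ler_norm// exprn_ge0// addr_ge0.
  by rewrite ler_wpM2l// lerXn2r ?nnegrE ?addr_ge0//; rewrite /B; lra.
have Bn : 1 <= B ^+ n by exact: exprn_ege1.
have BE : B ^+ (n + 2) = B ^+ n * B ^+ 2 by rewrite exprD.
have h3 : - (r * pois k T * ch) <= q * (`|C| * B ^+ (n + 2)).
  apply: (@le_trans _ _ (r * pois k T * `|ch|)).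
    by rewrite -mulrN; apply: ler_wpM2l; [apply: mulr_ge0; lra|rewrite -normrN ler_norm].
  have -> : q * (`|C| * B ^+ (n + 2)) = (B ^+ 2 * q) * (`|C| * B ^+ n) by rewrite BE; ring.
  apply: ler_pM => //; first by apply: mulr_ge0; lra.
  apply: ler_pM; [lra|lra| |lra].
  by rewrite /B; have := sqr_ge0 r; lra.
have h4 : (T / 4 + 1) * q <= q * (2 * B ^+ (n + 2)).
  rewrite mulrC ler_pM2l// BE.
  apply: (@le_trans _ _ (2 * B ^+ 2)).
    by rewrite /B -/T /T; have := sqr_ge0 r; lra.
  rewrite ler_pM2l// ler_peMl// exprn_ge0//; lra.
have h5 : B ^+ (n + 2) <= A * expR (T / 8).
  have := hA (2 * r); rewrite ger0_norm; last by lra.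
  by have -> : 8^-1 / 4 * (2 * r) ^+ 2 = T / 8 by rewrite /T; field.
have -> : 1 - (ptail k T + r * pois k T * ch) = (1 - ptail k T) - r * pois k T * ch by ring.
apply: (@le_trans _ _ (q * (B ^+ (n + 2) * (2 + `|C|)))).
  have -> : q * (B ^+ (n + 2) * (2 + `|C|)) = q * (2 * B ^+ (n + 2)) + q * (`|C| * B ^+ (n + 2)) by ring.
  lra.
have -> : A * (2 + `|C|) * expR (- (T / 8)) = q * (A * expR (T / 8) * (2 + `|C|)).
  have -> : - (T / 8) = - (T / 4) + T / 8 by field.
  by rewrite expRD -/q; ring.
rewrite ler_pM2l// ler_wpM2r// addr_ge0//.
Qed.

End Profile.

(** * Summation over the eigenvalues *)

Section StrictDifferentiability.
Variable R : realType.

(** Both points move, so differentiability at [p] alone is too weak; continuity of the derivative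
    gives |f u - f v - f' p (u - v)| <= eps |u - v| near [p]. *)
Lemma cvg_strict_diff (T : Type) (F : set_system T) (FF : Filter F)
  (f f' : R -> R) (p l : R) (u v s : T -> R) :
  (\forall t \near p, is_der t f (f' t)) -> {for p, continuous f'} ->
  u @ F --> p -> v @ F --> p -> (fun t => s t * (u t - v t)) @ F --> l ->
  (fun t => s t * (f (u t) - f (v t))) @ F --> f' p * l.
Proof.
move=> df cf' up vp sl.
have -> : (fun t => s t * (f (u t) - f (v t))) = (fun t => f' p * (s t * (u t - v t)) +
   s t * (f (u t) - f (v t) - f' p * (u t - v t))) by apply/funext => t; ring.
rewrite -[X in _ --> X]addr0; apply: cvgD; first by apply: cvgM => //; exact: cvg_cst.
apply/cvgr0Pnorm_le => e e0.
have l0 : 0 < `|l| + 1 by rewrite ltr_pwDr.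
have eta0 : 0 < e / (`|l| + 1) by rewrite divr_gt0.
have [d d0 hd] : exists2 d, 0 < d & forall t, `|t - p| < d ->
    is_der t f (f' t) /\ `|f' t - f' p| <= e / (`|l| + 1).
  have : \forall t \near p, is_der t f (f' t) /\ `|f' t - f' p| <= e / (`|l| + 1).
    near=> t; split; first by near: t.
    rewrite distrC; near: t; exact: (@cvgr_dist_le _ _ _ _ _ _ _ cf').
  move=> /nbhs_ballP[d /= d0 hd]; exists d => // t td; apply: hd.
  by rewrite /ball/= distrC.
near=> t.
have ut : `|u t - p| < d by rewrite distrC; near: t; exact: (@cvgr_dist_lt _ _ _ _ _ _ _ up).
have vt : `|v t - p| < d by rewrite distrC; near: t; exact: (@cvgr_dist_lt _ _ _ _ _ _ _ vp).
have st : `|s t * (u t - v t)| <= `|l| + 1.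
  have h : `|l - s t * (u t - v t)| <= 1 by near: t; exact: (@cvgr_dist_le _ _ _ _ _ _ _ sl).
  have := ler_normD (s t * (u t - v t) - l) l; rewrite subrK distrC; lra.
have key x y : `|x - p| < d -> `|y - p| < d -> x <= y ->
    `|f y - f x - f' p * (y - x)| <= e / (`|l| + 1) * (y - x).
  move=> hx hy xy.
  have := @derive_norm_le R (fun t => f t - f' p * t) (fun t => f' t - f' p)
    (fun t => e / (`|l| + 1) * t) (fun=> e / (`|l| + 1)) x y xy.
  have hz z : x <= z <= y -> `|z - p| < d.
    move=> /andP[xz zy]; move: hx hy; rewrite !ltr_norml => /andP[? ?] /andP[? ?].
    by apply/andP; split; lra.
  have -> : f y - f x - f' p * (y - x) = f y - f' p * y - (f x - f' p * x) by ring.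
  rewrite mulrBr; apply.
  - move=> z /hz/hd[h _]; apply: is_der_eq.
      by apply: is_der_add; [exact: h|repeat der1].
    by cbv beta; ring.
  - by move=> z _; der; ring.
  - by move=> z /hz/hd[].
have hfin : `|f (u t) - f (v t) - f' p * (u t - v t)| <= e / (`|l| + 1) * `|u t - v t|.
  have [uv|vu] := leP (v t) (u t).
    by rewrite [X in _ <= _ * X]ger0_norm ?subr_ge0//; exact: key.
  rewrite -normrN [X in _ <= _ * X]distrC [X in _ <= _ * X]ger0_norm ?subr_ge0 ?(ltW vu)//.
  have -> : - (f (u t) - f (v t) - f' p * (u t - v t)) = f (v t) - f (u t) - f' p * (v t - u t) by ring.
  by apply: key => //; exact: ltW.
rewrite normrM; apply: (@le_trans _ _ (`|s t| * (e / (`|l| + 1) * `|u t - v t|))).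
  by rewrite ler_wpM2l.
rewrite mulrCA -normrM mulrAC ler_pdivrMr//.
by rewrite ler_pM2l.
Unshelve. all: by end_near. Qed.

(** Second order Taylor formula with a moving base point: the continuity of f'' at the limit point
    makes the remainder uniform. *)
Lemma cvg_taylor2 (f f' f'' : R -> R) (p : R) (u : R -> R) :
  (forall t, is_der t f (f' t)) -> (forall t, is_der t f' (f'' t)) ->
  {for p, continuous f''} -> u r @[r --> +oo] --> p ->
  r * (r * (f (u r + r^-1) - f (u r)) - f' (u r)) @[r --> +oo] --> f'' p / 2.
Proof.
move=> df df' cf up.
have ri : r^-1 @[r --> +oo] --> (0 : R).
  apply/gtr0_cvgV0; last exact: cvg_id.
  by near=> t; near: t; apply: nbhs_pinfty_gt; rewrite num_real.
apply/cvgrPdist_le => e e0.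
have [d d0 hd] : exists2 d, 0 < d & forall t, `|t - p| < d -> `|f'' t - f'' p| <= e.
  have : \forall t \near p, `|f'' p - f'' t| <= e.
    by near=> t; near: t; exact: (@cvgr_dist_le _ _ _ _ _ _ _ cf).
  move=> /nbhs_ballP[d /= d0 hd]; exists d => // t td; rewrite distrC; apply: hd.
  by rewrite /ball/= distrC.
have d2 : 0 < d / 2 by rewrite divr_gt0.
near=> r.
have r0 : 0 < r by near: r; apply: nbhs_pinfty_gt; rewrite num_real.
have ur : `|u r - p| < d / 2.
  by rewrite distrC; near: r; exact: (@cvgr_dist_lt _ _ _ _ _ _ _ up).
have hr : r^-1 < d / 2.
  have : `|0 - r^-1| < d / 2 by near: r; exact: (@cvgr_dist_lt _ _ _ _ _ _ _ ri).
  by rewrite sub0r normrN gtr0_norm// invr_gt0.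
have h0 : 0 < r^-1 by rewrite invr_gt0.
set y := u r; set h := r^-1.
have hz z : y <= z <= y + h -> `|z - p| < d.
  move=> /andP[yz zy]; move: ur; rewrite !ltr_norml -/y => /andP[? ?].
  by move: hr; rewrite -/h => ?; apply/andP; split; lra.
have k1 z : y <= z <= y + h -> `|f' z - f' y - f'' p * (z - y)| <= e * (z - y).
  move=> /andP[yz zy].
  have := @derive_norm_le R (fun t => f' t - f'' p * t) (fun t => f'' t - f'' p)
    (fun t => e * t) (fun=> e) y z yz.
  have -> : f' z - f' y - f'' p * (z - y) = f' z - f'' p * z - (f' y - f'' p * y) by ring.
  rewrite mulrBr; apply.
  - move=> w _; have := df' w => hw; by der; ring.
  - by move=> w _; der; ring.
  - move=> w /andP[yw wz]; apply: hd; apply: hz; apply/andP; split; lra.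
have yh : y <= y + h by rewrite lerDl ltW.
have := @derive_norm_le R (fun t => f t - f' y * t - f'' p * ((t - y) ^+ 2 / 2))
   (fun t => f' t - f' y - f'' p * (t - y))
   (fun t => e * ((t - y) ^+ 2 / 2)) (fun t => e * (t - y)) y (y + h) yh.
have A1 z : y <= z <= y + h -> is_der z (fun t => f t - f' y * t - f'' p * ((t - y) ^+ 2 / 2)) (f' z - f' y - f'' p * (z - y)).
  by move=> _; have := df z => hw; der; rewrite /predn; field.
have A2 z : y <= z <= y + h -> is_der z (fun t => e * ((t - y) ^+ 2 / 2)) (e * (z - y)).
  by move=> _; der; rewrite /predn; field.
move=> /(_ A1 A2 k1) hfin.
rewrite distrC.
have -> : r * (r * (f (y + h) - f y) - f' y) - f'' p / 2 =
  r ^+ 2 * (f (y + h) - f' y * (y + h) - f'' p * ((y + h - y) ^+ 2 / 2) - (f y - f' y * y - f'' p * ((y - y) ^+ 2 / 2))).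
  by rewrite /h; field; rewrite gt_eqF.
rewrite normrM ger0_norm ?sqr_ge0//.
apply: (@le_trans _ _ (r ^+ 2 * (e * ((y + h - y) ^+ 2 / 2) - e * ((y - y) ^+ 2 / 2)))).
  by rewrite ler_pM2l// exprn_gt0.
have -> : r ^+ 2 * (e * ((y + h - y) ^+ 2 / 2) - e * ((y - y) ^+ 2 / 2)) = e / 2.
  by rewrite /h; field; rewrite gt_eqF.
lra.
Unshelve. all: by end_near. Qed.

End StrictDifferentiability.

(** * Means of the profile over the cells *)

Section Blocks.
Variables (R : realType) (a : nat) (b : R).
Hypothesis hb : 1 / 2 < b.
Hypothesis Hlam : forall k (r : R), 0 < r -> 0 <= lam a k r <= 1.
Implicit Types (x y p q r : R).
Local Notation mu := (@lebesgue_measure R).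
Local Notation F := (prof a b).
Local Notation dF := (dprof a b).

Lemma continuous_prof : continuous F.
Proof. exact: (continuous_of_der (f' := dF) (is_der_prof a hb)). Qed.

Lemma integrable_expR_sqr (c : R) : 0 < c -> mu.-integrable setT (fun x => (expR (- (c * x ^+ 2)))%:E).
Proof.
move=> c0; pose s := Num.sqrt (2 * c)^-1.
have s0 : 0 < s by rewrite sqrtr_gt0 invr_gt0 mulr_gt0.
have := @integrable_normal_pdf R 0 s.
move=> /(@integrableZl _ _ _ mu setT measurableT (normal_peak s)^-1) h.
apply: eq_integrable h => // x _ /=.
rewrite -EFinM normal_pdfE ?gt_eqF// mulKf; last first.
  by rewrite gt_eqF// normal_peak_gt0// gt_eqF.
rewrite /normal_fun subr0 /s sqr_sqrtr ?invr_ge0; last by rewrite mulr_ge0// ltW.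
by congr (expR _)%:E; field; rewrite gt_eqF.
Qed.

Lemma integrable_prof : mu.-integrable setT (fun x => (F x)%:E).
Proof.
have [c [C [c0 C0 hC]]] := prof_le a hb.
have h := @integrableZl _ _ _ mu setT measurableT C _ (integrable_expR_sqr c0).
apply: (le_integrable measurableT _ _ h).
  by apply/measurable_EFinP; apply: continuous_measurable_fun; exact: continuous_prof.
move=> x _; have /andP[p0 p1] := hC x.
rewrite abse_EFin ger0_norm// -EFinM abse_EFin lee_fin (le_trans p1)// ler_norm//.
Qed.

Definition IF x : R := \int[mu]_(t in `]-oo, x]) F t.

Lemma is_der_IF x : is_der x IF (F x).
Proof.
have x1 : x < x + 1 by rewrite ltrDl.
have hi : mu.-integrable `]-oo, (x + 1)] (EFin \o F).
  by apply: (@integrableS _ _ _ mu setT) => //; exact: integrable_prof.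
have [h1 h2] := @continuous_FTC1 R F -oo%O x (x + 1) x1 hi (ltNyr _) (@continuous_prof x).
by apply: DeriveDef; [exact: h1|rewrite -h2 derive1E].
Qed.

Definition xk (k : nat) r : R := (k%:R - r ^+ 2) / r.
(** The mean of the profile over the k-th cell, whose left end is [xk k r] and whose length is
    1/r. *)
Definition Fbar (k : nat) r : R := r * (IF (xk k r + r^-1) - IF (xk k r)).

Lemma xkE k r X : 0 < r -> X = 2 * (Num.sqrt k%:R - r) -> xk k r = X + X ^+ 2 / (4 * r).
Proof.
move=> r0 ->; rewrite /xk -[in LHS](@sqr_sqrtr _ k%:R) ?ler0n//.
by field; rewrite gt_eqF.
Qed.

Lemma Fbar_close : exists c C, [/\ 0 < c, 0 < C &
  forall k r X, 1 <= r -> X = 2 * (Num.sqrt k%:R - r) ->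
  `|F X - Fbar k r| <= C / r * expR (- (c * X ^+ 2))].
Proof.
have [c [C [c0 C0 hC]]] := dprof_le a hb.
have hp : polyb (fun _ : unit => True) (fun _ (x : R) => x ^+ 2 / 4 + 1).
  apply: polyb_add; last exact: polyb_cst.
  by apply: polyb_mul; [apply: polyb_exp; exact: polyb_id|exact: polyb_cst].
have c32 : c / 32 < c / 16 by lra.
have [A A0 hA] := polyb_gauss hp c32.
exists (c / 32), (C * expR c * A); split; first by rewrite divr_gt0.
  by rewrite !mulr_gt0// expR_gt0.
move=> k r X r1 XE; have r0 : 0 < r by lra.
have r10 : 0 < r^-1 by rewrite invr_gt0.
have r11 : r^-1 <= 1 by rewrite invf_le1.
have hx := xkE r0 XE; set y := xk k r in hx *.
have K0 := sqrtr_ge0 (k%:R : R).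
have X2r : - (2 * r) <= X by lra.
have q0 : 0 <= X ^+ 2 / (4 * r) by rewrite divr_ge0 ?sqr_ge0//; lra.
have q1 : X ^+ 2 / (4 * r) = X ^+ 2 / 4 * r^-1 by field; rewrite gt_eqF.
(* The rate c/16: for X <= -4 every z between X and the cell satisfies z <= X/2 + 1 <= X/4, and for
   -4 < X < 0 the factor e^c compensates. *)
pose B := C * expR c * expR (- (c / 16 * X ^+ 2)).
have hB t z : y <= t <= y + r^-1 -> Num.min X t <= z <= Num.max X t -> `|dF z| <= B.
  move=> /andP[yt ty] hz.
  apply: le_trans (hC z) _; rewrite /B -mulrA ler_pM2l// -expRD ler_expR.
  have [X0|X0] := leP 0 X.
    have Xz : X <= z.
      case/andP: hz => + _; apply: le_trans; rewrite le_min lexx/=; lra.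
    have : X ^+ 2 <= z ^+ 2 by rewrite lerXn2r ?nnegrE//; lra.
    move=> h; have := sqr_ge0 X => h2.
    have : c * X ^+ 2 <= c * z ^+ 2 by rewrite ler_pM2l.
    have : 0 <= c * X ^+ 2 by apply: mulr_ge0 => //; exact: ltW.
    lra.
  have y2 : y <= X / 2.
    rewrite hx; have : X ^+ 2 / (4 * r) <= - X / 2.
      rewrite ler_pdivrMr; last by lra.
      have : 0 <= - X * (X + 2 * r) by apply: mulr_ge0; lra.
      lra.
    lra.
  have zX : z <= X / 2 + 1.
    case/andP: hz => _ /le_trans; apply; rewrite ge_max; apply/andP; split; lra.
  have [X4|X4] := leP X (- 4).
    have : (X / 4) ^+ 2 <= z ^+ 2.
      rewrite -[(X / 4) ^+ 2]sqrrN -[z ^+ 2]sqrrN lerXn2r ?nnegrE//; lra.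
    move=> h; have : c * (X / 4) ^+ 2 <= c * z ^+ 2 by rewrite ler_pM2l.
    lra.
  have : X ^+ 2 <= 16.
    have : 0 <= (4 - X) * (4 + X) by apply: mulr_ge0; lra.
    lra.
  move=> h; have : c * X ^+ 2 <= c * 16 by rewrite ler_pM2l.
  have : 0 <= c * z ^+ 2 by apply: mulr_ge0; [exact: ltW|exact: sqr_ge0].
  lra.
have B0 : 0 < B by rewrite !mulr_gt0// expR_gt0.
have hF t : y <= t <= y + r^-1 -> `|F t - F X| <= B * ((X ^+ 2 / 4 + 1) / r).
  move=> yt; apply: (@le_trans _ _ (B * `|t - X|)).
    have key u v : u <= v -> (forall z, u <= z <= v -> `|dF z| <= B) -> `|F v - F u| <= B * (v - u).
      move=> uv hz; rewrite mulrBr.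
      apply: (@derive_norm_le _ F dF (fun t => B * t) (fun=> B)) => //.
      + by move=> z _; exact: is_der_prof.
      + move=> z _; apply: is_der_eq; first by apply: is_der_mul; [exact: is_der_cst|exact: is_der_id].
        by cbv beta; ring.
    have [Xt|tX] := leP X t.
      rewrite [X in _ <= _ * X]ger0_norm ?subr_ge0//; apply: key => // z hz.
      apply: (hB t z yt); rewrite min_l// max_r//.
    rewrite distrC [X in _ <= _ * X]distrC [X in _ <= _ * X]ger0_norm ?subr_ge0 ?(ltW tX)//.
    apply: key => [|z hz]; first exact: ltW.
    by apply: (hB t z yt); rewrite min_r ?max_l// ltW.
  rewrite ler_pM2l// mulrDl mul1r -q1 ger0_norm.
    by case/andP: yt => _; rewrite hx; lra.
  by case/andP: yt => + _; rewrite hx; lra.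
have yr : y <= y + r^-1 by lra.
have := @derive_norm_le R (fun t => IF t - F X * t) (fun t => F t - F X)
  (fun t => B * ((X ^+ 2 / 4 + 1) / r) * t) (fun=> B * ((X ^+ 2 / 4 + 1) / r)) y (y + r^-1) yr.
have A1 z : y <= z <= y + r^-1 -> is_der z (fun t => IF t - F X * t) (F z - F X).
  move=> _; apply: is_der_eq.
    apply: is_der_add; first exact: is_der_IF.
    by apply: is_der_opp; apply: is_der_mul; [exact: is_der_cst|exact: is_der_id].
  by cbv beta; move: (F X) (F z) => u v; ring.
have A2 z : y <= z <= y + r^-1 -> is_der z (fun t => B * ((X ^+ 2 / 4 + 1) / r) * t) (B * ((X ^+ 2 / 4 + 1) / r)).
  move=> _; apply: is_der_eq; first by apply: is_der_mul; [exact: is_der_cst|exact: is_der_id].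
  by cbv beta; ring.
move=> /(_ A1 A2 hF) h.
have -> : F X - Fbar k r = - (r * (IF (y + r^-1) - F X * (y + r^-1) - (IF y - F X * y))).
  rewrite /Fbar -/y; move: (F X) (IF (y + _)) (IF y) => u v w.
  by field; rewrite gt_eqF.
rewrite normrN normrM (gtr0_norm r0).
apply: (@le_trans _ _ (B * ((X ^+ 2 / 4 + 1) / r))).
  apply: le_trans (ler_wpM2l (ltW r0) h) _.
  by rewrite le_eqVlt; apply/orP; left; apply/eqP; field; rewrite gt_eqF.
have := hA tt X I; rewrite ger0_norm; last by rewrite addr_ge0// divr_ge0// sqr_ge0.
have Cr : 0 <= C * expR c / r by apply: divr_ge0; [apply: mulr_ge0; [exact: ltW|exact: expR_ge0]|exact: ltW].
move=> /(ler_wpM2l Cr) hh; apply: le_trans (le_trans _ hh) _.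
  by rewrite le_eqVlt; apply/orP; left; apply/eqP; rewrite /B; cbv beta; ring.
by rewrite le_eqVlt; apply/orP; left; apply/eqP; ring.
Qed.

End Blocks.

(** * Integrals over the line and measurability of the truncation *)

Section LebesgueLemmas.
Variable R : realType.
Local Notation mu := (@lebesgue_measure R).

Lemma integrable_expR_abs (c : R) : 0 < c -> mu.-integrable setT (fun x => (expR (- (c * `|x|)))%:E).
Proof.
move=> c0; pose f (x : R) := expR (- (c * `|x|)).
have cf : continuous f.
  move=> x; apply: (@cvg_comp _ _ _ (fun x => - (c * `|x|)) expR); last exact: continuous_expR.
  by apply: cvgN; apply: cvgM; [exact: cvg_cst|exact: norm_continuous].
have mf : measurable_fun setT f by exact: continuous_measurable_fun.
apply/integrableP; split; first exact/measurable_EFinP.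
under eq_integral do rewrite abse_EFin ger0_norm ?expR_ge0//.
have fe : f =1 f \o -%R by move=> x; rewrite /f/= normrN.
have f0 (x : R) : 0 <= f x by exact: expR_ge0.
rewrite (ge0_symfun_integralT f0 cf fe) -set_itvcy.
have dF (x : R) : is_der x (fun x => - (expR (- (c * x)) / c)) (expR (- (c * x))).
  by der; field; rewrite gt_eqF.
have -> : (\int[mu]_(x in `[0%R, +oo[) (f x)%:E = 0%:E - (- (expR (- (c * 0)) / c))%:E)%E.
  rewrite -(@ge0_continuous_FTC2y R (fun x => expR (- (c * x))) (fun x => - (expR (- (c * x)) / c)) 0 0).
  - apply: eq_integral => x; rewrite inE/= in_itv/= andbT => x0.
    by rewrite /f ger0_norm.
  - by move=> x _; exact: expR_ge0.
  - apply: continuous_subspaceT => x.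
    apply: (@cvg_comp _ _ _ (fun x => - (c * x)) expR); last exact: continuous_expR.
    by apply: cvgN; apply: cvgM; [exact: cvg_cst|exact: cvg_id].
  - rewrite -[X in _ --> X]oppr0; apply: cvgN; rewrite -[X in _ --> X](mul0r c^-1).
    apply: cvgM; last exact: cvg_cst.
    apply: (@cvg_comp _ _ _ (fun x => c * x) (fun x => expR (- x)) _ +oo).
      by apply: gt0_cvgMry => //; exact: cvg_id.
    exact: cvgr_expR.
  - by move=> x _; have [] := dF x.
  - by apply: cvg_at_right_filter; exact: (continuous_of_der dF).
  - by move=> x _; rewrite derive1E; have [_ ->] := dF x.
by rewrite -EFinB -EFinM ltry.
Qed.

Lemma integral_odd (f : R -> R) : measurable_fun setT f -> (forall x, f (- x) = - f x) ->
  \int[mu]_x f x = 0.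
Proof.
move=> mf fodd; rewrite /Rintegral.
have h (g : R -> \bar R) : measurable_fun setT g -> (forall x, 0 <= g x)%E ->
    (\int[mu]_x g (- x)%R = \int[mu]_x g x)%E.
  move=> mg g0; apply/esym.
  transitivity (\int[pushforward mu (-%R : _ -> measurableTypeR R)]_x g x)%E.
    by apply: eq_measure_integral => //= A mA _; exact/esym/lebesgue_measureN.
  by rewrite ge0_integral_pushforward.
rewrite integralE.
have mp : measurable_fun setT (fun x => (f x)%:E)^\+%E by apply: measurable_funepos; exact/measurable_EFinP.
have -> : (\int[mu]_x (fun x => (f x)%:E)^\- x = \int[mu]_x (fun x => (f x)%:E)^\+ x)%E.
  rewrite -[RHS]h//.
  by apply: eq_integral => x _; rewrite funeposE funenegE fodd.
(* If the common value of the two parts is infinite, so is their difference, and [fine] sends it to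
   0. *)
set I := (integral _ _ _); case: I => [v| |] //=.
by rewrite subrr.
Qed.

Lemma measurable_truncn : measurable_fun setT (Num.trunc : R -> nat).
Proof.
move=> _ A mA; rewrite setTI.
have -> : Num.trunc @^-1` A = \bigcup_(n in A) (Num.trunc @^-1` [set n] : set R).
  apply/seteqP; split => [x Ax|x [n An xn]]; first by exists (Num.trunc x).
  by rewrite /preimage/= xn.
apply: bigcup_measurable => n _.
have [->|n0] := eqVneq n 0%N.
  have -> : (Num.trunc : R -> nat) @^-1` [set 0%N] = `]-oo, 1[%classic.
    by apply/seteqP; split => x /=; rewrite in_itv/= ltNge => /truncn0Pn.
  exact: measurable_itv.
have -> : (Num.trunc : R -> nat) @^-1` [set n] = `[n%:R, n.+1%:R[%classic.
  apply/seteqP; split => x /=; rewrite in_itv/=; last exact: truncn_def.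
  move=> h; have x0 : 0 <= x.
    have : (0 < Num.trunc x)%N by rewrite h lt0n.
    by rewrite truncn_gt0; exact: le_trans.
  by have := truncn_itv x0; rewrite h.
exact: measurable_itv.
Qed.

End LebesgueLemmas.

(** * Domination and pointwise limit of the scaled error *)

Section Assembly.
Variables (R : realType) (a : nat) (b : R).
Hypothesis hb : 1 / 2 < b.
Hypothesis Hlam : forall k (r : R), 0 < r -> 0 <= lam a k r <= 1.
Implicit Types (x y p q r : R).
Local Notation mu := (@lebesgue_measure R).
Local Notation F := (prof a b).
Local Notation dF := (dprof a b).
Local Notation fl k r := (fbeta b (lam a k r)).

Lemma fl_ge0 k r : 0 < r -> 0 <= fl k r.
Proof. by have [C _ h] := fbeta_le hb => r0; have /andP[] := h _ (Hlam k r0). Qed.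

Lemma fl_low : exists c C, [/\ 0 < c, 0 < C & forall k r, 1 <= r -> k%:R <= r ^+ 2 / 4 ->
  fl k r <= C * expR (- (c * r ^+ 2))].
Proof.
have [C1 C10 h1] := fbeta_le hb; have [C2 C20 h2] := @lam_low R a.
have /andP[g1 g2] := gam_bounds hb.
exists (gam b / 8), (C1 * C2 `^ gam b); split; first by lra.
  by rewrite mulr_gt0// powR_gt0.
move=> k r r1 kr; have r0 : 0 < r by lra.
have l01 := Hlam k r0; have o01 : 0 <= 1 - lam a k r <= 1 by lra.
have /andP[_] := h1 _ o01; rewrite fbeta_onem => h; apply: le_trans h _.
rewrite -mulrA ler_pM2l//.
have := h2 k r r1 kr; set t := expR _ => h3.
apply: (@le_trans _ _ ((C2 * t) `^ gam b)).
  by apply: powR_le_base => //; lra.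
rewrite powRM ?(ltW C20) ?expR_ge0// ler_pM2l ?powR_gt0//.
by rewrite /t -expRM ler_expR; have := sqr_ge0 r; lra.
Qed.

(** For k >= r^2/4 the expansion of [lam] applies. For smaller k, X lies between -2 r and -r, and
    both terms are separately smaller than any Gaussian needed: [lam] is close to 1 and the profile
    is far out in its tail. *)
Lemma block_dom : exists c C r0, [/\ 0 < c, 0 < C, 1 <= r0 &
  forall k r X, r0 <= r -> X = 2 * (Num.sqrt k%:R - r) ->
  r * `|fl k r - Fbar a b k r| <= C * expR (- (c * X ^+ 2))].
Proof.
have [c1 [C1 [c10 C10 h1]]] := Fbar_close a hb.
have [c2 [C2 [r0 [c20 C20 r01 h2]]]] := fbeta_lam_close hb Hlam.
have [c3 [C3 [c30 C30 h3]]] := fl_low.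
have [c4 [C4 [c40 C40 h4]]] := prof_le a hb.
(* Half of the rates c3 and c4 is spent on absorbing a factor r. The further 1/4 in c3/8 converts
   r^2 into X^2, as X^2 <= 4 r^2 in the range of small k. *)
pose c := Num.min (Num.min c1 c2) (Num.min (c3 / 8) (c4 / 2)).
have c0 : 0 < c by rewrite !lt_min c10 c20 !divr_gt0.
have cc1 : c <= c1 by rewrite !ge_min lexx.
have cc2 : c <= c2 by rewrite !ge_min lexx orbT.
have cc3 : c <= c3 / 8 by rewrite !ge_min lexx !orbT.
have cc4 : c <= c4 / 2 by rewrite !ge_min lexx !orbT.
have hp : polyb (fun _ : unit => True) (fun _ (x : R) => x) by exact: polyb_id.
have c3' : c3 / 2 < c3 by lra.
have c4' : c4 / 2 < c4 by lra.
have [A3 A30 hA3] := polyb_gauss hp c3'; have [A4 A40 hA4] := polyb_gauss hp c4'.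
have mono (e : R) X : c <= e -> expR (- (e * X ^+ 2)) <= expR (- (c * X ^+ 2)).
  by move=> ce; rewrite ler_expR lerN2 ler_wpM2r// sqr_ge0.
exists c, (C1 + C2 + C3 * A3 + C4 * A4), r0; split => //.
  by rewrite !addr_gt0 ?mulr_gt0.
move=> k r X rr XE; have r1 : 1 <= r by lra.
have r00 : 0 < r by lra.
have b1 : r * `|F X - Fbar a b k r| <= C1 * expR (- (c * X ^+ 2)).
  apply: le_trans (ler_wpM2l (ltW r00) (h1 k r X r1 XE)) _.
  have -> : r * (C1 / r * expR (- (c1 * X ^+ 2))) = C1 * expR (- (c1 * X ^+ 2)) by field; lra.
  by rewrite ler_pM2l//; exact: mono.
have b2 : r * `|fl k r - F X| <= (C2 + C3 * A3 + C4 * A4) * expR (- (c * X ^+ 2)).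
  have E0 := expR_gt0 (- (c * X ^+ 2)).
  have [kr|kr] := leP (r ^+ 2 / 4) k%:R.
    apply: le_trans (ler_wpM2l (ltW r00) (h2 k r X rr kr XE)) _.
    have -> : r * (C2 / r * expR (- (c2 * X ^+ 2))) = C2 * expR (- (c2 * X ^+ 2)) by field; lra.
    apply: (@le_trans _ _ (C2 * expR (- (c * X ^+ 2)))); first by rewrite ler_pM2l//; exact: mono.
    by rewrite ler_pM2r//; have := mulr_gt0 C30 A30; have := mulr_gt0 C40 A40; lra.
  have kr' := ltW kr.
  have K2 : Num.sqrt k%:R ^+ 2 = k%:R :> R by rewrite sqr_sqrtr ?ler0n.
  have K0 : 0 <= Num.sqrt k%:R :> R by exact: sqrtr_ge0.
  have Kr : Num.sqrt k%:R <= r / 2.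
    by rewrite -(@ler_pXn2r _ 2) ?nnegrE ?K2//; lra.
  have X1 : X <= - r by lra.
  have X2 : - (2 * r) <= X by lra.
  have XX : X ^+ 2 <= 4 * r ^+ 2.
    have : 0 <= (2 * r - X) * (2 * r + X) by apply: mulr_ge0; lra.
    lra.
  have /andP[F0 F1] := h4 X.
  have f0 := fl_ge0 k r00; have f1 := h3 k r r1 kr'.
  have d1 : r * fl k r <= C3 * A3 * expR (- (c * X ^+ 2)).
    apply: le_trans (ler_wpM2l (ltW r00) f1) _.
    have := hA3 tt r I; rewrite gtr0_norm// => h.
    have -> : r * (C3 * expR (- (c3 * r ^+ 2))) = C3 * (r * expR (- (c3 * r ^+ 2))) by ring.
    rewrite -mulrA ler_pM2l//; apply: le_trans h _; rewrite ler_pM2l// ler_expR lerN2.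
    have : c * X ^+ 2 <= c3 / 8 * X ^+ 2 by rewrite ler_wpM2r// sqr_ge0.
    have : c3 / 8 * X ^+ 2 <= c3 / 8 * (4 * r ^+ 2) by rewrite ler_pM2l// divr_gt0.
    lra.
  have d2 : r * F X <= C4 * A4 * expR (- (c * X ^+ 2)).
    apply: le_trans (ler_wpM2l (ltW r00) F1) _.
    have := hA4 tt X I => h.
    apply: (@le_trans _ _ (C4 * (`|X| * expR (- (c4 * X ^+ 2))))).
      rewrite mulrCA ler_pM2l// ler_wpM2r ?expR_ge0// ler0_norm; lra.
    rewrite -[C4 * A4 * _]mulrA ler_pM2l//; apply: le_trans h _; rewrite ler_pM2l//; exact: mono.
  apply: (@le_trans _ _ (r * fl k r + r * F X)).
    rewrite -mulrDr ler_pM2l// (le_trans (ler_normB _ _))//.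
    by rewrite (ger0_norm f0) (ger0_norm F0).
  have : 0 <= C2 * expR (- (c * X ^+ 2)) by apply: mulr_ge0; exact: ltW.
  lra.
have -> : fl k r - Fbar a b k r = (fl k r - F X) + (F X - Fbar a b k r).
  by move: (fl k r) (F X) (Fbar a b k r) => u v w; ring.
apply: (@le_trans _ _ (r * `|fl k r - F X| + r * `|F X - Fbar a b k r|)).
  by rewrite -mulrDr ler_pM2l// ler_normD.
lra.
Qed.

(** The index of the cell containing [x]. It has this meaning for x >= -r only: [Num.trunc] is 0 on
    negative numbers. *)
Definition kx r x : nat := Num.trunc (r ^+ 2 + r * x).

Lemma kxP r x : 0 < r -> - r <= x -> xk (kx r x) r <= x < xk (kx r x) r + r^-1.
Proof.
move=> r0 rx; have h0 : 0 <= r ^+ 2 + r * x.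
  have : 0 <= r * (r + x) by apply: mulr_ge0; lra.
  lra.
have /andP[h1 h2] := truncn_itv h0; rewrite -/(kx r x) in h1 h2.
have h2' : r ^+ 2 + r * x < (kx r x)%:R + 1 by rewrite natr1.
have -> : xk (kx r x) r + r^-1 = ((kx r x)%:R + 1 - r ^+ 2) / r by rewrite /xk; field; lra.
by rewrite /xk ler_pdivrMr// ltr_pdivlMr//; apply/andP; split; lra.
Qed.

(** A Gaussian in X gives only an exponential in x: x is within 1/r of X + X^2/(4 r), so |x| <= X^2
    + 2 for r >= 1. *)
Lemma block_dom_x : exists c C r0, [/\ 0 < c, 0 < C, 1 <= r0 &
  forall r x, r0 <= r -> - r <= x ->
  r * `|fl (kx r x) r - Fbar a b (kx r x) r| <= C * expR (- (c * `|x|))].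
Proof.
have [c [C [r0 [c0 C0 r01 h]]]] := block_dom.
exists c, (C * expR (2 * c)), r0; split => //; first by rewrite mulr_gt0 ?expR_gt0.
move=> r x rr rx; have r1 : 1 <= r by lra.
have r00 : 0 < r by lra.
pose k := kx r x; pose X := 2 * (Num.sqrt k%:R - r).
apply: le_trans (h k r X rr erefl) _; rewrite -mulrA ler_pM2l// -expRD ler_expR.
have /andP[x1 x2] := kxP r00 rx; rewrite -/k in x1 x2.
have hx := xkE r00 (erefl : X = 2 * (Num.sqrt k%:R - r)).
have ri : r^-1 <= 1 by rewrite invf_le1.
have q0 : 0 <= X ^+ 2 / (4 * r) by rewrite divr_ge0 ?sqr_ge0//; lra.
have q1 : X ^+ 2 / (4 * r) <= X ^+ 2 / 4.
  rewrite ler_wpM2l ?sqr_ge0// lef_pV2 ?posrE; lra.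
have Xa : `|X| <= (1 + X ^+ 2) / 2.
  by rewrite -[X ^+ 2]real_normK ?num_real//; have := sqr_ge0 (1 - `|X|); lra.
have : `|x| <= X ^+ 2 + 2.
  move: Xa; rewrite ler_norml => /andP[Xa1 Xa2]; rewrite ler_norml; have := sqr_ge0 X => X2.
  by apply/andP; split; lra.
move=> hx2; have : c * `|x| <= c * (X ^+ 2 + 2) by rewrite ler_pM2l.
lra.
Qed.

Lemma cvg_inv_pinfty : r^-1 @[r --> +oo] --> (0 : R).
Proof.
apply/gtr0_cvgV0; last exact: cvg_id.
by near=> t; near: t; apply: nbhs_pinfty_gt; rewrite num_real.
Unshelve. all: by end_near. Qed.

Let Xk r x : R := 2 * (Num.sqrt (kx r x)%:R - r).

Lemma xk_cvg x : xk (kx r x) r @[r --> +oo] --> x.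
Proof.
apply/cvgrPdist_le => e e0; near=> r.
have r0 : 0 < r by near: r; apply: nbhs_pinfty_gt; rewrite num_real.
have rx : - r <= x.
  have : - x <= r by near: r; apply: nbhs_pinfty_ge; rewrite num_real.
  lra.
have /andP[h1 h2] := kxP r0 rx.
have ri : `|0 - r^-1| <= e by near: r; exact: (@cvgr_dist_le _ _ _ _ _ _ _ cvg_inv_pinfty).
move: ri; rewrite sub0r normrN ger0_norm ?invr_ge0 ?(ltW r0)// => ri.
by rewrite ger0_norm; lra.
Unshelve. all: by end_near. Qed.

Lemma Xk_cvg x : Xk r x @[r --> +oo] --> x.
Proof.
apply/cvgrPdist_le => e e0.
pose M := (`|x| + 1) ^+ 2 + 1.
have M0 : 0 < M by rewrite ltr_pwDr// sqr_ge0.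
near=> r.
have r1 : 1 <= r by near: r; apply: nbhs_pinfty_ge; rewrite num_real.
have r0 : 0 < r by lra.
have rx : - r <= x.
  have : - x <= r by near: r; apply: nbhs_pinfty_ge; rewrite num_real.
  lra.
have rM : M / e <= r by near: r; apply: nbhs_pinfty_ge; rewrite num_real.
have /andP[h1 h2] := kxP r0 rx.
have hx := xkE r0 (erefl : Xk r x = _).
set k := kx r x in h1 h2 hx *; set X := Xk r x in hx *.
have ri : r^-1 <= 1 by rewrite invf_le1.
have K0 : 0 <= Num.sqrt k%:R :> R by exact: sqrtr_ge0.
have X2 : - (2 * r) <= X by rewrite /X /Xk -/k; lra.
have Xle : `|X| <= 2 * `|xk k r|.
  have [X0|X0] := leP 0 X.
    have q0 : 0 <= X ^+ 2 / (4 * r) by rewrite divr_ge0 ?sqr_ge0//; lra.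
    by rewrite (ger0_norm X0) ger0_norm; lra.
  have q0 : X ^+ 2 / (4 * r) <= - X / 2.
    rewrite ler_pdivrMr; last by lra.
    have : 0 <= - X * (X + 2 * r) by apply: mulr_ge0; lra.
    lra.
  by rewrite (ltr0_norm X0) ler0_norm; lra.
have xkle : `|xk k r| <= `|x| + 1.
  have : `|xk k r - x| <= 1 by rewrite distrC ger0_norm; lra.
  have := ler_normD (xk k r - x) x; rewrite subrK; lra.
have q1 : X ^+ 2 / (4 * r) <= (`|x| + 1) ^+ 2 / r.
  have : X ^+ 2 <= (2 * (`|x| + 1)) ^+ 2.
    rewrite -[X ^+ 2]real_normK ?num_real// lerXn2r ?nnegrE ?mulr_ge0 ?addr_ge0//; lra.
  move=> hX; rewrite ler_pdivrMr; last by lra.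
  apply: le_trans hX _; rewrite le_eqVlt; apply/orP; left; apply/eqP; field; lra.
have q0 : 0 <= X ^+ 2 / (4 * r) by rewrite divr_ge0 ?sqr_ge0//; lra.
have Mr : M / r <= e.
  by rewrite ler_pdivrMr// mulrC -ler_pdivrMr.
have ME : M / r = (`|x| + 1) ^+ 2 / r + r^-1 by rewrite /M; field; lra.
have ri0 : 0 < r^-1 by rewrite invr_gt0.
have -> : x - X = (x - xk k r) + X ^+ 2 / (4 * r) by rewrite hx; ring.
by rewrite ger0_norm; lra.
Unshelve. all: by end_near. Qed.

(** Three first order effects add up. The eigenvalue correction contributes dfbeta(Phi_a) (E1 + E2),
    the move from X to the left end of the cell contributes -F' x^2/4, and averaging over the cell
    contributes -F'/2. In each, dfbeta(Phi_a) or F' is odd and the cofactor is even. *)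
Lemma block_cvg : exists2 L : R -> R, forall x, L (- x) = - L x & forall x,
  r * (fl (kx r x) r - Fbar a b (kx r x) r) @[r --> +oo] --> L x.
Proof.
have [E1 [E2 [[pE1 pE2] [cE1 cE2] _ hl]]] := @lam_expansion R a.
exists (fun x => dfbeta b (Phi a x) * (E1 x + E2 x) + dF x * - (x ^+ 2 / 4) - dF x / 2).
  by move=> x; rewrite PhiN dfbeta_onem pE1 pE2 dprof_odd sqrrN; ring.
move=> x.
have -> : (fun r => r * (fl (kx r x) r - Fbar a b (kx r x) r)) =
  (fun r => r * (fl (kx r x) r - F (Xk r x)) + r * (F (Xk r x) - F (xk (kx r x) r))
     - r * (Fbar a b (kx r x) r - F (xk (kx r x) r))).
  apply/funext => r.
  by move: (fl _ _) (F (Xk r x)) (F (xk _ _)) (Fbar _ _ _ _) => u v w z; ring.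
have d18 : 0 < (8^-1 : R) < 4^-1 by apply/andP; split; lra.
have [C [r0 [C0 r01 h]]] := hl _ d18.
have rinf := cvg_inv_pinfty.
have Xc (g : R -> R) : {for x, continuous g} -> g (Xk r x) @[r --> +oo] --> g x.
  by move=> cg; apply: continuous_cvg => //; exact: Xk_cvg.
have Kr1 : r / Num.sqrt (kx r x)%:R @[r --> +oo] --> (1 : R).
  rewrite [X in _ --> X](_ : _ = (1 + 0 * x / 2)^-1); last by rewrite mul0r mul0r addr0 invr1.
  have hc : 1 + r^-1 * Xk r x / 2 @[r --> +oo] --> 1 + 0 * x / 2.
    apply: cvgD; first exact: cvg_cst.
    apply: cvgM; last exact: cvg_cst.
    by apply: cvgM => //; exact: Xk_cvg.
  have n0 : 1 + 0 * x / 2 != 0 by rewrite mul0r mul0r addr0.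
  have hv : (1 + r^-1 * Xk r x / 2)^-1 @[r --> +oo] --> (1 + 0 * x / 2)^-1 by apply: cvgV.
  apply: cvg_trans hv; apply: near_eq_cvg; near=> r.
  have rp : 0 < r by near: r; apply: nbhs_pinfty_gt; rewrite num_real.
  have -> : 1 + r^-1 * Xk r x / 2 = Num.sqrt (kx r x)%:R / r by rewrite /Xk; field; lra.
  by rewrite invf_div.
have cl : (fun r => r * (lam a (kx r x) r - Phi a (Xk r x))) r @[r --> +oo] --> E1 x + E2 x.
  have -> : (fun r => r * (lam a (kx r x) r - Phi a (Xk r x))) =
    (fun r => (E1 (Xk r x) * (r / Num.sqrt (kx r x)%:R) + r / r * E2 (Xk r x)) +
      r * (lam a (kx r x) r - Phi a (Xk r x) - E1 (Xk r x) / Num.sqrt (kx r x)%:R - E2 (Xk r x) / r)).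
    apply/funext => r.
    by move: (lam _ _ _) (Phi a _) (E1 _) (E2 _) (Num.sqrt _)^-1 (r^-1) => *; ring.
  rewrite -[X in _ --> X]addr0; apply: cvgD.
    apply: cvgD.
      rewrite -[X in _ --> X]mulr1; apply: cvgM => //.
      by apply: Xc; exact: cE1.
    rewrite -[X in _ --> X]mul1r; apply: cvgM; last by apply: Xc; exact: cE2.
    apply: (@cvg_trans _ ((fun=> (1 : R)) r @[r --> +oo])); last exact: cvg_cst.
    apply: near_eq_cvg; near=> r.
    have rp : 0 < r by near: r; apply: nbhs_pinfty_gt; rewrite num_real.
    by rewrite divff// gt_eqF.
  apply/norm_cvg0P; apply: (@squeeze_cvgr _ _ _ _ (fun=> 0) (fun r => C * r^-1)).
  - near=> r; rewrite normr_ge0/=.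
    have rr : r0 <= r by near: r; apply: nbhs_pinfty_ge; rewrite num_real.
    have rp : 0 < r by lra.
    have kr : r ^+ 2 / 4 <= (kx r x)%:R.
      have rx : 2 * (`|x| + 1) <= r by near: r; apply: nbhs_pinfty_ge; rewrite num_real.
      have x0 : - `|x| <= x by rewrite lerNl -normrN ler_norm.
      have h0 : 0 <= r ^+ 2 + r * x.
        have : 0 <= r * (r + x) by apply: mulr_ge0; lra.
        lra.
      have /andP[_ h2] := truncn_itv h0; rewrite -/(kx r x) in h2.
      have h2' : r ^+ 2 + r * x < (kx r x)%:R + 1 by rewrite natr1.
      have : 0 <= r * (x + `|x|) by apply: mulr_ge0; lra.
      have : 0 <= r * (r - 2 * (`|x| + 1)) by apply: mulr_ge0; lra.
      have := sqr_ge0 r; lra.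
    have := h _ _ _ rr kr (erefl : Xk r x = _).
    move: (lam a _ r - _ - _ - _) => u hu.
    rewrite normrM (gtr0_norm rp); apply: le_trans (ler_wpM2l (ltW rp) hu) _.
    set G := expR _; have G1 : G <= 1.
      by rewrite expR_le1; have := sqr_ge0 (Xk r x); lra.
    have -> : r * (C / r ^+ 2 * G) = C * r^-1 * G by field; lra.
    by rewrite ler_piMr// mulr_ge0 ?invr_ge0 ?(ltW C0) ?(ltW rp).
  - exact: cvg_cst.
  - by rewrite -[X in _ --> X](mulr0 C); apply: cvgM => //; exact: cvg_cst.
have PX : Phi a (Xk r x) @[r --> +oo] --> Phi a x.
  by apply: Xc; exact: continuous_Phi.
have lX : lam a (kx r x) r @[r --> +oo] --> Phi a x.
  have hs : (lam a (kx r x) r - Phi a (Xk r x)) @[r --> +oo] --> (0 : R).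
    have hv : r^-1 * (r * (lam a (kx r x) r - Phi a (Xk r x))) @[r --> +oo] --> 0 * (E1 x + E2 x).
      exact: cvgM.
    rewrite mul0r in hv; apply: cvg_trans hv; apply: near_eq_cvg; near=> r => /=.
    have rp : 0 < r by near: r; apply: nbhs_pinfty_gt; rewrite num_real.
    by rewrite mulKf// gt_eqF.
  have hv : lam a (kx r x) r - Phi a (Xk r x) + Phi a (Xk r x) @[r --> +oo] --> 0 + Phi a x.
    exact: cvgD.
  rewrite add0r in hv; apply: cvg_trans hv; apply: near_eq_cvg; near=> r => /=.
  by rewrite subrK.
apply: cvgB.
  apply: cvgD.
    apply: (@cvg_strict_diff R _ _ _ (fbeta b) (dfbeta b) (Phi a x) (E1 x + E2 x)) => //.
    - have /andP[p0 p1] := Phi_in01 a x.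
      have hgt : \forall t \near Phi a x, 0 < t.
        by apply: (@cvgr_gt _ _ (nbhs (Phi a x)) _ id (Phi a x)) => //; exact: cvg_id.
      have hlt : \forall t \near Phi a x, t < 1.
        by apply: (@cvgr_lt _ _ (nbhs (Phi a x)) _ id (Phi a x)) => //; exact: cvg_id.
      by near=> t; apply: is_der_fbeta => //; apply/andP; split; near: t.
    - exact: (dfbeta_continuous hb (Phi_in01 a x)).
  apply: (@cvg_strict_diff R _ _ _ F dF x (- (x ^+ 2 / 4))) => //.
  - by near=> t; exact: is_der_prof.
  - exact: continuous_dprof.
  - exact: Xk_cvg.
  - exact: xk_cvg.
  - have hv : - (Xk r x ^+ 2 / 4) @[r --> +oo] --> - (x ^+ 2 / 4).
      apply: cvgN; apply: cvgM; last exact: cvg_cst.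
      by apply: (Xc (fun z => z ^+ 2)); exact: exprn_continuous.
    apply: cvg_trans hv; apply: near_eq_cvg; near=> r.
    have rp : 0 < r by near: r; apply: nbhs_pinfty_gt; rewrite num_real.
    by rewrite (xkE rp (erefl : Xk r x = _)); move: (Xk r x) => X; field; lra.
have := @cvg_taylor2 R (IF a b) F dF x (fun r => xk (kx r x) r)
  (is_der_IF a hb) (is_der_prof a hb) (@continuous_dprof R a b hb x) (@xk_cvg x).
by [].
Unshelve. all: by end_near. Qed.

End Assembly.

(** * From the sum over the eigenvalues to the integral of the profile *)

Section Conclusion.
Variables (R : realType) (a : nat) (b : R).
Hypothesis hb : 1 / 2 < b.
Hypothesis Hlam : forall k (r : R), 0 < r -> 0 <= lam a k r <= 1.
Implicit Types (x y p q r : R).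
Local Notation mu := (@lebesgue_measure R).
Local Notation F := (prof a b).
Local Notation fl k r := (fbeta b (lam a k r)).

Let blk k r : set R := `[xk k r, xk k r + r^-1[%classic.

Let kx_blk k r x : 0 < r -> blk k r x -> kx r x = k.
Proof.
move=> r0; rewrite /blk/= in_itv/= => /andP[h1 h2]; apply: truncn_def.
move: h1 h2; rewrite /xk ler_pdivrMr// => h1.
have -> : (k%:R - r ^+ 2) / r + r^-1 = (k%:R + 1 - r ^+ 2) / r by field; rewrite gt_eqF.
rewrite ltr_pdivlMr// => h2; have -> : k.+1%:R = k%:R + 1 :> R by rewrite natr1.
by apply/andP; split; lra.
Qed.

Let bigcup_blk r : 0 < r -> \bigcup_k blk k r = `[- r, +oo[%classic.
Proof.
move=> r0; apply/seteqP; split => x.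
  move=> [k _]; rewrite /blk/= !in_itv/= andbT => /andP[+ _]; apply: le_trans.
  by rewrite /xk ler_pdivlMr//; have := ler0n R k; lra.
by rewrite /= in_itv/= andbT => rx; exists (kx r x) => //; rewrite /blk/= in_itv/= kxP.
Qed.

Let trivIset_blk r : 0 < r -> trivIset setT (blk^~ r).
Proof.
move=> r0; apply/trivIsetP => i j _ _ ij; apply/seteqP; split => // x [xi xj].
by move: ij; rewrite -(kx_blk r0 xi) -(kx_blk r0 xj) eqxx.
Qed.

Let measurable_kx (g : nat -> R) r : measurable_fun setT (fun x => g (kx r x)).
Proof.
apply: (measurableT_comp (f := g)) => //.
have -> : kx r = (Num.trunc : R -> nat) \o (fun x => r ^+ 2 + r * x) by [].
apply: measurableT_comp; first exact: measurable_truncn.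
by apply: measurable_funD => //; apply: measurable_funM.
Qed.

Lemma step_integral (g : nat -> R) r : 0 < r -> (forall k, 0 <= g k) ->
  (\int[mu]_(x in `[(- r)%R, +oo[) (g (kx r x))%:E = \sum_(0 <= k <oo) (g k / r)%:E)%E.
Proof.
move=> r0 g0; rewrite -bigcup_blk// ge0_integral_bigcup//=.
- apply: eq_eseriesr => k _.
  transitivity (\int[mu]_(x in blk k r) (g k)%:E)%E.
    by apply: eq_integral => x; rewrite inE => /(kx_blk r0) ->.
  rewrite integral_cst; last exact: measurable_itv.
  transitivity ((g k)%:E * mu (blk k r))%E => //.
  have -> : mu (blk k r) = (r^-1)%:E.
    rewrite /blk lebesgue_measure_itv/= lte_fin ltrDl invr_gt0 r0 -EFinB.
    by rewrite addrAC subrr add0r.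
  by rewrite -EFinM.
- by move=> k; exact: measurable_itv.
- apply: measurable_funTS; apply/measurable_EFinP; exact: (measurable_kx g r).
- by move=> x _; rewrite lee_fin.
- exact: trivIset_blk.
Qed.

Let F_ge0 x : 0 <= F x.
Proof. by have [c [C [_ _ /(_ x)/andP[]]]] := prof_le a hb. Qed.

Lemma prof_blk k r : 0 < r ->
  (\int[mu]_(x in blk k r) (F x)%:E = (Fbar a b k r / r)%:E)%E.
Proof.
move=> r0; rewrite /blk integral_itv_bndo_bndc; last first.
  apply: measurable_funTS; apply/measurable_EFinP.
  by apply: continuous_measurable_fun; exact: continuous_prof.
have lt1 : xk k r < xk k r + r^-1 by rewrite ltrDl invr_gt0.
rewrite (@continuous_FTC2 _ _ (IF a b)) //.
- by rewrite -EFinB /Fbar mulrC mulKf// gt_eqF.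
- by apply: continuous_subspaceT; exact: continuous_prof.
- have cI : continuous (IF a b) by exact: (continuous_of_der (is_der_IF a hb)).
  split.
  + by move=> x _; have [] := is_der_IF a hb x.
  + by apply: cvg_at_right_filter; exact: cI.
  + by apply: cvg_at_left_filter; exact: cI.
- by move=> x _; rewrite derive1E; have [_ ->] := is_der_IF a hb x.
Qed.

Lemma Fbar_ge0 k r : 0 < r -> 0 <= Fbar a b k r.
Proof.
move=> r0; have h : (0 <= (Fbar a b k r / r)%:E)%E.
  by rewrite -prof_blk//; apply: integral_ge0 => x _; rewrite lee_fin.
by move: h; rewrite lee_fin pmulr_lge0// invr_gt0.
Qed.

Lemma integral_Fbar r : 0 < r ->
  (\int[mu]_(x in `[(- r)%R, +oo[) (Fbar a b (kx r x) r)%:E =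
   \int[mu]_(x in `[(- r)%R, +oo[) (F x)%:E)%E.
Proof.
move=> r0; rewrite (step_integral (g := fun k => Fbar a b k r))//; last first.
  by move=> k; exact: Fbar_ge0.
rewrite -bigcup_blk// ge0_integral_bigcup//=.
- by apply: eq_eseriesr => k _; rewrite prof_blk.
- by move=> k; exact: measurable_itv.
- apply: measurable_funTS; apply/measurable_EFinP.
  by apply: continuous_measurable_fun; exact: continuous_prof.
- by move=> x _; rewrite lee_fin.
- exact: trivIset_blk.
Qed.

Let mle r : measurable_fun setT (fun x : R => - r <= x).
Proof. exact: measurable_fun_ler. Qed.

Let integral_if (g h : R -> R) r : measurable_fun setT g -> measurable_fun setT h ->
  (forall x, 0 <= g x) -> (forall x, 0 <= h x) ->
  (\int[mu]_x (if (- r <= x)%R then g x else h x)%:E =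
  \int[mu]_(x in `[(- r)%R, +oo[) (g x)%:E + \int[mu]_(x in ~` `[(- r)%R, +oo[) (h x)%:E)%E.
Proof.
move=> mg mh g0 h0; rewrite -[X in integral _ X _](setUv `[(- r)%R, +oo[%classic) ge0_integral_setU//=.
- congr (_ + _)%E; apply: eq_integral => x; rewrite inE/= in_itv/= andbT; first by move=> ->.
  by move=> /negP/negbTE ->.
- exact: measurableC.
- by rewrite setUv; apply/measurable_EFinP; apply: (measurable_fun_ifT (mle r)).
- by move=> x _; rewrite lee_fin; case: ifP.
- exact/disj_setPCl.
Qed.

Definition Ssum r : \bar R := (\sum_(0 <= k <oo) (fl k r)%:E)%E.

(** Cell 0 starts at -r, so [U] is extended by 0 to its left, while [W] continues with r F. Then [U]
    integrates to [Ssum r], [W] integrates to r times the integral of F, and dominated convergence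
    is applied to the difference [D]. *)
Let U r x : R := if - r <= x then r * fl (kx r x) r else 0.
Let W r x : R := if - r <= x then r * Fbar a b (kx r x) r else r * F x.
Let D r x : R := if - r <= x then r * (fl (kx r x) r - Fbar a b (kx r x) r) else - (r * F x).

Let DE r x : D r x = U r x - W r x.
Proof. by rewrite /D /U /W; case: ifP => _; [rewrite mulrBr|rewrite sub0r]. Qed.

Let mF : measurable_fun setT F.
Proof. by apply: continuous_measurable_fun; exact: continuous_prof. Qed.

Let mU r : measurable_fun setT (U r).
Proof.
apply: measurable_fun_ifT => //; apply: measurable_funM => //.
exact: (measurable_kx (fun k => fl k r)).
Qed.

Let mW r : measurable_fun setT (W r).
Proof.
apply: measurable_fun_ifT => //; apply: measurable_funM => //.
exact: (measurable_kx (fun k => Fbar a b k r)).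
Qed.

Let mD r : measurable_fun setT (D r).
Proof.
have -> : D r = (fun x => U r x - W r x) by apply/funext => x; exact: DE.
by apply: measurable_funB.
Qed.

Let integral_U r : 0 < r -> (\int[mu]_x (U r x)%:E = Ssum r)%E.
Proof.
move=> r0; rewrite /U.
have mg : measurable_fun setT (fun x => r * fl (kx r x) r).
  by apply: measurable_funM => //; exact: (measurable_kx (fun k => fl k r)).
have g0 x : 0 <= r * fl (kx r x) r by apply: mulr_ge0; [exact: ltW|exact: fl_ge0].
rewrite (@integral_if _ (fun=> 0) r mg)//.
rewrite integral0 adde0 (step_integral (g := fun k => r * fl k r))//; last first.
  by move=> k; apply: mulr_ge0; [exact: ltW|exact: fl_ge0].
by apply: eq_eseriesr => k _; rewrite mulrC mulKf// gt_eqF.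
Qed.

Let integral_W r : 0 < r -> (\int[mu]_x (W r x)%:E = r%:E * \int[mu]_x (F x)%:E)%E.
Proof.
move=> r0; rewrite /W integral_if//.
- have Z (E : set R) (g : R -> R) : measurable E -> measurable_fun setT g -> (forall x, 0 <= g x) ->
      (\int[mu]_(x in E) (r * g x)%:E = r%:E * \int[mu]_(x in E) (g x)%:E)%E.
    move=> mE mg g0; under eq_integral do rewrite EFinM.
    apply: ge0_integralZl => //.
    + by apply: measurable_funTS; apply/measurable_EFinP.
    + by move=> x _; rewrite lee_fin.
    + by rewrite lee_fin ltW.
  rewrite (Z _ (fun x => Fbar a b (kx r x) r))//; last 2 first.
  + exact: (measurable_kx (fun k => Fbar a b k r)).
  + by move=> x; exact: Fbar_ge0.
  rewrite (Z _ F)//; last exact: measurableC.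
  rewrite integral_Fbar// -ge0_muleDr; last 2 first.
  + by apply: integral_ge0 => x _; rewrite lee_fin.
  + by apply: integral_ge0 => x _; rewrite lee_fin.
  congr (_ * _)%E; rewrite -ge0_integral_setU//= ?setUv//.
  + exact: measurableC.
  + exact/measurable_EFinP.
  + by move=> x _; rewrite lee_fin.
  + exact/disj_setPCl.
- apply: measurable_funM => //; exact: (measurable_kx (fun k => Fbar a b k r)).
- exact: measurable_funM.
- by move=> x; apply: mulr_ge0; [exact: ltW|exact: Fbar_ge0].
- by move=> x; apply: mulr_ge0; [exact: ltW|].
Qed.

Let D_dom : exists c C r0, [/\ 0 < c, 0 < C, 1 <= r0 &
  forall r x, r0 <= r -> `|D r x| <= C * expR (- (c * `|x|))].
Proof.
have [c1 [C1 [r0 [c10 C10 r01 h1]]]] := block_dom_x hb Hlam.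
have [c2 [C2 [c20 C20 h2]]] := prof_le a hb.
have hp : polyb (fun _ : unit => True) (fun _ (x : R) => x) by exact: polyb_id.
have c2' : c2 / 2 < c2 by lra.
have [A A0 hA] := polyb_gauss hp c2'.
pose c := Num.min c1 (c2 / 2).
have c0 : 0 < c by rewrite lt_min c10 divr_gt0.
exists c, (C1 + C2 * A), r0; split => //; first by rewrite addr_gt0// mulr_gt0.
move=> r x rr; have r00 : 0 < r by lra.
have r1 : 1 <= r by lra.
have E0 := expR_gt0 (- (c * `|x|)).
rewrite /D; case: (leP (- r) x) => rx.
  rewrite normrM (gtr0_norm r00); apply: le_trans (h1 r x rr rx) _.
  apply: (@le_trans _ _ (C1 * expR (- (c * `|x|)))).
    by rewrite ler_pM2l// ler_expR lerN2 ler_wpM2r// ge_min lexx.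
  by rewrite ler_pM2r// lerDl mulr_ge0// ltW.
have /andP[F0 F1] := h2 x.
rewrite normrN ger0_norm; last by rewrite mulr_ge0// ltW.
apply: (@le_trans _ _ (C2 * (`|x| * expR (- (c2 * x ^+ 2))))).
  rewrite mulrCA; apply: ler_pM => //; first exact: ltW.
  by rewrite ltr0_norm; lra.
apply: (@le_trans _ _ (C2 * (A * expR (- (c2 / 2 * x ^+ 2))))).
  by rewrite ler_pM2l//; exact: hA tt x I.
rewrite mulrDl -[C2 * A * _]mulrA ler_wpDl//; first by rewrite mulr_ge0// ltW.
rewrite !ler_pM2l// ler_expR lerN2.
have x1 : 1 <= `|x| by rewrite ltr0_norm; lra.
apply: (@le_trans _ _ (c2 / 2 * `|x|)); first by rewrite ler_wpM2r// ge_min lexx orbT.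
rewrite ler_pM2l ?divr_gt0// -[x ^+ 2]real_normK ?num_real// expr2 ler_peMl//.
Qed.

Let integrable_D r0 c C : 0 < c -> 
  (forall r x, r0 <= r -> `|D r x| <= C * expR (- (c * `|x|))) ->
  forall r, r0 <= r -> mu.-integrable setT (fun x => (D r x)%:E).
Proof.
move=> c0 h r rr.
have hi := @integrableZl _ _ _ mu setT measurableT C _ (integrable_expR_abs c0).
apply: (le_integrable measurableT _ _ hi); first by apply/measurable_EFinP; exact: mD.
move=> x _; rewrite abse_EFin -EFinM abse_EFin lee_fin.
by apply: le_trans (h r x rr) _; exact: ler_norm.
Qed.

Theorem Ssum_asymptotics :
  (\forall r \near +oo, Ssum r \is a fin_num) /\
  fine (Ssum r) - r * Rintegral mu setT F @[r --> +oo] --> (0 : R).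
Proof.
have [c [C [r0 [c0 C0 r01 hD]]]] := D_dom.
have iD := integrable_D c0 hD.
have iW r : 0 < r -> mu.-integrable setT (fun x => (W r x)%:E).
  move=> rp; apply/integrableP; split; first by apply/measurable_EFinP; exact: mW.
  under eq_integral => x _.
    rewrite abse_EFin ger0_norm; last first.
      by rewrite /W; case: ifP => _; rewrite mulr_ge0 ?(ltW rp)//; exact: Fbar_ge0.
    over.
  rewrite integral_W// ltey_eq fin_numM//.
  by apply: integrable_fin_num => //; exact: integrable_prof.
have iU r : r0 <= r -> mu.-integrable setT (fun x => (U r x)%:E).
  move=> rr; have rp : 0 < r by lra.
  have := integrableD measurableT (iD r rr) (iW r rp).
  apply: eq_integrable => // x _ /=.
  by rewrite -EFinD DE subrK.
have fin r : r0 <= r -> Ssum r \is a fin_num.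
  move=> rr; have rp : 0 < r by lra.
  by rewrite -integral_U//; apply: integrable_fin_num => //; exact: iU.
have key r : r0 <= r -> fine (Ssum r) - r * Rintegral mu setT F = Rintegral mu setT (D r).
  move=> rr; have rp : 0 < r by lra.
  have -> : D r = (fun x => U r x - W r x) by apply/funext => x; exact: DE.
  rewrite RintegralB//; [|exact: iU|exact: iW].
  congr (_ - _); first by rewrite /Rintegral integral_U.
  rewrite /Rintegral integral_W// fineM//.
  by apply: integrable_fin_num => //; exact: integrable_prof.
split.
  near=> r; apply: fin; near: r; apply: nbhs_pinfty_ge; rewrite num_real//.
have [L Lodd hL] := @block_cvg R a b hb.
apply: (@cvg_trans _ (Rintegral mu setT (D r) @[r --> +oo])).
  apply: near_eq_cvg; near=> r; apply/esym; apply: key; near: r.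
  by apply: nbhs_pinfty_ge; rewrite num_real.
(* Passage to sequences for dominated convergence. Taking the maximum with r0 makes the domination
   hold for every n and changes only finitely many terms. *)
apply/cvg_pinftyP => u uy.
pose v n := Num.max r0 (u n).
have vr0 n : r0 <= v n by rewrite le_max lexx.
have uv : \forall n \near \oo, v n = u n.
  near=> n; apply/max_idPr; near: n; move/cvgryPge : uy; exact.
apply: (@cvg_trans _ (Rintegral mu setT (D (v n)) @[n --> \oo])).
  by apply: near_eq_cvg; near=> n; rewrite (_ : v n = u n)//; near: n.
have vy : v n @[n --> \oo] --> +oo.
  by apply: cvg_trans uy; apply: near_eq_cvg; near=> n; apply/esym; near: n.
have DL x : (D (v n) x) @[n --> \oo] --> L x.
  have h : r * (fl (kx r x) r - Fbar a b (kx r x) r) @[r --> +oo] --> L x by exact: hL.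
  have := cvg_comp _ _ vy h; apply: cvg_trans; apply: near_eq_cvg.
  near=> n; rewrite /D/= ifT//.
  have : - x <= v n by near: n; move/cvgryPge : vy; exact.
  lra.
have mL : measurable_fun setT L.
  apply: (@measurable_fun_cvg _ _ _ setT (fun n => D (v n))) => // x _; exact: DL.
have ig := @integrableZl _ _ _ mu setT measurableT C _ (integrable_expR_abs c0).
have [iL _ hc] : [/\ mu.-integrable setT (fun x => (L x)%:E),
    (\int[mu]_x `|(D (v n) x)%:E - (L x)%:E| @[n --> \oo] --> 0)%E &
    (\int[mu]_x (D (v n) x)%:E @[n --> \oo] --> \int[mu]_x (L x)%:E)%E].
  apply: (@dominated_convergence _ _ R mu setT measurableT
    (fun n x => (D (v n) x)%:E) (fun x => (L x)%:E)) ig _.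
  - by move=> n; apply/measurable_EFinP; exact: mD.
  - exact/measurable_EFinP.
  - by apply: aeW => x _; apply/fine_cvgP; split; [exact: nearW|exact: DL].
  - by apply: aeW => x n _; rewrite abse_EFin -EFinM lee_fin; exact: hD.
have L0 := integral_odd mL Lodd.
rewrite -L0; apply: fine_cvg; rewrite fineK//.
by apply: integrable_fin_num.
Unshelve. all: by end_near. Qed.

End Conclusion.

(** * Integration over the disk *)

Section PlaneMeasure.
Variable R : realType.
Local Notation mu := (@lebesgue_measure R).
Local Notation plane := (mu \x mu)%E.
Implicit Types (c r t : R) (z : R * R).

Lemma lebesgue_measure_shift c (A : set R) : measurable A ->
  pushforward mu ((fun x => x + c) : measurableTypeR R -> measurableTypeR R) A = mu A.
Proof.
move=> mA; have mphi : measurable_fun setT ((fun x => x + c) : measurableTypeR R -> measurableTypeR R).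
  by apply: measurable_funD.
pose phi : {mfun measurableTypeR R >-> measurableTypeR R} :=
  HB.pack ((fun x => x + c) : measurableTypeR R -> measurableTypeR R)
    (isMeasurableFun.Build _ _ _ _ _ mphi).
apply/esym; apply: (lebesgue_measure_unique (mu := pushforward mu phi)) => // _ [[a b]] _ <-.
have e : (fun x => x + c) @^-1` `]a, b] = `](a - c), (b - c)]%classic.
  apply/seteqP; split => x /=; rewrite !in_itv/= => /andP[h1 h2]; apply/andP; split; lra.
transitivity (mu `](a - c), (b - c)]%classic); last by rewrite -e.
rewrite !lebesgue_measure_itv/= !lte_fin ltrD2r.
by case: ifP => // _; rewrite -!EFinB; congr EFin; ring.
Qed.

Lemma ge0_integral_shift c (f : R -> \bar R) : measurable_fun setT f ->
  (forall x, 0 <= f x)%E -> (\int[mu]_x f (x + c)%R = \int[mu]_x f x)%E.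
Proof.
move=> mf f0; apply/esym.
have mphi : measurable_fun setT ((fun x => x + c)%R : measurableTypeR R -> measurableTypeR R).
  by apply: measurable_funD.
pose phi : {mfun measurableTypeR R >-> measurableTypeR R} :=
  HB.pack ((fun x => x + c)%R : measurableTypeR R -> measurableTypeR R)
    (isMeasurableFun.Build _ _ _ _ _ mphi).
transitivity (\int[pushforward mu phi]_x f x)%E.
  by apply: eq_measure_integral => //= A mA _; rewrite -(lebesgue_measure_shift c mA).
by rewrite ge0_integral_pushforward.
Qed.

Lemma plane_tonelli_xy (f : R * R -> \bar R) : measurable_fun setT f ->
  (forall z, 0 <= f z)%E ->
  (\int[plane]_z f z = \int[mu]_x \int[mu]_y f (x, y))%E.
Proof. move=> mf f0; have h := @fubini_tonelli1 _ _ _ _ _ mu mu f mf f0; etransitivity; [exact h|reflexivity]. Qed.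

Lemma plane_tonelli_yx (f : R * R -> \bar R) : measurable_fun setT f ->
  (forall z, 0 <= f z)%E ->
  (\int[plane]_z f z = \int[mu]_y \int[mu]_x f (x, y))%E.
Proof. move=> mf f0; have h := @fubini_tonelli2 _ _ _ _ _ mu mu f mf f0; etransitivity; [exact h|reflexivity]. Qed.

Definition shearx c z : R * R := (z.1 + c * z.2, z.2).
Definition sheary c z : R * R := (z.1, z.2 + c * z.1).

Lemma measurable_shearx c : measurable_fun setT (shearx c).
Proof.
apply: measurable_fun_pair; last exact: measurable_snd.
by apply: measurable_funD => //; apply: measurable_funM.
Qed.

Lemma measurable_sheary c : measurable_fun setT (sheary c).
Proof.
apply: measurable_fun_pair; first exact: measurable_fst.
by apply: measurable_funD => //; apply: measurable_funM.
Qed.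

Lemma ge0_integral_shearx c (f : R * R -> \bar R) : measurable_fun setT f ->
  (forall z, 0 <= f z)%E -> (\int[plane]_z f (shearx c z) = \int[plane]_z f z)%E.
Proof.
move=> mf f0.
rewrite !plane_tonelli_yx//; last first.
  by apply: measurableT_comp => //; exact: measurable_shearx.
apply: eq_integral => y _.
apply: (@ge0_integral_shift (c * y) (fun x => f (x, y))) => //.
exact: measurableT_comp.
Qed.

Lemma ge0_integral_sheary c (f : R * R -> \bar R) : measurable_fun setT f ->
  (forall z, 0 <= f z)%E -> (\int[plane]_z f (sheary c z) = \int[plane]_z f z)%E.
Proof.
move=> mf f0.
rewrite !plane_tonelli_xy//; last first.
  by apply: measurableT_comp => //; exact: measurable_sheary.
apply: eq_integral => x _.
apply: (@ge0_integral_shift (c * x) (fun y => f (x, y))) => //.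
exact: measurableT_comp.
Qed.

Definition rot (u v : R) z : R * R := (u * z.1 - v * z.2, v * z.1 + u * z.2).

(** A rotation by theta is the product of shears with parameters -tan(theta/2), sin theta and
    -tan(theta/2), where tan(theta/2) = v/(1 + u); the half turn is excluded. A shear preserves
    plane measure by Tonelli and translation invariance on lines. *)
Lemma rotE u v z : u ^+ 2 + v ^+ 2 = 1 -> 1 + u != 0 ->
  rot u v z = shearx (- (v / (1 + u))) (sheary v (shearx (- (v / (1 + u))) z)).
Proof.
move=> uv u1; rewrite /rot /shearx /sheary/=.
have e : v * v / (1 + u) = 1 - u.
  have -> : v * v = (1 - u) * (1 + u) by have := uv; rewrite !expr2; lra.
  by rewrite mulfK.
have e2 : v / (1 + u) * v = 1 - u by rewrite mulrAC.
have e3 : v * (v / (1 + u)) = 1 - u by rewrite mulrA.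
set t := v / (1 + u) in e2 e3 *.
have e4 : t * u = v - t by rewrite /t; field.
congr (_, _).
  have -> : z.1 + - t * z.2 + - t * (z.2 + v * (z.1 + - t * z.2)) =
    z.1 - t * z.2 - t * z.2 - (t * v) * z.1 + t * (v * t) * z.2 by ring.
  rewrite e2 e3 mulrBr mulr1 e4; ring.
have -> : z.2 + v * (z.1 + - t * z.2) = z.2 + v * z.1 - (v * t) * z.2 by ring.
by rewrite e3; ring.
Qed.

Lemma ge0_integral_rot u v (f : R * R -> \bar R) : u ^+ 2 + v ^+ 2 = 1 -> 1 + u != 0 ->
  measurable_fun setT f -> (forall z, 0 <= f z)%E ->
  (\int[plane]_z f (rot u v z) = \int[plane]_z f z)%E.
Proof.
move=> uv u1 mf f0; set t := - (v / (1 + u)).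
under eq_integral do rewrite (rotE _ uv u1).
rewrite (@ge0_integral_shearx t (fun z => f (shearx t (sheary v z))))//; last first.
  apply: measurableT_comp => //; apply: measurableT_comp; [exact: measurable_shearx|exact: measurable_sheary].
rewrite (@ge0_integral_sheary v (fun z => f (shearx t z)))//; last first.
  by apply: measurableT_comp => //; exact: measurable_shearx.
exact: ge0_integral_shearx.
Qed.

Lemma integral_rot u v (f : R * R -> \bar R) : u ^+ 2 + v ^+ 2 = 1 -> 1 + u != 0 ->
  measurable_fun setT f -> (\int[plane]_z f (rot u v z) = \int[plane]_z f z)%E.
Proof.
move=> uv u1 mf; rewrite integralE [RHS]integralE; congr (_ - _)%E.
  rewrite -(ge0_integral_rot uv u1 (f := f^\+%E))//; last exact: measurable_funepos.
  by apply: eq_integral => z _; rewrite !funeposE.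
rewrite -(ge0_integral_rot uv u1 (f := f^\-%E))//; last exact: measurable_funeneg.
by apply: eq_integral => z _; rewrite !funenegE.
Qed.

Lemma measurable_sqrnorm : measurable_fun setT (fun z : R * R => z.1 ^+ 2 + z.2 ^+ 2).
Proof. by apply: measurable_funD; apply: measurable_funX. Qed.

Lemma measurable_disk r : measurable (disk r).
Proof.
have -> : disk r = (fun z : R * R => z.1 ^+ 2 + z.2 ^+ 2) @^-1` `]-oo, r ^+ 2[%classic.
  by apply/seteqP; split => z /=; rewrite in_itv.
by rewrite -[X in measurable X]setTI; apply: measurable_sqrnorm => //; exact: measurable_itv.
Qed.

Lemma disk_rot u v r z : u ^+ 2 + v ^+ 2 = 1 -> disk r (rot u v z) = disk r z.
Proof.
move=> uv; rewrite /disk/= /rot/=; congr (is_true (_ < _)).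
have -> : (u * z.1 - v * z.2) ^+ 2 + (v * z.1 + u * z.2) ^+ 2 = (u ^+ 2 + v ^+ 2) * (z.1 ^+ 2 + z.2 ^+ 2) by ring.
by rewrite uv mul1r.
Qed.

Lemma Rintegral_disk_rot u v r (f : R * R -> R) : u ^+ 2 + v ^+ 2 = 1 -> 1 + u != 0 ->
  measurable_fun setT f ->
  Rintegral plane (disk r) (fun z => f (rot u v z)) = Rintegral plane (disk r) f.
Proof.
move=> uv u1 mf; rewrite [LHS]Rintegral_mkcond [RHS]Rintegral_mkcond /Rintegral; congr fine.
have mfr : measurable_fun setT (fun z => ((f \_ (disk r)) z)%:E).
  have h : measurable_fun (disk r) f by exact: measurable_funTS.
  have h2 := iffLR (measurable_restrictT f (measurable_disk r)) h.
  by apply/measurable_EFinP; exact: h2.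
have e := integral_rot uv u1 mfr.
etransitivity; last exact e.
apply: eq_integral => z _; congr EFin; rewrite /patch.
by rewrite (_ : (rot u v z \in disk r) = (z \in disk r))// /in_mem/= /in_set/= disk_rot.
Qed.

End PlaneMeasure.

(** * Area of the disk *)

Section DiskArea.
Variable R : realType.
Local Notation mu := (@lebesgue_measure R).
Local Notation plane := (mu \x mu)%E.
Implicit Types (r x : R).

Lemma is_der_rsin r x : is_der x (fun t => r * sin t) (r * cos x).
Proof.
apply: is_der_eq; first apply: is_der_mul.
- exact: is_der_cst.
- exact: is_derive_sin.
- by cbv beta; rewrite mul0r addr0.
Qed.

Lemma continuous_chord r : continuous (fun x => 2 * Num.sqrt (r ^+ 2 - x ^+ 2)).
Proof.
move=> x; apply: cvgM; first exact: cvg_cst.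
apply: (@cvg_comp _ _ _ _ Num.sqrt _ (nbhs (r ^+ 2 - x ^+ 2))); last exact: sqrt_continuous.
by apply: cvgB; [exact: cvg_cst|exact: exprn_continuous].
Qed.

(** Substitution x = r sin t; the resulting 2 r^2 cos^2 t has the primitive r^2 (t + sin t cos
    t). *)
Lemma integral_chord r : 0 < r ->
  (\int[mu]_(x in `[(- r)%R, r]) (2 * Num.sqrt (r ^+ 2 - x ^+ 2))%:E = (pi * r ^+ 2)%:E)%E.
Proof.
move=> r0; have p0 : - (pi / 2) < pi / 2 :> R by have := pi_gt0 R; lra.
have e1 : r * sin (- (pi / 2)) = - r by rewrite sinN sin_pihalf mulrN mulr1.
have e2 : r * sin (pi / 2) = r by rewrite sin_pihalf mulr1.
have dF : derive1 (fun t : R => r * sin t) = (fun t => r * cos t).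
  by apply/funext => t; rewrite derive1E; have [_ ->] := is_der_rsin r t.
have cF : continuous (fun t : R => r * sin t) by exact: (continuous_of_der (is_der_rsin r)).
have cc : continuous (fun t : R => r * cos t).
  by move=> t; apply: cvgM; [exact: cvg_cst|exact: continuous_cos].
have := @integration_by_substitution_increasing R (fun t => r * sin t)
  (fun x => 2 * Num.sqrt (r ^+ 2 - x ^+ 2)) (- (pi / 2)) (pi / 2) (ltW p0).
rewrite e1 e2 => ->.
- rewrite dF.
  transitivity (\int[mu]_(t in `[(- (pi / 2))%R, (pi / 2)%R]) (2 * r ^+ 2 * cos t ^+ 2)%:E)%E.
    apply: eq_integral => t; rewrite inE/= in_itv/= => /andP[t1 t2]; congr EFin.
    change (2 * Num.sqrt (r ^+ 2 - (r * sin t) ^+ 2) * (r * cos t) = 2 * r ^+ 2 * cos t ^+ 2).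
    have c0 : 0 <= cos t by apply: cos_ge0_pihalf; rewrite t1 t2.
    have -> : r ^+ 2 - (r * sin t) ^+ 2 = (r * cos t) ^+ 2.
      by rewrite [in RHS]exprMn cos2sin2; ring.
    by rewrite sqrtr_sqr ger0_norm ?mulr_ge0 ?(ltW r0)//; ring.
  have dG t : is_der t (fun t => r ^+ 2 * (t + sin t * cos t)) (2 * r ^+ 2 * cos t ^+ 2).
    apply: is_der_eq.
      apply: is_der_mul; first exact: is_der_cst.
      apply: is_der_add; first exact: is_der_id.
      apply: is_der_mul; [exact: is_derive_sin|exact: is_derive_cos].
    cbv beta; rewrite mul0r addr0.
    have -> : sin t * - sin t + cos t * cos t = cos t ^+ 2 - sin t ^+ 2 by ring.
    by rewrite cos2sin2; ring.
  have cG := continuous_of_der dG.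
  rewrite (@continuous_FTC2 _ _ (fun t => r ^+ 2 * (t + sin t * cos t)))//.
  + by rewrite cosN cos_pihalf !mulr0 -EFinB; congr EFin; field.
  + apply: continuous_subspaceT => t.
    apply: cvgM; first exact: cvg_cst.
    by apply: (@cvg_comp _ _ _ cos (fun x => x ^+ 2) _ (nbhs (cos t))); [exact: continuous_cos|exact: exprn_continuous].
  + split.
    * by move=> t _; have [] := dG t.
    * by apply: cvg_at_right_filter; exact: cG.
    * by apply: cvg_at_left_filter; exact: cG.
  + by move=> t _; rewrite derive1E; have [_ ->] := dG t.
- by move=> s t hs ht st; rewrite ltr_pM2l// ltr_sin.
- by rewrite dF => t _; exact: cc.
- by rewrite dF; apply: cvgP; apply: cvg_at_right_filter; exact: cc.
- by rewrite dF; apply: cvgP; apply: cvg_at_left_filter; exact: cc.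
- split.
  + by move=> t _; have [] := is_der_rsin r t.
  + by apply: cvg_at_right_filter; exact: cF.
  + by apply: cvg_at_left_filter; exact: cF.
- by apply: continuous_subspaceT; exact: continuous_chord.
Qed.

(** By vertical slices. [Num.sqrt] is 0 on negative numbers, so the slices with |x| >= r come out
    empty by the same formula. *)
Lemma area_disk r : 0 < r -> plane (disk r) = (pi * r ^+ 2)%:E.
Proof.
move=> r0; transitivity (\int[plane]_z (\1_(disk r) z)%:E)%E.
  have h := @integral_indic _ _ _ plane setT measurableT _ (measurable_disk r).
  by rewrite setIT in h; exact: (esym h).
rewrite plane_tonelli_xy; last 2 first.
- by apply/measurable_EFinP; apply: measurable_indic; exact: measurable_disk.
- by move=> z; rewrite lee_fin.
rewrite -(integral_chord r0) [RHS]integral_mkcond; apply: eq_integral => x _.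
transitivity (\int[mu]_y (\1_(`](- Num.sqrt (r ^+ 2 - x ^+ 2))%R, (Num.sqrt (r ^+ 2 - x ^+ 2))%R[%classic : set R) y)%:E)%E.
  apply: eq_integral => y _; rewrite !indicE; congr (_%:R%:E); apply: congr1.
  apply/idP/idP; rewrite !inE/= /disk/= in_itv/= -ltr_norml.
    move=> h; have h1 : y ^+ 2 < r ^+ 2 - x ^+ 2 by lra.
    rewrite -sqrtr_sqr ltr_sqrt//; apply: le_lt_trans h1; exact: sqr_ge0.
  move=> h; have s0 : 0 < Num.sqrt (r ^+ 2 - x ^+ 2) by apply: le_lt_trans h.
  have q0 : 0 < r ^+ 2 - x ^+ 2 by rewrite -sqrtr_gt0.
  by move: h; rewrite -sqrtr_sqr ltr_sqrt//; lra.
set s := Num.sqrt _.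
have h := @integral_indic _ _ _ mu setT measurableT _ (measurable_itv `](- s)%R, s[).
rewrite setIT in h; etransitivity; first exact h.
transitivity (2 * s)%:E.
  have h2 := lebesgue_measure_itv `](- s)%R, s[; etransitivity; first exact h2.
  rewrite /= lte_fin.
  have s0 : 0 <= s by exact: sqrtr_ge0.
  case: ifP => h3; first by rewrite -EFinB; congr EFin; ring.
  have -> : s = 0 by move/negbT: h3; rewrite -leNgt; lra.
  by rewrite mulr0.
rewrite patchE; case: ifPn => //; rewrite notin_setE/= in_itv/= -ler_norml => /negP.
rewrite -ltNge => h4; rewrite /s (@ler0_sqrtr _ (r ^+ 2 - x ^+ 2)) ?mulr0//.
rewrite subr_le0 -(real_normK (num_real x)) ler_pXn2r// ?nnegrE ?(ltW r0)// ltW//.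
Qed.

End DiskArea.

(** * Complex Hermite polynomials *)

Section ItoHermite.
Variable A : comNzRingType.
Implicit Types (a b k l n : nat) (z w t : A).

(* [ito a k z zb] is (zb - d/dz)^a z^k. *)
Fixpoint ito a k z w : A :=
  if a is a'.+1 then w * ito a' k z w - k%:R * ito a' k.-1 z w else z ^+ k.

Lemma itoS a k z w : ito a.+1 k z w = w * ito a k z w - k%:R * ito a k.-1 z w.
Proof. by []. Qed.

(** Mirrors the defining recurrence under the exchange of a with k and of z with w. *)
Lemma ito_succ a k z w : ito a k.+1 z w = z * ito a k z w - a%:R * ito a.-1 k z w.
Proof.
elim: a k => [|a IH] k; first by rewrite /= exprS mul0r subr0.
rewrite itoS IH [in RHS]itoS -[k.+1.-1]/k -[a.+1.-1]/a.
case: a IH => [|a] IH.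
  case: k => [|k]; first by rewrite /= expr0; ring.
  by rewrite /= exprS -[k.+2]addn1 -[k.+1]addn1 !natrD; ring.
rewrite -[a.+1.-1]/a.
case: k => [|k].
  rewrite [in RHS]itoS -[0.-1]/0%N.
  have := itoS a 0 z w; rewrite mul0r subr0 => e.
  by rewrite e; ring.
rewrite -[k.+1.-1]/k.
have h1 := IH k; rewrite -[a.+1.-1]/a in h1.
have h2 := itoS a k.+1 z w; rewrite -[k.+1.-1]/k in h2.
have -> : w * (z * ito a.+1 k.+1 z w - a.+1%:R * ito a k.+1 z w) =
  w * z * ito a.+1 k.+1 z w - a.+1%:R * (w * ito a k.+1 z w) by ring.
have -> : w * ito a k.+1 z w = ito a.+1 k.+1 z w + k.+1%:R * ito a k z w by rewrite h2; ring.
have -> : z * (w * ito a.+1 k.+1 z w - k.+1%:R * ito a.+1 k z w) =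
   w * z * ito a.+1 k.+1 z w - k.+1%:R * (z * ito a.+1 k z w) by ring.
have -> : z * ito a.+1 k z w = ito a.+1 k.+1 z w + a.+1%:R * ito a k z w by rewrite h1; ring.
rewrite -[k.+2]addn1 -[a.+2]addn1 !natrD; ring.
Qed.

(** With w = 1 it relates [ito a k t 1] to [ito a k 1 t], so that one Charlier polynomial describes
    both. *)
Lemma ito_homogeneous a k z w : z ^+ a * ito a k z w = z ^+ k * ito a k 1 (z * w).
Proof.
elim: a k => [|a IH] k; first by rewrite /= expr1n mul1r mulr1.
rewrite !itoS exprS.
have -> : z * z ^+ a * (w * ito a k z w - k%:R * ito a k.-1 z w) =
  z * w * (z ^+ a * ito a k z w) - k%:R * z * (z ^+ a * ito a k.-1 z w) by ring.
rewrite !IH; case: k => [|k]; first by rewrite !mul0r; ring.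
by rewrite -[k.+1.-1]/k exprS; ring.
Qed.

Lemma ito_rot a k (u v : A) z w : u * v = 1 ->
  ito a k (u * z) (v * w) = u ^+ k * v ^+ a * ito a k z w.
Proof.
move=> uv; elim: a k => [|a IH] k; first by rewrite /= exprMn mulr1.
rewrite !itoS !IH; case: k => [|k]; first by rewrite !mul0r exprS; ring.
rewrite -[k.+1.-1]/k !exprS.
have -> : k.+1%:R * (u ^+ k * v ^+ a * ito a k z w) =
  (u * v) * (k.+1%:R * (u ^+ k * v ^+ a * ito a k z w)) by rewrite uv mul1r.
ring.
Qed.

(* Both sides are invariant under z -> c z, w -> w / c. *)
Lemma ito_mul_swap a b k l z w : (k + b = l + a)%N ->
  ito a k z w * ito b l w z = ito a k (z * w) 1 * ito b l 1 (z * w).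
Proof.
elim: a b k l => [|a IH] b k l.
  rewrite addn0 => <- /=; rewrite addnC.
  elim: b k => [|b IHb] k; first by rewrite /= add0n expr1n exprMn mulr1.
  rewrite !itoS addSn -[(b + k).+1.-1]/(b + k)%N.
  have e1 := IHb k; have e2 := IHb k.+1; rewrite addnS exprS in e2.
  have -> : z ^+ k * (z * ito b (b + k).+1 w z - (b + k).+1%:R * ito b (b + k) w z) =
    z * z ^+ k * ito b (b + k).+1 w z - (b + k).+1%:R * (z ^+ k * ito b (b + k) w z) by ring.
  by rewrite e1 e2 exprS; ring.
move=> e; rewrite !itoS.
have s1 := ito_succ b l w z.
have s2 := ito_succ b l 1 (z * w).
have -> : (w * ito a k z w - k%:R * ito a k.-1 z w) * ito b l w z =
  ito a k z w * (ito b l.+1 w z + b%:R * ito b.-1 l w z)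
   - k%:R * (ito a k.-1 z w * ito b l w z) by rewrite s1; ring.
have -> : (1 * ito a k (z * w) 1 - k%:R * ito a k.-1 (z * w) 1) * ito b l 1 (z * w) =
  ito a k (z * w) 1 * (ito b l.+1 1 (z * w) + b%:R * ito b.-1 l 1 (z * w))
   - k%:R * (ito a k.-1 (z * w) 1 * ito b l 1 (z * w)) by rewrite s2; ring.
rewrite !mulrDr IH; last by rewrite e addSn addnS.
congr (_ + _ - _).
  case: b e {s1 s2} => [|b] e; first by rewrite !mul0r !mulr0.
  have e2 : (k + b = l + a)%N by move: e; rewrite !addnS => -[].
  have := IH b k l e2; rewrite -[b.+1.-1]/b => h.
  rewrite mulrCA h; ring.
case: k e => [|k] e; first by rewrite !mul0r.
rewrite -[k.+1.-1]/k IH//.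
by move: e; rewrite addSn addnS => -[].
Qed.

Lemma ito_conj_mul a k z w :
  ito a k z w * ito a k w z = ito a k (z * w) 1 * ito a k 1 (z * w).
Proof. exact: ito_mul_swap. Qed.

(* The limit of [itoker] is [itolim] times an exponential. *)
Fixpoint itolim a b (u v : A) : A :=
  if a is a'.+1 then u * itolim a' b u v + b%:R * itolim a' b.-1 u v else v ^+ b.

(** The Leibniz expansion of (u + d/dv)^a v^b. *)
Lemma itolimE a b (u v : A) :
  itolim a b u v = \sum_(m < a.+1) ('C(a, m) * b ^_ m)%:R * (u ^+ (a - m) * v ^+ (b - m)).
Proof.
elim: a b => [|a IH] b.
  by rewrite big_ord1 /= bin0 ffactn0 muln1 mul1r expr0 mul1r subn0.
rewrite /= !IH !mulr_sumr [RHS]big_ord_recl/=.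
rewrite [X in _ + X = _]big_ord_recr/= [X in X + _ = _]big_ord_recl/=.
rewrite [X in _ = _ + X]big_ord_recr/=.
rewrite !bin0 !ffactn0 !subn0 !binn !mul1r.
have -> : \sum_(i < a) ('C(a.+1, bump 0 i) * b ^_ (bump 0 i))%:R *
   (u ^+ (a.+1 - bump 0 i) * v ^+ (b - bump 0 i)) =
  \sum_(i < a) u * (('C(a, bump 0 i) * b ^_ (bump 0 i))%:R * (u ^+ (a - bump 0 i) * v ^+ (b - bump 0 i)))
  + \sum_(i < a) b%:R * (('C(a, i) * b.-1 ^_ i)%:R * (u ^+ (a - i) * v ^+ (b.-1 - i))).
  rewrite -big_split/=; apply: eq_bigr => i _; rewrite /bump/= add1n.
  have -> : (a.+1 - i.+1 = (a - i.+1).+1)%N by rewrite subSS subnSK.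
  have -> : (a - i = (a - i.+1).+1)%N by rewrite subnSK.
  have -> : (b.-1 - i = b - i.+1)%N by case: b => [|b] /=; rewrite ?sub0n// subSS.
  rewrite binS ffactnS !natrM natrD exprS; ring.
rewrite /bump/= add1n ffactnS ?subnn ?binn !natrM ?mul1n.
have -> : (b.-1 - a = b - a.+1)%N by case: b => [|b] /=; rewrite ?sub0n// subSS.
rewrite expr0 exprS; ring.
Qed.

End ItoHermite.

(** * Radial densities and their primitives *)

Section Radial.
Variable R : realType.
Implicit Types (a i k : nat) (t : R).

Lemma is_der_ito_l a k t : is_der t (fun s => ito a k s 1) (k%:R * ito a k.-1 t 1).
Proof.
elim: a k => [|a IH] k.
  by apply: is_der_eq; [apply: is_der_exp; exact: is_der_id|rewrite mulr1].
apply: is_der_eq.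
  apply: is_der_add; first by apply: is_der_mul; [exact: is_der_cst|exact: IH].
  by apply: is_der_opp; apply: is_der_mul; [exact: is_der_cst|exact: IH].
by cbv beta; rewrite [ito a.+1 _ _ _]itoS; ring.
Qed.

Lemma is_der_ito_r a k t : is_der t (fun s => ito a k 1 s) (a%:R * ito a.-1 k 1 t).
Proof.
elim: a k => [|a IH] k.
  by apply: is_der_eq; [exact: is_der_cst|rewrite mul0r].
have -> : (fun s => ito a.+1 k 1 s) = (fun s => s * ito a k 1 s - k%:R * ito a k.-1 1 s) by [].
apply: is_der_eq.
  apply: is_der_add; first by apply: is_der_mul; [exact: is_der_id|exact: IH].
  by apply: is_der_opp; apply: is_der_mul; [exact: is_der_cst|exact: IH].
cbv beta; rewrite -[a.+1.-1]/a.
have key : a%:R * (t * ito a.-1 k 1 t - k%:R * ito a.-1 k.-1 1 t) = a%:R * ito a k 1 t.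
  by case: a {IH} => [|a]; rewrite ?mul0r.
have -> : a.+1%:R * ito a k 1 t = a%:R * ito a k 1 t + ito a k 1 t.
  by rewrite -[a.+1]addn1 natrD; ring.
by rewrite -key; ring.
Qed.

Lemma ito_l_at0 a k : (a < k)%N -> ito a k (0 : R) 1 = 0.
Proof.
elim: a k => [|a IH] k ak; first by rewrite /= expr0n gtn_eqF.
by rewrite itoS !IH ?mulr0 ?subr0//; [case: k ak|exact: ltnW].
Qed.

Lemma ito_r_at0 a k : (k < a)%N -> ito a k 1 (0 : R) = 0.
Proof.
elim: a k => [|a IH] k ka//; rewrite itoS mul0r.
by case: k ka => [|k] ka; rewrite ?mul0r ?subr0// IH// mulr0 subr0.
Qed.

(** At t = |z|^2 this is |H_k(z)|^2 e^{-|z|^2} / (a! k!), the modulus squared being a function of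
    |z|^2 by [ito_conj_mul]. *)
Definition usq a k t : R := expR (- t) * (ito a k t 1 * ito a k 1 t) / ((a`!)%:R * (k`!)%:R).

Definition glam a k t : R := ptail k t -
  \sum_(i < a) expR (- t) * (ito i k t 1 * ito i.+1 k 1 t) / ((i.+1)`!%:R * (k`!)%:R).

(** The same telescoping as for [hecor]: the i-th summand has derivative [usq i - usq i.+1], and
    [usq 0] is the Poisson weight. *)
Lemma is_der_glam a k t : is_der t (glam a k) (usq a k t).
Proof.
have h i : is_der t (fun t => expR (- t) * (ito i k t 1 * ito i.+1 k 1 t) / ((i.+1)`!%:R * (k`!)%:R))
    (usq i k t - usq i.+1 k t).
  apply: is_der_eq.
    apply: is_der_mul; last exact: is_der_cst.
    apply: is_der_mul; first by apply: is_der_expR; apply: is_der_opp; exact: is_der_id.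
    exact: (is_der_mul (is_der_ito_l i k t) (is_der_ito_r i.+1 k t)).
  cbv beta; rewrite /usq -[i.+1.-1]/i [ito i.+1 k t 1]itoS factS natrM.
  have f1 := fact_neq0 R k; have f2 := fact_neq0 R i.
  have f3 : i.+1%:R != 0 :> R by rewrite pnatr_eq0.
  by field; rewrite f1 f2/= nat1r f3.
apply: is_der_eq.
  apply: is_der_add; first exact: is_der_ptail.
  by apply: is_der_opp; apply: is_der_sum => i; exact: h.
have -> : \sum_(i < a) (usq i k t - usq i.+1 k t) = usq 0 k t - usq a k t.
  by rewrite -(big_mkord xpredT (fun i => usq i k t - usq i.+1 k t)) (@telescope_sumr_eq _ _ _ (fun i => - usq i k t))//; [ring|move=> j _; ring].
rewrite /usq/= /pois fact0 expr1n mulr1 mul1r; ring.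
Qed.

Lemma glam_at0 a k : glam a k 0 = 0.
Proof.
rewrite /glam ptail0 big1 ?subrr// => i _.
case: (ltnP i k) => h; first by rewrite ito_l_at0// mul0r mulr0 mul0r.
by rewrite ito_r_at0// mulr0 mulr0 mul0r.
Qed.

(** The three term recurrence of the Charlier polynomials results from eliminating the values at k -
    1 between the two recurrences of [ito], both taken at (1, r^2). *)
Lemma glam_lam a k (r : R) : 0 < r -> glam a k (r ^+ 2) = lam a k r.
Proof.
move=> r0; have rn0 : r != 0 by rewrite gt_eqF.
have Ch i : ito i k 1 (r ^+ 2) = (-1) ^+ i * r ^+ i * chp i r^-1 ((k%:R - r ^+ 2) / r) /\
   ito i.+1 k 1 (r ^+ 2) = (-1) ^+ i.+1 * r ^+ i.+1 * chp i.+1 r^-1 ((k%:R - r ^+ 2) / r).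
  elim: i => [|i [h1 h2]].
    rewrite chp0 chp1 /= !expr1n; split; first by ring.
    by field.
  split => //; rewrite itoS.
  have e : k%:R * ito i.+1 k.-1 1 (r ^+ 2) =
     k%:R * ito i.+1 k 1 (r ^+ 2) + i.+1%:R * (k%:R * ito i k.-1 1 (r ^+ 2)).
    case: k {h1 h2} => [|k]; first by rewrite !mul0r; ring.
    by rewrite [ito i.+1 k.+1 _ _]ito_succ -[k.+1.-1]/k -[i.+1.-1]/i; ring.
  have e2 : k%:R * ito i k.-1 1 (r ^+ 2) = r ^+ 2 * ito i k 1 (r ^+ 2) - ito i.+1 k 1 (r ^+ 2).
    by rewrite itoS; ring.
  rewrite e e2 h1 h2 chpSS !exprS expr0.
  by field.
rewrite /glam /lam /chcor !mulr_sumr -sumrN; congr (_ + _); apply: eq_bigr => i _.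
have e := ito_homogeneous i k (r ^+ 2) 1; rewrite mulr1 in e.
have ri : (r ^+ 2) ^+ i != 0 by rewrite !expf_neq0.
have -> : ito i k (r ^+ 2) 1 = (r ^+ 2) ^+ k * ito i k 1 (r ^+ 2) / (r ^+ 2) ^+ i.
  by rewrite -e mulrAC mulfV// mul1r.
have [-> _] := Ch i; have [_ ->] := Ch i.
rewrite /pois.
have f1 := fact_neq0 R k; have f2 := fact_neq0 R i.+1.
have s1 : (-1 : R) ^+ i * (-1) ^+ i = 1 by rewrite -exprMn mulrNN mulr1 expr1n.
have e3 : (r ^+ 2) ^+ i = r ^+ i * r ^+ i by rewrite -exprM mulnC exprM expr2 -exprMn.
rewrite e3.
have ri2 : r ^+ i != 0 by rewrite expf_neq0.
set c1 := chp i _ _; set c2 := chp i.+1 _ _.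
transitivity (((-1) ^+ i * (-1) ^+ i) * (r * (expR (- r ^+ 2) * (r ^+ 2) ^+ k / k`!%:R) * (c1 * c2 / (i.+1)`!%:R)));
  last by rewrite s1 mul1r.
rewrite !exprSr.
by field; rewrite f1 f2 ri2.
Qed.

End Radial.

Section FiniteMeasureSet.
Context d (T : measurableType d) (R : realType) (m : {measure set T -> \bar R}).
Implicit Types (D : set T) (f : T -> R).

Lemma le_bounded_integrable D f (M : R) : measurable D -> (m D < +oo)%E ->
  measurable_fun D f -> (forall x, D x -> `|f x| <= M) -> m.-integrable D (EFin \o f).
Proof.
move=> mD fD mf fM; apply: measurable_bounded_integrable => //.
exists M; split; first exact: num_real.
by move=> N MN x Dx; apply: (le_trans (fM x Dx)); exact: ltW.
Qed.

Lemma Rintegral_near_cst D f (v c e : R) : measurable D -> m D = v%:E ->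
  measurable_fun D f -> (forall x, D x -> `|f x - c| <= e) ->
  `|Rintegral m D f - c * v| <= e * v.
Proof.
move=> mD mv mf fc.
have fD : (m D < +oo)%E by rewrite mv ltry.
have ic (k : R) : m.-integrable D (EFin \o (fun=> k)).
  by apply: (@le_bounded_integrable _ _ `|k|).
have If : m.-integrable D (EFin \o f).
  apply: (@le_bounded_integrable _ _ (`|c| + e)) => // x Dx.
  rewrite -(subrK c (f x)) (le_trans (ler_normD _ _))// addrC lerD2l; exact: fc.
have If2 : m.-integrable D (EFin \o (fun x => f x - c)).
  apply: (@le_bounded_integrable _ _ e) => //.
  by apply: measurable_funB.
have -> : Rintegral m D f - c * v = Rintegral m D (fun x => f x - c).
  by rewrite RintegralB// Rintegral_cst// mv.
apply: le_trans (le_normr_Rintegral mD If2) _.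
have -> : e * v = Rintegral m D (fun=> e) by rewrite Rintegral_cst// mv.
apply: le_Rintegral => //.
by apply: (@le_bounded_integrable _ _ e) => //; [apply: measurableT_comp => //; apply: measurable_funB|
  move=> x Dx; rewrite normr_id; exact: fc].
Qed.

End FiniteMeasureSet.

(** * Integrals of radial functions over disks *)

Section RadialIntegral.
Variable R : realType.
Local Notation mu := (@lebesgue_measure R).
Local Notation plane := (mu \x mu)%E.
Implicit Types (s t : R) (z : R * R).

Definition sqn z : R := z.1 ^+ 2 + z.2 ^+ 2.
Definition sdisk t : set (R * R) := [set z | sqn z < t].

Lemma sqn_ge0 z : 0 <= sqn z.
Proof. by rewrite /sqn addr_ge0 ?sqr_ge0. Qed.

Lemma sdisk_disk (r : R) : sdisk (r ^+ 2) = disk r.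
Proof. by []. Qed.

Lemma sdisk_sqrt t : 0 <= t -> sdisk t = disk (Num.sqrt t).
Proof. by move=> t0; rewrite -sdisk_disk sqr_sqrtr. Qed.

Lemma measurable_sdisk t : measurable (sdisk t).
Proof.
case: (leP 0 t) => t0; first by rewrite sdisk_sqrt//; exact: measurable_disk.
suff -> : sdisk t = set0 by exact: measurable0.
apply/seteqP; split => z //=; rewrite /sdisk/= => h.
by have := lt_trans (le_lt_trans (sqn_ge0 z) h) t0; rewrite ltxx.
Qed.

Lemma area_sdisk t : 0 <= t -> plane (sdisk t) = (pi * t)%:E.
Proof.
rewrite le_eqVlt => /predU1P[<-|t0].
  rewrite mulr0 (_ : sdisk 0 = set0) ?measure0//.
  apply/seteqP; split => z //=; rewrite /sdisk/= => h.
  by have := le_lt_trans (sqn_ge0 z) h; rewrite ltxx.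
by rewrite sdisk_sqrt ?(ltW t0)// area_disk ?sqrtr_gt0// sqr_sqrtr// ltW.
Qed.

Lemma area_annulus s t : 0 <= s <= t -> plane (sdisk t `\` sdisk s) = (pi * (t - s))%:E.
Proof.
move=> /andP[s0 st]; have ms := measurable_sdisk s; have mt := measurable_sdisk t.
have t0 : 0 <= t by exact: le_trans st.
have ft : (plane (sdisk t) < +oo)%E by rewrite area_sdisk// ltry.
have h := @measureD _ _ _ plane (sdisk t) (sdisk s) mt ms ft.
rewrite (_ : sdisk t `&` sdisk s = sdisk s) in h; last first.
  by apply/setIidPr => z; rewrite /sdisk/= => zs; exact: lt_le_trans st.
etransitivity; first exact h.
rewrite mulrBr EFinB; congr (_ - _)%E; exact: area_sdisk.
Qed.

(** Halving n times produces 2^n increments, each with a bound smaller by 4^n, so the total gains a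
    factor 2^-n. *)
Lemma bisection_null (F : R -> R) (K B : R) :
  (forall s t, 0 <= s -> s <= t -> t <= B -> `|F t - F s| <= K * (t - s) ^+ 2) ->
  forall t, 0 <= t -> t <= B -> F t = F 0.
Proof.
move=> h t t0 tB.
have step n : forall s t, 0 <= s -> s <= t -> t <= B -> `|F t - F s| <= K * (t - s) ^+ 2 / 2 ^+ n.
  elim: n => [|n IH] s u s0 su uB; first by rewrite expr0 divr1; exact: h.
  have h1 := IH s ((s + u) / 2) s0 ltac:(lra) ltac:(lra).
  have h2 := IH ((s + u) / 2) u ltac:(lra) ltac:(lra) uB.
  have -> : F u - F s = (F u - F ((s + u) / 2)) + (F ((s + u) / 2) - F s) by ring.
  apply: le_trans (ler_normD _ _) _; apply: le_trans (lerD h2 h1) _.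
  have p0 : (2 : R) ^+ n != 0 by rewrite expf_neq0.
  by rewrite le_eqVlt; apply/orP; left; apply/eqP; rewrite [2 ^+ n.+1]exprS; move: (2 ^+ n) p0 => P p0; field.
have lim0 : (fun n => K * t ^+ 2 / 2 ^+ n) @ \oo --> (0 : R).
  have h1 : (fun n => (2^-1 : R) ^+ n) @ \oo --> (0 : R).
    by apply: cvg_expr; rewrite ger0_norm ?invr_ge0//; lra.
  have -> : (fun n => K * t ^+ 2 / 2 ^+ n) = (fun n => K * t ^+ 2 * (2^-1) ^+ n).
    by apply/funext => n; rewrite exprVn.
  have := cvgM (cvg_cst (K * t ^+ 2)) h1; rewrite mulr0; exact.
have : `|F t - F 0| <= 0.
  rewrite -[leRHS](cvg_lim _ lim0)//; apply: limr_ge; first by apply: cvgP lim0.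
  by near=> n; have := step n 0 t (lexx _) t0 tB; rewrite subr0.
by rewrite normr_le0 subr_eq0 => /eqP.
Unshelve. all: by end_near. Qed.

Lemma measurable_radial (h : R -> R) D : continuous h -> measurable_fun D (fun z => h (sqn z)).
Proof.
move=> ch; apply: measurable_funTS; apply: (@measurableT_comp _ _ _ _ _ _ h).
  exact: continuous_measurable_fun.
exact: measurable_sqrnorm.
Qed.

Lemma continuous_bounded (h : R -> R) (B : R) : continuous h ->
  exists2 M : R, 0 <= M & forall t, 0 <= t <= B -> `|h t| <= M.
Proof.
move=> ch; case: (leP 0 B) => B0; last first.
  by exists 0 => // t /andP[t0 tB]; have := lt_le_trans B0 (le_trans t0 tB); rewrite ltxx.
have [c _ hc] := @EVT_max R (fun t => `|h t|) 0 B B0 ltac:(apply: continuous_subspaceT => t; apply: cvg_norm; exact: ch).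
by exists `|h c| => // t tB; apply: hc; rewrite in_itv.
Qed.

Lemma integrable_radial (h : R -> R) (T : R) : continuous h ->
  plane.-integrable (sdisk T) (fun z => (h (sqn z))%:E).
Proof.
move=> ch; have [M M0 hM] := continuous_bounded T ch.
apply: (@le_bounded_integrable _ _ R plane (sdisk T) (fun z => h (sqn z)) M).
- exact: measurable_sdisk.
- case: (leP 0 T) => T0.
    have e := area_sdisk T0. have : (plane (sdisk T) < +oo)%E by rewrite e ltry.
    exact.
  have e : sdisk T = set0.
    apply/seteqP; split => z //=; rewrite /sdisk/= => h1.
    by have := lt_trans (le_lt_trans (sqn_ge0 z) h1) T0; rewrite ltxx.
  by rewrite e measure0.
- exact: measurable_radial.
- by move=> z; rewrite /sdisk/= => zT; apply: hM; rewrite sqn_ge0 ltW.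
Qed.

(** Takes the place of polar coordinates. In t = |z|^2 an annulus has area pi (t - s), and on it h
    varies by at most K (t - s). The integral over the disk and pi G thus have increments that agree
    up to a quadratic error. *)
Lemma Rintegral_radial (G h h' : R -> R) (T : R) :
  (forall t, is_der t G (h t)) -> (forall t, is_der t h (h' t)) -> continuous h' ->
  0 <= T -> Rintegral plane (sdisk T) (fun z => h (sqn z)) = pi * (G T - G 0).
Proof.
move=> dG dh ch' T0; have ch := continuous_of_der dh.
have [K K0 hK] := continuous_bounded T ch'.
have p0 : 0 <= pi :> R by exact: pi_ge0.
have lip s t : 0 <= s -> s <= t -> t <= T -> `|h t - h s| <= K * (t - s).
  move=> s0 st tT.
  have := @derive_norm_le R h h' (fun x => K * x) (fun=> K) s t st.
  rewrite mulrBr; apply => // x /andP[sx xt].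
    by apply: is_der_eq; [apply: is_der_mul; [exact: is_der_cst|exact: is_der_id]|cbv beta; ring].
  by apply: hK; rewrite (le_trans s0 sx) (le_trans xt tT).
pose J t := Rintegral plane (sdisk t) (fun z => h (sqn z)).
have J0 : J 0 = 0.
  rewrite /J (_ : sdisk 0 = set0) ?Rintegral_set0//.
  apply/seteqP; split => z //=; rewrite /sdisk/= => h1.
  by have := le_lt_trans (sqn_ge0 z) h1; rewrite ltxx.
suff : J T - pi * G T = J 0 - pi * G 0 by rewrite J0 mulrBr -/(J T) => e; lra.
apply: (@bisection_null (fun t => J t - pi * G t) (2 * (pi * K)) T) => // s t s0 st tT.
have d0 : 0 <= t - s by rewrite subr_ge0.
have hG : `|G t - G s - h s * (t - s)| <= K * (t - s) ^+ 2.
  have := @derive_norm_le R (fun x => G x - h s * x) (fun x => h x - h s)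
    (fun x => K * (t - s) * x) (fun=> K * (t - s)) s t st.
  have -> : G t - h s * t - (G s - h s * s) = G t - G s - h s * (t - s) by ring.
  have -> : K * (t - s) * t - K * (t - s) * s = K * (t - s) ^+ 2 by ring.
  apply => x /andP[sx xt].
  - apply: is_der_eq; first apply: is_der_add; first exact: dG.
      by apply: is_der_opp; apply: is_der_mul; [exact: is_der_cst|exact: is_der_id].
    by cbv beta; ring.
  - by apply: is_der_eq; [apply: is_der_mul; [exact: is_der_cst|exact: is_der_id]|cbv beta; ring].
  - apply: le_trans (lip s x s0 sx (le_trans xt tT)) _.
    by apply: ler_wpM2l => //; rewrite lerD2r.
have mA : measurable (sdisk t `\` sdisk s).
  by apply: measurableD; exact: measurable_sdisk.
have hJ : `|J t - J s - h s * (pi * (t - s))| <= (K * (t - s)) * (pi * (t - s)).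
  have U : sdisk s `|` (sdisk t `\` sdisk s) = sdisk t.
    apply/setDUK => z; rewrite /sdisk/= => zs; exact: lt_le_trans st.
  have e : J t = J s + Rintegral plane (sdisk t `\` sdisk s) (fun z => h (sqn z)).
    rewrite {1}/J -{1}U Rintegral_setU//.
    + exact: measurable_sdisk.
    + rewrite U; exact: integrable_radial.
    + by apply/disj_setPS => z [h1 [_ h2]].
  rewrite e; set I := Rintegral _ _ _.
  have -> : J s + I - J s - h s * (pi * (t - s)) = I - h s * (pi * (t - s)) by ring.
  apply: (@Rintegral_near_cst _ _ R plane (sdisk t `\` sdisk s) (fun z => h (sqn z)) (pi * (t - s))) => //.
  + by apply: area_annulus; rewrite s0.
  + exact: measurable_radial.
  + move=> z [zt zs]; move: zt zs; rewrite /sdisk/= => zt /negP; rewrite -leNgt => sz.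
    apply: le_trans (lip s (sqn z) s0 sz (le_trans (ltW zt) tT)) _.
    by apply: ler_wpM2l => //; rewrite lerD2r ltW.
have -> : J t - pi * G t - (J s - pi * G s) =
  (J t - J s - h s * (pi * (t - s))) - pi * (G t - G s - h s * (t - s)) by ring.
apply: le_trans (ler_normB _ _) _.
rewrite normrM (ger0_norm p0).
have := lerD hJ (ler_wpM2l p0 hG); lra.
Qed.

End RadialIntegral.

(** * Expansion of the kernel *)

Section ComplexAbs.
Local Open Scope complex_scope.
Variable R : realType.
Local Notation C := R[i].
Implicit Types (x y : C) (n k : nat).

Lemma Re_mulc x y : complex.Re (x * y) = complex.Re x * complex.Re y - complex.Im x * complex.Im y.
Proof. by case: x => a b; case: y => c d. Qed.
Lemma Im_mulc x y : complex.Im (x * y) = complex.Re x * complex.Im y + complex.Im x * complex.Re y.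
Proof. by case: x => a b; case: y => c d. Qed.
Lemma Re_addc x y : complex.Re (x + y) = complex.Re x + complex.Re y.
Proof. by case: x => a b; case: y => c d. Qed.
Lemma Im_addc x y : complex.Im (x + y) = complex.Im x + complex.Im y.
Proof. by case: x => a b; case: y => c d. Qed.
Lemma Re_oppc x : complex.Re (- x) = - complex.Re x.
Proof. by case: x => a b. Qed.
Lemma Im_oppc x : complex.Im (- x) = - complex.Im x.
Proof. by case: x => a b. Qed.
Lemma Re_conjc x : complex.Re (conjc x) = complex.Re x.
Proof. by case: x => a b. Qed.
Lemma Im_conjc x : complex.Im (conjc x) = - complex.Im x.
Proof. by case: x => a b. Qed.
Lemma complex_ext x y : complex.Re x = complex.Re y -> complex.Im x = complex.Im y -> x = y.
Proof. by case: x => a b; case: y => c d /= -> ->. Qed.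
Lemma Re_sum n (F : 'I_n -> C) : complex.Re (\sum_(i < n) F i) = \sum_(i < n) complex.Re (F i).
Proof. by elim/big_rec2: _ => // i u v _ <-; rewrite Re_addc. Qed.
Lemma Im_sum n (F : 'I_n -> C) : complex.Im (\sum_(i < n) F i) = \sum_(i < n) complex.Im (F i).
Proof. by elim/big_rec2: _ => // i u v _ <-; rewrite Im_addc. Qed.
Lemma natC n : n%:R = (n%:R : R)%:C :> C.
Proof. by rewrite rmorph_nat. Qed.
Lemma invC (c : R) : (c%:C)^-1 = (c^-1)%:C :> C.
Proof. by rewrite fmorphV. Qed.

(** The l1 modulus: real valued, submultiplicative, and integrable as soon as the real and imaginary
    parts are. *)
Definition cabs x : R := `|complex.Re x| + `|complex.Im x|.

Lemma cabs_ge0 x : 0 <= cabs x.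
Proof. by rewrite /cabs addr_ge0. Qed.
Lemma cabs0 : cabs 0 = 0.
Proof. by rewrite /cabs/= normr0 addr0. Qed.
Lemma cabs_eq0 x : cabs x = 0 -> x = 0.
Proof.
move=> /eqP; rewrite /cabs paddr_eq0// !normr_eq0 => /andP[/eqP h1 /eqP h2].
exact: complex_ext.
Qed.
Lemma cabsD x y : cabs (x + y) <= cabs x + cabs y.
Proof.
rewrite /cabs Re_addc Im_addc; have := ler_normD (complex.Re x) (complex.Re y).
have := ler_normD (complex.Im x) (complex.Im y); lra.
Qed.
Lemma cabsN x : cabs (- x) = cabs x.
Proof. by rewrite /cabs Re_oppc Im_oppc !normrN. Qed.
Lemma cabsB x y : cabs (x - y) <= cabs x + cabs y.
Proof. by rewrite -(cabsN y); exact: cabsD. Qed.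
Lemma cabsC (c : R) : cabs c%:C = `|c|.
Proof. by rewrite /cabs/= normr0 addr0. Qed.
Lemma cabs_nat n : cabs n%:R = n%:R.
Proof. by rewrite natC cabsC ger0_norm. Qed.
Lemma cabsM x y : cabs (x * y) <= cabs x * cabs y.
Proof.
rewrite /cabs Re_mulc Im_mulc.
have h1 := ler_normB (complex.Re x * complex.Re y) (complex.Im x * complex.Im y).
have h2 := ler_normD (complex.Re x * complex.Im y) (complex.Im x * complex.Re y).
rewrite !normrM in h1 h2; apply: le_trans (lerD h1 h2) _.
by rewrite le_eqVlt; apply/orP; left; apply/eqP; ring.
Qed.
Lemma cabsM_le x y (a b : R) : cabs x <= a -> cabs y <= b -> cabs (x * y) <= a * b.
Proof.
move=> xa yb; apply: le_trans (cabsM x y) _.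
by apply: ler_pM => //; exact: cabs_ge0.
Qed.
Lemma cabsX_le x n (a : R) : cabs x <= a -> cabs (x ^+ n) <= a ^+ n.
Proof.
move=> xa; elim: n => [|n IH]; first by rewrite !expr0 -[1%R]/(1%:R) cabs_nat.
by rewrite !exprS; exact: cabsM_le.
Qed.
Lemma cabs_conj x : cabs (conjc x) = cabs x.
Proof. by rewrite /cabs Re_conjc Im_conjc normrN. Qed.
Lemma normRe_le x : `|complex.Re x| <= cabs x.
Proof. by rewrite /cabs lerDl. Qed.
Lemma normIm_le x : `|complex.Im x| <= cabs x.
Proof. by rewrite /cabs lerDr. Qed.
Lemma cabs_le x (a : R) : `|complex.Re x| <= a -> `|complex.Im x| <= a -> cabs x <= 2 * a.
Proof. by rewrite /cabs; lra. Qed.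

End ComplexAbs.

(** * Partial sums of the complex exponential *)

Section ExpPartialSum.
Local Open Scope complex_scope.
Variable R : realType.
Local Notation C := R[i].
Implicit Types (x : C) (n k : nat).

Definition cexp (a b : R) : C := (expR a * cos b) +i* (expR a * sin b).

Definition eN n x : C := \sum_(k < n) x ^+ k / (k`!)%:R.

Lemma factC_neq0 n : (n`!)%:R != 0 :> C.
Proof. by rewrite pnatr_eq0 -lt0n fact_gt0. Qed.

Let term x k : C := x ^+ k / (k`!)%:R.

Let termS x k : k.+1%:R * term x k.+1 = x * term x k.
Proof.
rewrite /term factS natrM exprS; have := factC_neq0 k.
have n0 : k.+1%:R != 0 :> C by rewrite pnatr_eq0.
move: (_%:R) (k.+1%:R) n0 => f m m0 f0; field; by rewrite f0 m0.
Qed.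

Let P x n t := \sum_(k < n) complex.Re (term x k) * t ^+ k.
Let Q x n t := \sum_(k < n) complex.Im (term x k) * t ^+ k.

Let is_derP x n t : is_der t (P x n.+1) (complex.Re x * P x n t - complex.Im x * Q x n t).
Proof.
elim: n => [|n IH].
  have -> : P x 1 = fun=> complex.Re (term x 0).
    by apply/funext => s; rewrite /P big_ord1 expr0 mulr1.
  rewrite /P /Q !big_ord0 !mulr0 subr0; exact: is_der_cst.
rewrite {1}/P; under eq_fun do rewrite big_ord_recr/=.
apply: is_der_eq.
  apply: is_der_add; first exact: IH.
  apply: is_der_mul; first exact: is_der_cst.
  apply: is_der_exp; exact: is_der_id.
cbv beta; rewrite /P /Q ![in RHS]big_ord_recr/= -/(P x n t) -/(Q x n t).
have e : n.+1%:R * complex.Re (term x n.+1) = complex.Re x * complex.Re (term x n) - complex.Im x * complex.Im (term x n).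
  by rewrite -Re_mulc -termS natC Re_mulc/= mul0r subr0.
rewrite -/(term x n) -/(term x n.+1) mul0r addr0 mulr1 mulrA [_ * n.+1%:R]mulrC e; ring.
Qed.

Let is_derQ x n t : is_der t (Q x n.+1) (complex.Re x * Q x n t + complex.Im x * P x n t).
Proof.
elim: n => [|n IH].
  have -> : Q x 1 = fun=> complex.Im (term x 0).
    by apply/funext => s; rewrite /Q big_ord1 expr0 mulr1.
  rewrite /P /Q !big_ord0 !mulr0 addr0; exact: is_der_cst.
rewrite {1}/Q; under eq_fun do rewrite big_ord_recr/=.
apply: is_der_eq.
  apply: is_der_add; first exact: IH.
  apply: is_der_mul; first exact: is_der_cst.
  apply: is_der_exp; exact: is_der_id.
cbv beta; rewrite /P /Q ![in RHS]big_ord_recr/= -/(P x n t) -/(Q x n t).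
have e : n.+1%:R * complex.Im (term x n.+1) = complex.Re x * complex.Im (term x n) + complex.Im x * complex.Re (term x n).
  by rewrite -Im_mulc -termS natC Im_mulc/= mul0r addr0.
rewrite -/(term x n) -/(term x n.+1) mul0r addr0 mulr1 mulrA [_ * n.+1%:R]mulrC e; ring.
Qed.

(* e^{-tx} eN(n+1, tx) has derivative - x e^{-tx} (tx)^n / n!. *)
Lemma eN_close x n (rho : R) : cabs x <= rho ->
  cabs (eN n.+1 x - cexp (complex.Re x) (complex.Im x)) <= 4 * expR rho ^+ 2 * (rho * (rho ^+ n / (n`!)%:R)).
Proof.
move=> xr; set a := complex.Re x; set b := complex.Im x.
have r0 : 0 <= rho by apply: le_trans xr; exact: cabs_ge0.
pose E := expR rho * (rho * (rho ^+ n / (n`!)%:R)).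
have xn : cabs (x * term x n) <= rho * (rho ^+ n / (n`!)%:R).
  apply: cabsM_le => //; apply: cabsM_le; first exact: cabsX_le.
  by rewrite natC invC cabsC ger0_norm// invr_ge0.
have dc t : is_der t (fun t => cos (t * b)) (- sin (t * b) * b).
  apply: (@is_der_comp _ cos (fun t => t * b)); first exact: is_derive_cos.
  by apply: is_der_eq; [apply: is_der_mul; [exact: is_der_id|exact: is_der_cst]|cbv beta; ring].
have ds t : is_der t (fun t => sin (t * b)) (cos (t * b) * b).
  apply: (@is_der_comp _ sin (fun t => t * b)); first exact: is_derive_sin.
  by apply: is_der_eq; [apply: is_der_mul; [exact: is_der_id|exact: is_der_cst]|cbv beta; ring].
have de t : is_der t (fun t => expR (- (t * a))) (expR (- (t * a)) * - a).
  apply: is_der_expR.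
  by apply: is_der_eq; [apply: is_der_opp; apply: is_der_mul; [exact: is_der_id|exact: is_der_cst]|cbv beta; ring].
have PS t : P x n.+1 t = P x n t + complex.Re (term x n) * t ^+ n by rewrite /P big_ord_recr.
have QS t : Q x n.+1 t = Q x n t + complex.Im (term x n) * t ^+ n by rewrite /Q big_ord_recr.
(* [D1] and [D2] are the real and imaginary parts of e^{-tx} times the partial sum at tx; they start
   from 1 and 0 at t = 0. *)
pose D1 t := expR (- (t * a)) * (cos (t * b) * P x n.+1 t + sin (t * b) * Q x n.+1 t).
pose D2 t := expR (- (t * a)) * (cos (t * b) * Q x n.+1 t - sin (t * b) * P x n.+1 t).
have dD1 t : is_der t D1 (- (expR (- (t * a)) * t ^+ n *
   (cos (t * b) * complex.Re (x * term x n) + sin (t * b) * complex.Im (x * term x n)))).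
  apply: is_der_eq.
    apply: is_der_mul; first exact: de.
    apply: is_der_add; apply: is_der_mul; [exact: dc|exact: is_derP|exact: ds|exact: is_derQ].
  by cbv beta; rewrite Re_mulc Im_mulc PS QS -/a -/b; ring.
have dD2 t : is_der t D2 (- (expR (- (t * a)) * t ^+ n *
   (cos (t * b) * complex.Im (x * term x n) - sin (t * b) * complex.Re (x * term x n)))).
  apply: is_der_eq.
    apply: is_der_mul; first exact: de.
    apply: is_der_add; first by apply: is_der_mul; [exact: dc|exact: is_derQ].
    by apply: is_der_opp; apply: is_der_mul; [exact: ds|exact: is_derP].
  by cbv beta; rewrite Re_mulc Im_mulc PS QS -/a -/b; ring.
have bnd t (u v : R) : 0 <= t <= 1 -> `|u| + `|v| <= rho * (rho ^+ n / (n`!)%:R) ->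
   `|expR (- (t * a)) * t ^+ n * (cos (t * b) * u + sin (t * b) * v)| <= E.
  move=> /andP[t0 t1] uv; rewrite normrM; apply: ler_pM => //.
    rewrite normrM (ger0_norm (expR_ge0 _)) (ger0_norm (exprn_ge0 _ t0)).
    rewrite -[leRHS]mulr1; apply: ler_pM; rewrite ?expR_ge0 ?exprn_ge0//.
      rewrite ler_expR; apply: le_trans (ler_norm _) _; rewrite normrN normrM (ger0_norm t0).
      apply: le_trans (_ : 1 * `|a| <= _); first exact: ler_wpM2r.
      by rewrite mul1r; apply: le_trans xr; exact: normRe_le.
    exact: exprn_ile1.
  apply: le_trans uv; apply: le_trans (ler_normD _ _) _; apply: lerD.
    rewrite normrM -[leRHS]mul1r; apply: ler_wpM2r => //.
    by rewrite ler_norml cos_geN1 cos_le1.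
  rewrite normrM -[leRHS]mul1r; apply: ler_wpM2r => //.
  by rewrite ler_norml sin_geN1 sin_le1.
have dE t : is_der t (fun t => E * t) E.
  by apply: is_der_eq; [apply: is_der_mul; [exact: is_der_cst|exact: is_der_id]|cbv beta; ring].
have h1 : `|D1 1 - D1 0| <= E.
  have := @derive_norm_le R D1 _ (fun t => E * t) (fun=> E) 0 1 ler01 (fun t _ => dD1 t) (fun t _ => dE t).
  rewrite mulr1 mulr0 subr0; apply => t t01; rewrite normrN; apply: bnd => //.
have h2 : `|D2 1 - D2 0| <= E.
  have := @derive_norm_le R D2 _ (fun t => E * t) (fun=> E) 0 1 ler01 (fun t _ => dD2 t) (fun t _ => dE t).
  rewrite mulr1 mulr0 subr0; apply => t t01; rewrite normrN.
  have h := bnd t (complex.Im (x * term x n)) (- complex.Re (x * term x n)) t01.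
  rewrite (mulrN (sin (t * b))) normrN in h; apply: h.
  by rewrite addrC; exact: xn.
have t0 : term x 0 = 1 by rewrite /term expr0 fact0 divr1.
have P0 : P x n.+1 0 = 1.
  rewrite /P big_ord_recl t0 expr0 mulr1 big1 ?addr0//.
  by move=> i _; rewrite expr0n mulr0.
have Q0 : Q x n.+1 0 = 0.
  rewrite /Q big_ord_recl t0 expr0 mulr1 big1 ?addr0//.
  by move=> i _; rewrite expr0n mulr0.
have D10 : D1 0 = 1 by rewrite /D1 !mul0r oppr0 expR0 cos0 sin0 P0; ring.
have D20 : D2 0 = 0 by rewrite /D2 !mul0r oppr0 expR0 cos0 sin0 Q0; ring.
rewrite D10 in h1; rewrite D20 subr0 in h2.
have eP : complex.Re (eN n.+1 x) = P x n.+1 1.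
  by rewrite /eN Re_sum /P; apply: eq_bigr => i _; rewrite expr1n mulr1.
have eQ : complex.Im (eN n.+1 x) = Q x n.+1 1.
  by rewrite /eN Im_sum /Q; apply: eq_bigr => i _; rewrite expr1n mulr1.
have sc : cos b ^+ 2 + sin b ^+ 2 = 1 by exact: cos2Dsin2.
have ee : expR a * expR (- a) = 1 by rewrite -expRD subrr expR0.
have -> : eN n.+1 x - cexp a b = cexp a b * ((D1 1 - 1) +i* D2 1).
  have id1 : P x n.+1 1 = expR a * (cos b * D1 1 - sin b * D2 1).
    rewrite /D1 /D2 !mul1r.
    transitivity ((expR a * expR (- a)) * (cos b ^+ 2 + sin b ^+ 2) * P x n.+1 1); first by rewrite ee sc; ring.
    ring.
  have id2 : Q x n.+1 1 = expR a * (cos b * D2 1 + sin b * D1 1).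
    rewrite /D1 /D2 !mul1r.
    transitivity ((expR a * expR (- a)) * (cos b ^+ 2 + sin b ^+ 2) * Q x n.+1 1); first by rewrite ee sc; ring.
    ring.
  apply: complex_ext.
    by rewrite Re_addc Re_oppc eP Re_mulc/= id1; ring.
  by rewrite Im_addc Im_oppc eQ Im_mulc/= id2; ring.
have c1 : cabs (cexp a b) <= 2 * expR rho.
  have ea : expR a <= expR rho.
    by rewrite ler_expR; apply: le_trans (ler_norm _) _; apply: le_trans xr; exact: normRe_le.
  have g (u : R) : `|u| <= 1 -> `|expR a * u| <= expR rho.
    move=> u1; rewrite normrM (ger0_norm (expR_ge0 _)) -[leRHS]mulr1.
    by apply: ler_pM => //; exact: expR_ge0.
  by apply: cabs_le => /=; apply: g; rewrite ler_norml ?cos_geN1 ?cos_le1 ?sin_geN1 ?sin_le1.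
have c2 : cabs ((D1 1 - 1) +i* D2 1) <= 2 * E by exact: cabs_le.
apply: le_trans (cabsM_le c1 c2) _.
by rewrite le_eqVlt; apply/orP; left; apply/eqP; rewrite /E; ring.
Qed.

End ExpPartialSum.

(** * Uniform convergence of the bilinear Hermite series *)

Section KernelExpansion.
Local Open Scope complex_scope.
Variable R : realType.
Local Notation C := R[i].
Implicit Types (a b k N : nat) (z w : R * R) (e : R).

Definition zc z : C := z.1 +i* z.2.

Definition Hf a k z : C := ito a k (zc z) (conjc (zc z)).

Lemma conj_ito a k (x y : C) : conjc (ito a k x y) = ito a k (conjc x) (conjc y).
Proof.
elim: a k => [|a IH] k; first by rewrite /= rmorphXn.
by rewrite !itoS rmorphB !rmorphM/= !IH rmorph_nat.
Qed.

Lemma conj_Hf a k z : conjc (Hf a k z) = ito a k (conjc (zc z)) (zc z).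
Proof. by rewrite /Hf conj_ito conjcK. Qed.

(** Two orders a and b are carried along because the recursion in a brings in b - 1; the kernel
    itself has a = b. *)
Definition itoker a b N z w : C := \sum_(k < N)
  ito a k (zc z) (conjc (zc z)) * ito b k (conjc (zc w)) (zc w) / (k`!)%:R.

Lemma sum_ito_shift (F G : nat -> C) N :
  \sum_(k < N.+1) k%:R * F k.-1 * G k / (k`!)%:R = \sum_(k < N) F k * G k.+1 / (k`!)%:R.
Proof.
rewrite big_ord_recl !mul0r add0r; apply: eq_bigr => k _.
rewrite -[nat_of_ord (lift ord0 k)]/(k.+1)%N factS natrM -[k.+1.-1]/(k : nat); have f0 := factC_neq0 R k.
have n0 : k.+1%:R != 0 :> C by rewrite pnatr_eq0.
move: (k`!%:R) (k.+1%:R) f0 n0 => f m f0 m0.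
by move: (F _) (G _) => u v; field; rewrite f0 m0.
Qed.

(** Summation by parts: k/k! shifts the index, so that lowering k in the first factor becomes
    raising it in the second, where [ito_succ] applies. Up to the boundary term at N, this is the
    recursion of [itolim] with u = conj z - conj w. *)
Lemma itokerS a b N z w : itoker a.+1 b N.+1 z w =
  (conjc (zc z) - conjc (zc w)) * itoker a b N.+1 z w + b%:R * itoker a b.-1 N.+1 z w
  + ito a N (zc z) (conjc (zc z)) * ito b N.+1 (conjc (zc w)) (zc w) / (N`!)%:R.
Proof.
set x := zc z; set xb := conjc x; set y := zc w; set yb := conjc y.
have -> : itoker a.+1 b N.+1 z w = xb * itoker a b N.+1 z w -
    \sum_(k < N.+1) k%:R * ito a k.-1 x xb * ito b k yb y / (k`!)%:R.
  rewrite /itoker mulr_sumr -sumrB; apply: eq_bigr => k _; rewrite itoS -/x -/xb -/y -/yb; ring.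
rewrite (sum_ito_shift (fun k => ito a k x xb) (fun k => ito b k yb y)).
have -> : \sum_(k < N) ito a k x xb * ito b k.+1 yb y / (k`!)%:R =
  yb * itoker a b N.+1 z w - b%:R * itoker a b.-1 N.+1 z w
   - ito a N x xb * ito b N.+1 yb y / (N`!)%:R.
  rewrite /itoker !mulr_sumr -sumrB big_ord_recr/= -/x -/xb -/y -/yb.
  rewrite [ito b N.+1 _ _]ito_succ -[LHS]addr0 -addrA; congr (_ + _); last by ring.
  by apply: eq_bigr => k _; rewrite ito_succ; ring.
ring.
Qed.

Lemma itoker0S b N z w : itoker 0 b.+1 N.+1 z w =
  (zc w - zc z) * itoker 0 b N.+1 z w
  + zc z * (ito 0 N (zc z) (conjc (zc z)) * ito b N (conjc (zc w)) (zc w) / (N`!)%:R).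
Proof.
set x := zc z; set xb := conjc x; set y := zc w; set yb := conjc y.
have -> : itoker 0 b.+1 N.+1 z w = y * itoker 0 b N.+1 z w -
    \sum_(k < N.+1) k%:R * ito b k.-1 yb y * x ^+ k / (k`!)%:R.
  rewrite /itoker mulr_sumr -sumrB; apply: eq_bigr => k _; rewrite itoS -/x -/xb -/y -/yb/=; ring.
rewrite (sum_ito_shift (fun k => ito b k yb y) (fun k => x ^+ k)).
have -> : \sum_(k < N) ito b k yb y * x ^+ k.+1 / (k`!)%:R =
  x * itoker 0 b N.+1 z w - x * (ito 0 N x xb * ito b N yb y / (N`!)%:R).
  rewrite /itoker !mulr_sumr big_ord_recr/= -/x -/xb -/y -/yb addrK.
  by apply: eq_bigr => k _; rewrite exprS; ring.
ring.
Qed.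

Section Uniform.
Variable r : R.
Let rho := 2 * `|r| + 1.

Definition unull (F : nat -> R * R -> R * R -> C) := forall e, 0 < e ->
  exists N0, forall N z w, (N0 <= N)%N -> disk r z -> disk r w -> cabs (F N z w) <= e.

Definition ubdd (g : R * R -> R * R -> C) := exists2 M : R, 0 <= M &
  forall z w, disk r z -> disk r w -> cabs (g z w) <= M.

Lemma rho_ge1 : 1 <= rho.
Proof. by rewrite /rho lerDr mulr_ge0. Qed.

Lemma cabs_zc z : disk r z -> cabs (zc z) <= rho.
Proof.
rewrite /disk/= => h; rewrite /cabs/=.
have h1 : `|z.1| <= `|r|.
  rewrite -!sqrtr_sqr ler_wsqrtr//; apply: le_trans (ltW h); rewrite lerDl; exact: sqr_ge0.
have h2 : `|z.2| <= `|r|.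
  rewrite -!sqrtr_sqr ler_wsqrtr//; apply: le_trans (ltW h); rewrite lerDr; exact: sqr_ge0.
rewrite /rho; lra.
Qed.

Lemma unullD F G : unull F -> unull G -> unull (fun N z w => F N z w + G N z w).
Proof.
move=> hF hG e e0; have e2 : 0 < e / 2 by lra.
have [N1 h1] := hF _ e2; have [N2 h2] := hG _ e2.
exists (maxn N1 N2) => N z w; rewrite geq_max => /andP[n1 n2] dz dw.
by apply: le_trans (cabsD _ _) _; have := lerD (h1 N z w n1 dz dw) (h2 N z w n2 dz dw); lra.
Qed.

Lemma unullM g F : ubdd g -> unull F -> unull (fun N z w => g z w * F N z w).
Proof.
move=> [M M0 hg] hF e e0; have M1 : 0 < M + 1 by lra.
have [N1 h1] := hF (e / (M + 1)) ltac:(by rewrite divr_gt0).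
exists N1 => N z w n1 dz dw.
have h : M * (e / (M + 1)) <= e.
  by rewrite mulrA ler_pdivrMr// mulrC ler_wpM2l ?(ltW e0)// lerDl.
apply: le_trans h; apply: cabsM_le; [exact: hg|exact: h1].
Qed.

Lemma unull_le (u : nat -> R) F : u @ \oo --> (0 : R) ->
  (forall N z w, disk r z -> disk r w -> cabs (F N z w) <= u N) -> unull F.
Proof.
move=> /cvgrPdist_le hu hF e e0; have [N0 _ h] := hu e e0.
exists N0 => N z w n0 dz dw; apply: le_trans (hF N z w dz dw) _.
by have := h N n0; rewrite sub0r normrN; apply: le_trans; exact: ler_norm.
Qed.

Lemma unull_eq F G : (forall N z w, F N z w = G N z w) -> unull F -> unull G.
Proof. by move=> FG hF e e0; have [N0 h] := hF e e0; exists N0 => N z w *; rewrite -FG; exact: h. Qed.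

Lemma ubddD g h : ubdd g -> ubdd h -> ubdd (fun z w => g z w + h z w).
Proof.
move=> [M M0 hg] [M' M0' hh]; exists (M + M'); first by rewrite addr_ge0.
by move=> z w dz dw; apply: le_trans (cabsD _ _) _; apply: lerD; [exact: hg|exact: hh].
Qed.

Lemma ubddN g : ubdd g -> ubdd (fun z w => - g z w).
Proof. by move=> [M M0 hg]; exists M => // z w dz dw; rewrite cabsN; exact: hg. Qed.

Lemma ubdd_zc1 : ubdd (fun z w => zc z).
Proof. by exists rho => [|z w dz _]; [have := rho_ge1; lra|exact: cabs_zc]. Qed.
Lemma ubdd_zc2 : ubdd (fun z w => zc w).
Proof. by exists rho => [|z w _ dw]; [have := rho_ge1; lra|exact: cabs_zc]. Qed.
Lemma ubdd_zcb1 : ubdd (fun z w => conjc (zc z)).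
Proof. by exists rho => [|z w dz _]; [have := rho_ge1; lra|rewrite cabs_conj; exact: cabs_zc]. Qed.
Lemma ubdd_zcb2 : ubdd (fun z w => conjc (zc w)).
Proof. by exists rho => [|z w _ dw]; [have := rho_ge1; lra|rewrite cabs_conj; exact: cabs_zc]. Qed.
Lemma ubdd_nat n : ubdd (fun z w => n%:R).
Proof. by exists n%:R => // z w _ _; rewrite cabs_nat. Qed.

Lemma ito_bound a k (x y : C) : cabs x <= rho -> cabs y <= rho ->
  cabs (ito a k x y) <= (rho + k%:R) ^+ a * rho ^+ k.
Proof.
move=> hx hy; have r1 := rho_ge1; have r0 : 0 <= rho by lra.
elim: a k => [|a IH] k; first by rewrite expr0 mul1r /=; exact: cabsX_le.
rewrite itoS; apply: le_trans (cabsB _ _) _.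
have h1 : cabs (y * ito a k x y) <= rho * ((rho + k%:R) ^+ a * rho ^+ k).
  by apply: cabsM_le => //; exact: IH.
have h2 : cabs (k%:R * ito a k.-1 x y) <= k%:R * ((rho + k%:R) ^+ a * rho ^+ k).
  apply: cabsM_le; first by rewrite cabs_nat.
  apply: le_trans (IH k.-1) _; apply: ler_pM.
  - by rewrite exprn_ge0// addr_ge0.
  - exact: exprn_ge0.
  - by apply: lerXn2r; rewrite ?nnegrE ?addr_ge0// lerD2l ler_nat leq_pred.
  - by apply: ler_weXn2l => //; exact: leq_pred.
apply: le_trans (lerD h1 h2) _.
by rewrite exprS le_eqVlt; apply/orP; left; apply/eqP; ring.
Qed.

Lemma exp_coeff_cvg0 (x : R) : (fun n => x ^+ n / (n`!)%:R) @ \oo --> (0 : R).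
Proof. exact: (cvg_series_cvg_0 (is_cvg_series_exp_coeff x)). Qed.

(** The polynomial factor is at most p! e^{rho + n + 1}, which leaves a multiple of (e rho^2)^n /
    n!. *)
Lemma rem_cvg0 p : (fun n => (rho + n.+1%:R) ^+ p * rho ^+ (2 * n).+1 / (n`!)%:R) @ \oo --> (0 : R).
Proof.
have r1 := rho_ge1; have r0 : 0 <= rho by lra.
pose c := (p`!)%:R * expR (rho + 1) * rho.
have h : (fun n => c * ((expR 1 * rho ^+ 2) ^+ n / (n`!)%:R)) @ \oo --> (0 : R).
  by have := cvgM (cvg_cst c) (exp_coeff_cvg0 (expR 1 * rho ^+ 2)); rewrite mulr0; exact.
apply: (squeeze_cvgr _ (cvg_cst 0) h).
near=> n; apply/andP; split.
  by rewrite !mulr_ge0// exprn_ge0// addr_ge0.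
rewrite mulrA ler_wpM2r ?invr_ge0//.
have e1 : (rho + n.+1%:R) ^+ p <= (p`!)%:R * expR (rho + n.+1%:R).
  have x0 : 0 <= rho + n.+1%:R by rewrite addr_ge0.
  have := expR_ge1Dxn p x0.
  case: p @c h => [|p] c h; first by rewrite expr0 fact0 mul1r; have := expR_ge1Dx (rho + n.+1%:R); lra.
  move=> _; have := @expR_ge1Dxn R (rho + n.+1%:R) p x0 => h3.
  have f0 : 0 < ((p.+1)`!)%:R :> R by rewrite ltr0n fact_gt0.
  rewrite mulrC -ler_pdivrMr//; lra.
apply: le_trans (ler_wpM2r _ e1) _; first exact: exprn_ge0.
rewrite /c exprMn -expRM_natl -exprM exprS mulr1 -[n.+1]addn1 natrD addrA expRD expRD [expR (rho + 1)]expRD.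
by rewrite le_eqVlt; apply/orP; left; apply/eqP; ring.
Unshelve. all: by end_near. Qed.

(** [d] tells apart the boundary term of [itokerS], with second index N + 1, and that of [itoker0S],
    with second index N. *)
Lemma unull_rem a b (d : bool) : unull (fun N z w =>
  ito a N (zc z) (conjc (zc z)) * ito b (d + N) (conjc (zc w)) (zc w) / (N`!)%:R).
Proof.
have r1 := rho_ge1; have r0 : 0 <= rho by lra.
apply: (unull_le (rem_cvg0 (a + b))) => N z w dz dw.
have hz := cabs_zc dz; have hw := cabs_zc dw.
have hzb : cabs (conjc (zc z)) <= rho by rewrite cabs_conj.
have hwb : cabs (conjc (zc w)) <= rho by rewrite cabs_conj.
have f1 : cabs ((N`!)%:R^-1 : C) <= (N`!)%:R^-1.
  by rewrite natC invC cabsC ger0_norm// invr_ge0.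
have dN : (d + N <= N.+1)%N by case: d.
have h1 n m : (m <= N.+1)%N -> (rho + m%:R) ^+ n <= (rho + N.+1%:R) ^+ n.
  by move=> mN; apply: lerXn2r; rewrite ?nnegrE ?addr_ge0// lerD2l ler_nat.
have e0 n m : 0 <= (rho + m%:R) ^+ n by rewrite exprn_ge0// addr_ge0.
have ha : cabs (ito a N (zc z) (conjc (zc z))) <= (rho + N.+1%:R) ^+ a * rho ^+ N.
  by apply: le_trans (ito_bound a N hz hzb) _; apply: ler_wpM2r; [exact: exprn_ge0|exact: h1].
have hb : cabs (ito b (d + N) (conjc (zc w)) (zc w)) <= (rho + N.+1%:R) ^+ b * rho ^+ N.+1.
  apply: le_trans (ito_bound b (d + N) hwb hw) _; apply: ler_pM => //.
  - exact: exprn_ge0.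
  - exact: h1.
  - exact: ler_weXn2l.
have h := cabsM_le (cabsM_le ha hb) f1.
apply: le_trans h _; rewrite ler_wpM2r ?invr_ge0//.
have -> : (2 * N).+1 = (N + N.+1)%N by rewrite addnS addnn mul2n.
by rewrite !exprD le_eqVlt; apply/orP; left; apply/eqP; ring.
Qed.

Definition kexp z w : C :=
  cexp (z.1 * w.1 + z.2 * w.2) (z.2 * w.1 - z.1 * w.2).

Lemma zcM z w : zc z * conjc (zc w) = (z.1 * w.1 + z.2 * w.2) +i* (z.2 * w.1 - z.1 * w.2).
Proof. by apply: complex_ext; rewrite ?Re_mulc ?Im_mulc/=; ring. Qed.

Lemma unull_exp : unull (fun N z w => itoker 0 0 N.+1 z w - kexp z w).
Proof.
have r1 := rho_ge1.
have h : (fun n => 4 * expR (rho ^+ 2) ^+ 2 * (rho ^+ 2 * ((rho ^+ 2) ^+ n / (n`!)%:R))) @ \oo --> (0 : R).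
  have := cvgM (cvg_cst (4 * expR (rho ^+ 2) ^+ 2)) (cvgM (cvg_cst (rho ^+ 2)) (exp_coeff_cvg0 (rho ^+ 2))).
  by rewrite !mulr0; exact.
apply: (unull_le h) => N z w dz dw.
have x1 : cabs (zc z * conjc (zc w)) <= rho ^+ 2.
  by rewrite expr2; apply: cabsM_le; [exact: cabs_zc|rewrite cabs_conj; exact: cabs_zc].
have := eN_close N x1; rewrite zcM.
have -> : itoker 0 0 N.+1 z w = eN N.+1 ((z.1 * w.1 + z.2 * w.2) +i* (z.2 * w.1 - z.1 * w.2)).
  by rewrite /itoker /eN -zcM; apply: eq_bigr => k _; rewrite /= exprMn.
exact.
Qed.

Lemma unull_itoker a b : unull (fun N z w => itoker a b N.+1 z w -
  itolim a b (conjc (zc z) - conjc (zc w)) (zc w - zc z) * kexp z w).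
Proof.
have b1 : ubdd (fun z w => conjc (zc z) - conjc (zc w)).
  by apply: ubddD; [exact: ubdd_zcb1|apply: ubddN; exact: ubdd_zcb2].
have b2 : ubdd (fun z w => zc w - zc z).
  by apply: ubddD; [exact: ubdd_zc2|apply: ubddN; exact: ubdd_zc1].
elim: a b => [|a IH] b.
  elim: b => [|b IH]; first by apply: unull_eq unull_exp => N z w; rewrite /= expr0 mul1r.
  apply: (unull_eq _ (unullD (unullM b2 IH) (unullM ubdd_zc1 (unull_rem 0 b false)))) => N z w.
  by rewrite itoker0S /= exprS; ring.
apply: (unull_eq _ (unullD (unullD (unullM b1 (IH b)) (unullM (ubdd_nat b) (IH b.-1))) (unull_rem a b true))) => N z w.
by rewrite itokerS /=; ring.
Qed.

End Uniform.
End KernelExpansion.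

(** * Complex-valued integrals *)

Section KernelSeries.
Local Open Scope complex_scope.
Variable R : realType.
Local Notation C := R[i].
Implicit Types (a k N : nat) (z w : R * R).

(** For equal orders only the product u v enters the Leibniz expansion, and reversing the summation
    gives a! times the Laguerre sum. *)
Lemma itolim_laguerre a (u v : C) (x : R) : u * v = (- x)%:C ->
  itolim a a u v = (a`!)%:R * (laguerre a x)%:C.
Proof.
move=> uv; rewrite itolimE /laguerre rmorph_sum mulr_sumr/=.
rewrite (reindex_inj rev_ord_inj)/=; apply: eq_bigr => i _.
rewrite subSS; have ia : (i <= a)%N by rewrite -ltnS.
rewrite (subKn ia) -exprMn uv bin_sub//.
rewrite -(ffact_fact (leq_subr i a)) (subKn ia).
have -> : ('C(a, i)%:R * (- x) ^+ i / (i`!)%:R)%:C = 'C(a, i)%:R * (- x)%:C ^+ i / (i`!)%:R :> C.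
  by rewrite rmorphM rmorphM/= rmorphXn fmorphV !rmorph_nat.
rewrite !natrM.
have := factC_neq0 R i; move: (i`!%:R) => f f0; move: ((- x)%:C ^+ i) => y; by field.
Qed.

Definition Hker a N z w : C :=
  \sum_(k < N) Hf a k z * conjc (Hf a k w) / ((a`!)%:R * (k`!)%:R).

Lemma Hker_itoker a N z w : Hker a N z w = itoker a a N z w / (a`!)%:R.
Proof.
rewrite /Hker /itoker mulr_suml; apply: eq_bigr => k _.
by rewrite conj_Hf /Hf invfM [(a`!)%:R^-1 * _]mulrC mulrA.
Qed.

(** Here u v = (conj z - conj w)(w - z) = -|z - w|^2. *)
Lemma Kker_expansion a (r : R) : unull r (fun N z w => Kker a z w - Hker a N.+1 z w).
Proof.
have h := unull_itoker r a a.
have hb : ubdd r (fun z w => - (a`!)%:R^-1).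
  exists (a`!)%:R^-1; first by rewrite invr_ge0.
  by move=> z w _ _; rewrite cabsN natC invC cabsC ger0_norm// invr_ge0.
apply: (unull_eq _ (unullM hb h)) => N z w.
rewrite Hker_itoker.
have uv : (conjc (zc z) - conjc (zc w)) * (zc w - zc z) =
   (- ((z.1 - w.1) ^+ 2 + (z.2 - w.2) ^+ 2))%:C.
  by apply: complex_ext; rewrite ?Re_mulc ?Im_mulc /=; ring.
rewrite (itolim_laguerre a uv) /Kker -[exp_zwbar z w]/(kexp z w).
have := factC_neq0 R a; move: (a`!%:R) => f f0; by field.
Qed.

End KernelSeries.

Section ComplexIntegral.
Local Open Scope complex_scope.
Context d (T : measurableType d) (R : realType) (m : {measure set T -> \bar R}).
Variables (D : set T) (mD : measurable D).
Local Notation C := R[i].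
Implicit Types (f g : T -> C) (c : C) (n : nat).
Local Notation Re := (@complex.Re R).
Local Notation Im := (@complex.Im R).

Definition cmeas f := measurable_fun D (fun x => Re (f x)) /\ measurable_fun D (fun x => Im (f x)).

Definition cintegrable f := m.-integrable D (fun x => (Re (f x))%:E) /\
  m.-integrable D (fun x => (Im (f x))%:E).

Definition cI f : C := (Rintegral m D (fun x => Re (f x))) +i* (Rintegral m D (fun x => Im (f x))).

Lemma cmeas_cst c : cmeas (fun=> c).
Proof. by split; exact: measurable_cst. Qed.

Lemma cmeasD f g : cmeas f -> cmeas g -> cmeas (fun x => f x + g x).
Proof.
move=> [f1 f2] [g1 g2]; split.
  by under eq_fun do rewrite Re_addc; exact: measurable_funD.
by under eq_fun do rewrite Im_addc; exact: measurable_funD.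
Qed.

Lemma cmeasN f : cmeas f -> cmeas (fun x => - f x).
Proof.
move=> [f1 f2]; split.
  by under eq_fun do rewrite Re_oppc; exact: measurableT_comp.
by under eq_fun do rewrite Im_oppc; exact: measurableT_comp.
Qed.

Lemma cmeasM f g : cmeas f -> cmeas g -> cmeas (fun x => f x * g x).
Proof.
move=> [f1 f2] [g1 g2]; split.
  by under eq_fun do rewrite Re_mulc; apply: measurable_funB; exact: measurable_funM.
by under eq_fun do rewrite Im_mulc; apply: measurable_funD; exact: measurable_funM.
Qed.

Lemma cmeas_conj f : cmeas f -> cmeas (fun x => conjc (f x)).
Proof.
move=> [f1 f2]; split; first by under eq_fun do rewrite Re_conjc.
by under eq_fun do rewrite Im_conjc; exact: measurableT_comp.
Qed.

Lemma cmeas_real (f : T -> R) : measurable_fun D f -> cmeas (fun x => (f x)%:C).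
Proof. by move=> mf; split => //; exact: measurable_cst. Qed.

Lemma cmeas_sum n (F : 'I_n -> T -> C) : (forall i, cmeas (F i)) ->
  cmeas (fun x => \sum_(i < n) F i x).
Proof.
elim: n F => [|n IH] F mF; first by under eq_fun do rewrite big_ord0; exact: cmeas_cst.
by under eq_fun do rewrite big_ord_recr/=; apply: cmeasD => //; apply: IH.
Qed.

Lemma cintegrable_cmeas f : cintegrable f -> cmeas f.
Proof.
move=> [/integrableP[h1 _] /integrableP[h2 _]].
by split; apply/measurable_EFinP.
Qed.

Lemma cintegrable_le f (g : T -> R) : cmeas f ->
  m.-integrable D (fun x => (g x)%:E) -> (forall x, D x -> cabs (f x) <= g x) -> cintegrable f.
Proof.
move=> [f1 f2] ig fg; split; apply: (le_integrable mD _ _ ig).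
- exact/measurable_EFinP.
- move=> x Dx; rewrite !abse_EFin lee_fin; apply: le_trans (ler_norm _).
  by apply: le_trans (fg x Dx); exact: normRe_le.
- exact/measurable_EFinP.
- move=> x Dx; rewrite !abse_EFin lee_fin; apply: le_trans (ler_norm _).
  by apply: le_trans (fg x Dx); exact: normIm_le.
Qed.

Lemma cintegrable_cabs f : cintegrable f -> m.-integrable D (fun x => (cabs (f x))%:E).
Proof.
move=> [h1 h2].
have := integrableD mD (integrable_norm h1) (integrable_norm h2); exact.
Qed.

Lemma cintegrableM f g (M : R) : cmeas f -> (forall x, D x -> cabs (f x) <= M) ->
  cintegrable g -> cintegrable (fun x => f x * g x).
Proof.
move=> mf fM ig; have mg := cintegrable_cmeas ig.
apply: (@cintegrable_le _ (fun x => M * cabs (g x))); first exact: cmeasM.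
  have := integrableZl mD M (cintegrable_cabs ig); exact.
by move=> x Dx; apply: cabsM_le => //; exact: fM.
Qed.

Lemma cintegrableZ c f : cintegrable f -> cintegrable (fun x => c * f x).
Proof. by apply: (@cintegrableM (fun=> c) f (cabs c)) => //; exact: cmeas_cst. Qed.

Lemma cintegrableD f g : cintegrable f -> cintegrable g -> cintegrable (fun x => f x + g x).
Proof.
move=> [f1 f2] [g1 g2]; split.
  under eq_fun do rewrite Re_addc EFinD; have := integrableD mD f1 g1; exact.
under eq_fun do rewrite Im_addc EFinD; have := integrableD mD f2 g2; exact.
Qed.

Lemma cintegrableN f : cintegrable f -> cintegrable (fun x => - f x).
Proof. by move=> h; under eq_fun do rewrite -mulN1r; exact: cintegrableZ. Qed.

Lemma cintegrable0 : cintegrable (fun=> 0).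
Proof. by split; exact: integrable0. Qed.

Lemma cintegrable_sum n (F : 'I_n -> T -> C) : (forall i, cintegrable (F i)) ->
  cintegrable (fun x => \sum_(i < n) F i x).
Proof.
elim: n F => [|n IH] F mF; first by under eq_fun do rewrite big_ord0; exact: cintegrable0.
by under eq_fun do rewrite big_ord_recr/=; apply: cintegrableD => //; apply: IH.
Qed.

Lemma cID f g : cintegrable f -> cintegrable g -> cI (fun x => f x + g x) = cI f + cI g.
Proof.
move=> [f1 f2] [g1 g2]; apply: complex_ext; rewrite ?Re_addc ?Im_addc /=.
  by under eq_Rintegral do rewrite Re_addc; rewrite RintegralD.
by under eq_Rintegral do rewrite Im_addc; rewrite RintegralD.
Qed.

Lemma cIZ c f : cintegrable f -> cI (fun x => c * f x) = c * cI f.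
Proof.
move=> [f1 f2]; apply: complex_ext; rewrite ?Re_mulc ?Im_mulc /=.
  under eq_Rintegral do rewrite Re_mulc.
  rewrite RintegralB ?RintegralZl//; [have := integrableZl mD (Re c) f1|have := integrableZl mD (Im c) f2]; exact.
under eq_Rintegral do rewrite Im_mulc.
rewrite RintegralD ?RintegralZl//; [have := integrableZl mD (Re c) f2|have := integrableZl mD (Im c) f1]; exact.
Qed.

Lemma cIB f g : cintegrable f -> cintegrable g -> cI (fun x => f x - g x) = cI f - cI g.
Proof.
move=> hf hg; rewrite cID//; last exact: cintegrableN.
rewrite -[- cI g]mulN1r -cIZ//; congr (_ + cI _).
by apply/funext => x; rewrite mulN1r.
Qed.

Lemma cI_sum n (F : 'I_n -> T -> C) : (forall i, cintegrable (F i)) ->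
  cI (fun x => \sum_(i < n) F i x) = \sum_(i < n) cI (F i).
Proof.
elim: n F => [|n IH] F mF.
  rewrite big_ord0; under eq_fun do rewrite big_ord0.
  by rewrite /cI /= Rintegral_cst// mul0r.
rewrite big_ord_recr/= -IH// -cID//; last by apply: cintegrable_sum.
by congr cI; apply/funext => x; rewrite big_ord_recr.
Qed.

Lemma eq_cI f g : (forall x, D x -> f x = g x) -> cI f = cI g.
Proof.
by move=> fg; apply: complex_ext => /=; apply: eq_Rintegral => x; rewrite inE => Dx; rewrite fg.
Qed.

Lemma Rintegral_ae_le (f g : T -> R) : m.-integrable D (fun x => (f x)%:E) ->
  m.-integrable D (fun x => (g x)%:E) -> (forall x, D x -> 0 <= g x) ->
  {ae m, forall x, D x -> `|f x| <= g x} -> `|Rintegral m D f| <= Rintegral m D g.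
Proof.
move=> If Ig g0 fg; apply: le_trans (le_normr_Rintegral mD If) _.
have If' := integrable_norm If.
apply: fine_le.
- have := integrable_fin_num mD If'; exact.
- exact: integrable_fin_num.
apply: ae_ge0_le_integral.
- exact: mD.
- by move=> x _; rewrite lee_fin.
- by have /integrableP[] := If'.
- by move=> x Dx; rewrite lee_fin g0.
- by have /integrableP[] := Ig.
- by apply: filterS fg => x h Dx; rewrite lee_fin; exact: h.
Qed.

Lemma cabs_cI_ae_le f (g : T -> R) : cintegrable f ->
  m.-integrable D (fun x => (g x)%:E) -> (forall x, D x -> 0 <= g x) ->
  {ae m, forall x, D x -> cabs (f x) <= g x} -> cabs (cI f) <= 2 * Rintegral m D g.
Proof.
move=> [f1 f2] ig g0 fg; apply: cabs_le => /=; apply: Rintegral_ae_le => //.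
  by apply: filterS fg => x h Dx; apply: le_trans (h Dx); exact: normRe_le.
by apply: filterS fg => x h Dx; apply: le_trans (h Dx); exact: normIm_le.
Qed.

Lemma cabs_cI_le f (g : T -> R) : cintegrable f ->
  m.-integrable D (fun x => (g x)%:E) -> (forall x, D x -> cabs (f x) <= g x) ->
  cabs (cI f) <= 2 * Rintegral m D g.
Proof.
move=> hf ig fg; apply: cabs_cI_ae_le => //.
  by move=> x Dx; apply: le_trans (fg x Dx); exact: cabs_ge0.
by apply: aeW.
Qed.

Lemma ae_mono (P Q : T -> Prop) : {ae m, forall x, P x} -> (forall x, P x -> Q x) ->
  {ae m, forall x, Q x}.
Proof. by move=> hP PQ; apply: filterS hP. Qed.

Lemma ae_forall (I : finType) (P : I -> T -> Prop) : (forall i, {ae m, forall x, P i x}) ->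
  {ae m, forall x, forall i, P i x}.
Proof. by move=> h; exact: filter_forall. Qed.

Lemma cI_ae0 f : cintegrable f -> {ae m, forall x, D x -> f x = 0} -> cI f = 0.
Proof.
move=> hf f0; apply: cabs_eq0; apply/eqP; rewrite eq_le cabs_ge0 andbT.
have i0 : m.-integrable D (fun=> (0 : R)%:E) by exact: integrable0.
have := @cabs_cI_ae_le f (fun=> 0) hf i0 (fun _ _ => lexx _).
rewrite Rintegral_cst// mul0r mulr0; apply.
by apply: ae_mono f0 _ => x h Dx; rewrite h// cabs0.
Qed.

End ComplexIntegral.

(** * The eigenfunctions on the disk *)

Section EigenvalueRange.
Local Open Scope complex_scope.
Variable R : realType.
Local Notation C := R[i].
Implicit Types (a k i : nat) (t : R) (z : R * R).

Lemma rmorph_ito (A B : comNzRingType) (f : {rmorphism A -> B}) a k (x y : A) :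
  f (ito a k x y) = ito a k (f x) (f y).
Proof.
elim: a k => [|a IH] k; first by rewrite /= rmorphXn.
by rewrite !itoS rmorphB !rmorphM/= !IH rmorph_nat.
Qed.

Lemma zc_sqn z : zc z * conjc (zc z) = (sqn z)%:C.
Proof. by apply: complex_ext; rewrite ?Re_mulc ?Im_mulc/= /sqn; ring. Qed.

Lemma Hf_sqr a k z : conjc (Hf a k z) * Hf a k z = (ito a k (sqn z) 1 * ito a k 1 (sqn z))%:C.
Proof.
rewrite conj_Hf [LHS]mulrC /Hf [LHS]ito_conj_mul zc_sqn.
by rewrite rmorphM/= !(rmorph_ito (real_complex R)) rmorph1.
Qed.

Lemma conj_mulc (x : C) : conjc x * x = (complex.Re x ^+ 2 + complex.Im x ^+ 2)%:C.
Proof. by apply: complex_ext; rewrite ?Re_mulc ?Im_mulc ?Re_conjc ?Im_conjc/=; ring. Qed.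

Lemma ito_sqr_ge0 a k t : 0 <= t -> 0 <= ito a k t 1 * ito a k 1 t.
Proof.
move=> t0; have := Hf_sqr a k (Num.sqrt t, 0).
have -> : sqn (Num.sqrt t, 0) = t by rewrite /sqn/= sqr_sqrtr// expr0n addr0.
rewrite conj_mulc => -[<-]; by rewrite addr_ge0 ?sqr_ge0.
Qed.

Lemma usq_ge0 a k t : 0 <= t -> 0 <= usq a k t.
Proof.
move=> t0; rewrite /usq mulr_ge0 ?invr_ge0//.
by apply: mulr_ge0; [exact: expR_ge0|exact: ito_sqr_ge0].
Qed.

Lemma ito_real_bound a k t (x y : R) : 1 <= t -> `|x| <= t -> `|y| <= t ->
  `|ito a k x y| <= k.+1%:R ^+ a * t ^+ (a + k).
Proof.
move=> t1 hx hy; have t0 : 0 <= t by lra.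
elim: a k => [|a IH] k.
  by rewrite expr0 mul1r add0n /= normrX; apply: lerXn2r; rewrite ?nnegrE.
rewrite itoS; apply: le_trans (ler_normB _ _) _; rewrite !normrM.
have h1 : `|y| * `|ito a k x y| <= t * (k.+1%:R ^+ a * t ^+ (a + k)).
  by apply: ler_pM => //; exact: IH.
have h2 : `|k%:R : R| * `|ito a k.-1 x y| <= k%:R * (k.+1%:R ^+ a * t ^+ (a.+1 + k)).
  rewrite ger0_norm//; apply: ler_wpM2l => //; apply: le_trans (IH k.-1) _.
  apply: ler_pM; rewrite ?exprn_ge0//.
    by apply: lerXn2r; rewrite ?nnegrE// ler_nat ltnS leq_pred.
  by apply: ler_weXn2l => //; rewrite leq_add// leq_pred.
apply: le_trans (lerD h1 h2) _.
by rewrite addSn !exprS -[in X in _ <= X * _ * _]natr1 le_eqVlt; apply/orP; left; apply/eqP; ring.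
Qed.

Lemma cvg_sum0 n (f : 'I_n -> R -> R) :
  (forall j : 'I_n, f j t @[t --> +oo] --> (0 : R)) -> \sum_(j < n) f j t @[t --> +oo] --> (0 : R).
Proof.
elim: n f => [|n IH] f hf.
  by under eq_cvg do rewrite big_ord0; exact: cvg_cst.
under eq_cvg do rewrite big_ord_recr/=.
by have := cvgD (IH _ (fun l => hf (widen_ord (leqnSn n) l))) (hf ord_max); rewrite addr0; exact.
Qed.

(** Each correction term is dominated by a multiple of the Poisson weight whose index is the total
    degree of the polynomial bound. *)
Lemma glam_cvg1 a k : glam a k t @[t --> +oo] --> (1 : R).
Proof.
suff h0 : \sum_(i < a) expR (- t) * (ito i k t 1 * ito i.+1 k 1 t) / ((i.+1)`!%:R * (k`!)%:R)
    @[t --> +oo] --> (0 : R).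
  by have := cvgB (@ptail_cvg1 R k) h0; rewrite subr0; exact.
apply: cvg_sum0 => i.
pose p := ((i + k) + (i.+1 + k))%N.
pose c := k.+1%:R ^+ i * k.+1%:R ^+ i.+1 * (p`!)%:R / ((i.+1)`!%:R * (k`!)%:R) : R.
have h : c * pois p t @[t --> +oo] --> (0 : R).
  by have := cvgM (cvg_cst c) (@pois_cvg0 R p); rewrite mulr0; exact.
have hN : - (c * pois p t) @[t --> +oo] --> (0 : R).
  by have := cvgN h; rewrite oppr0; exact.
apply: (squeeze_cvgr _ hN h).
near=> t; rewrite -ler_norml normrM [`|_^-1|]ger0_norm ?invr_ge0// /c.
have t1 : 1 <= t by near: t; exact: nbhs_pinfty_ge.
have f0 : 0 < (i.+1)`!%:R * (k`!)%:R :> R by rewrite mulr_gt0 ?fact_gt0R.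
rewrite mulrAC ler_pM2r ?invr_gt0//.
have t0 : 0 <= t by lra.
have b1 := @ito_real_bound i k t t 1 t1 ltac:(by rewrite ger0_norm) ltac:(by rewrite normr1).
have b2 := @ito_real_bound i.+1 k t 1 t t1 ltac:(by rewrite normr1) ltac:(by rewrite ger0_norm).
rewrite normrM (ger0_norm (expR_ge0 _)) /pois.
rewrite normrM; apply: le_trans (ler_wpM2l (expR_ge0 _) (ler_pM _ _ b1 b2)) _ => //.
have fp := fact_neq0 R p.
rewrite /p [t ^+ (i + k + _)]exprD -/p le_eqVlt; apply/orP; left; apply/eqP.
by field.
Unshelve. all: by end_near. Qed.

(** [glam] is nondecreasing because [usq] is nonnegative, and it goes from 0 at t = 0 to 1 at
    infinity. This supplies the hypothesis 0 <= [lam] <= 1 of the analytic sections. *)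
Lemma glam_range a k t : 0 <= t -> 0 <= glam a k t <= 1.
Proof.
have nd (s u : R) : 0 <= s -> s <= u -> glam a k s <= glam a k u.
  move=> s0 su; apply: (@derive_ge0_le _ _ (usq a k) _ _ su) => [x _|x /andP[sx _]]; first exact: is_der_glam.
  by apply: usq_ge0; exact: le_trans sx.
move=> t0; rewrite -{1}(glam_at0 R a k) nd//=.
rewrite -[leRHS](cvg_lim _ (glam_cvg1 a k))//; apply: limr_ge; first exact: cvgP (glam_cvg1 a k).
by near=> s; apply: nd => //; near: s; exact: nbhs_pinfty_ge.
Unshelve. all: by end_near. Qed.

Lemma lam_range a k (r : R) : 0 < r -> 0 <= lam a k r <= 1.
Proof. by move=> r0; rewrite -glam_lam//; apply: glam_range; exact: sqr_ge0. Qed.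

End EigenvalueRange.

(** * Inner products of the complex Hermite functions *)

Section InnerProducts.
Local Open Scope complex_scope.
Variable R : realType.
Local Notation C := R[i].
Local Notation mu := (@lebesgue_measure R).
Local Notation plane := (mu \x mu)%E.
Implicit Types (a k j : nat) (t r : R) (z : R * R) (D : set (R * R)).

Lemma cmeas_zc D : cmeas D (@zc R).
Proof. by split; apply: measurable_funTS; [exact: measurable_fst|exact: measurable_snd]. Qed.

Lemma cmeas_ito D a k (f g : R * R -> C) : cmeas D f -> cmeas D g ->
  cmeas D (fun z => ito a k (f z) (g z)).
Proof.
move=> mf mg; elim: a k => [|a IH] k.
  elim: k => [|k IHk]; first by under eq_fun do rewrite /= expr0; exact: cmeas_cst.
  by under eq_fun do rewrite /= exprS; exact: cmeasM.
under eq_fun do rewrite itoS.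
apply: cmeasD; first exact: cmeasM.
by apply: cmeasN; apply: cmeasM => //; exact: cmeas_cst.
Qed.

Lemma cmeas_Hf D a k : cmeas D (Hf a k : R * R -> C).
Proof. by apply: cmeas_ito; [exact: cmeas_zc|apply: cmeas_conj; exact: cmeas_zc]. Qed.

Lemma measurable_gauss D : measurable_fun D (@gauss R).
Proof.
apply: measurable_funTS; apply: measurable_funM => //.
apply: measurableT_comp => //; apply: measurableT_comp => //; exact: measurable_sqrnorm.
Qed.

Lemma cmeas_gauss D : cmeas D (fun z : R * R => (gauss z)%:C).
Proof. by apply: cmeas_real; exact: measurable_gauss. Qed.

Lemma gauss_ge0 z : 0 <= gauss z.
Proof. by rewrite /gauss mulr_ge0 ?expR_ge0// invr_ge0 pi_ge0. Qed.

Lemma gauss_le1 z : gauss z <= 1.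
Proof.
rewrite /gauss ler_pdivrMr ?pi_gt0// mul1r.
apply: (@le_trans _ _ 1); last by have := pi_ge2 R; lra.
by rewrite -expR0 ler_expR oppr_le0; exact: sqn_ge0.
Qed.

Definition ip a r j k : C :=
  cI plane (disk r) (fun z => conjc (Hf a j z) * Hf a k z * (gauss z)%:C).

Lemma ip_diag a r k : 0 < r -> ip a r k k = ((a`!)%:R * (k`!)%:R * lam a k r)%:C.
Proof.
move=> r0; have p0 : pi != 0 :> R by rewrite gt_eqF// pi_gt0.
have fa := fact_neq0 R a; have fk := fact_neq0 R k.
pose c : R := (a`!)%:R * (k`!)%:R / pi.
have e z : conjc (Hf a k z) * Hf a k z * (gauss z)%:C = (c * usq a k (sqn z))%:C.
  rewrite Hf_sqr -rmorphM/=; congr (_%:C); rewrite /gauss /usq /c -/(sqn z).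
  by clear -fa fk p0; move: (@pi R) p0 => p p0; field; rewrite fa fk p0.
have dh (t : R) : is_der t (usq a k) ((expR (- t) * (ito a k t 1 * (a%:R * ito a.-1 k 1 t)
    + k%:R * ito a k.-1 t 1 * ito a k 1 t) + expR (- t) * -1 * (ito a k t 1 * ito a k 1 t))
    / ((a`!)%:R * (k`!)%:R)).
  apply: is_der_eq.
    apply: is_der_mul; last exact: is_der_cst.
    apply: is_der_mul; first by apply: is_der_expR; apply: is_der_opp; exact: is_der_id.
    exact: (is_der_mul (is_der_ito_l a k t) (is_der_ito_r a k t)).
  by cbv beta; rewrite mulr0 add0r.
have cl i l : continuous (fun t : R => ito i l t 1).
  by apply: continuous_of_der => t; exact: is_der_ito_l.
have cr i l : continuous (fun t : R => ito i l 1 t).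
  by apply: continuous_of_der => t; exact: is_der_ito_r.
have ce : continuous (fun t : R => expR (- t)).
  move=> t; apply: (@cvg_comp _ _ _ (fun x => - x) expR _ (nbhs (- t))); last exact: continuous_expR.
  exact: cvgN.
rewrite /ip; apply: complex_ext => /=.
  rewrite (@eq_Rintegral _ _ _ plane (disk r) (fun z => c * usq a k (sqn z))); last first.
    by move=> z _; rewrite e.
  rewrite RintegralZl; last 2 first.
  - exact: measurable_disk.
  - rewrite -sdisk_disk; apply: (@integrable_radial R (usq a k)).
    exact: (continuous_of_der dh).
  have := @Rintegral_radial R (glam a k) (usq a k) _ (r ^+ 2) (is_der_glam a k) dh _ (sqr_ge0 r).
  rewrite sdisk_disk => ->.
    by rewrite glam_at0 glam_lam// subr0 /c; clear -p0; move: (@pi R) p0 => p p0; field.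
  move=> t; apply: cvgM; last exact: cvg_cst.
  apply: cvgD; apply: cvgM.
  - exact: ce.
  - apply: cvgD; first by apply: cvgM; [exact: cl|apply: cvgM; [exact: cvg_cst|exact: cr]].
    by apply: cvgM; [apply: cvgM; [exact: cvg_cst|exact: cl]|exact: cr].
  - by apply: cvgM; [exact: ce|exact: cvg_cst].
  - by apply: cvgM; [exact: cl|exact: cr].
rewrite (@eq_Rintegral _ _ _ plane (disk r) (fun=> 0)); last by move=> z _; rewrite e.
by rewrite Rintegral_cst ?mul0r//; exact: measurable_disk.
Qed.

(** A root of i and not of -1, so that w = -1 is excluded: its powers are real. The rotation by w is
    then within reach of the shear factorisation. *)
Lemma root_of_i n : (0 < n)%N -> exists u v : R,
  [/\ u ^+ 2 + v ^+ 2 = 1, 1 + u != 0 & (u +i* v) ^+ n = 'i%C].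
Proof.
move=> n0.
have [w wn] : exists w : C, w ^+ n = 'i%C.
  by exists (n.-root 'i%C); rewrite rootCK.
have n1 : `|w| = 1.
  have : `|w| ^+ n = 1.
    rewrite -normrX wn; rewrite normc_def/= expr0n add0r expr1n sqrtr1//.
  by move/eqP; rewrite pexpr_eq1// => /eqP.
exists (complex.Re w), (complex.Im w); split.
- have := add_Re2_Im2 w; rewrite n1 expr1n => /eqP; rewrite eq_complex/= => /andP[/eqP].
  by [].
- apply/eqP => h.
  have hu : complex.Re w = -1 by lra.
  have : complex.Re w ^+ 2 + complex.Im w ^+ 2 = 1.
    have := add_Re2_Im2 w; rewrite n1 expr1n => /eqP; rewrite eq_complex/= => /andP[/eqP].
    by [].
  rewrite hu sqrrN expr1n => h2.
  have hv : complex.Im w = 0 by apply/eqP; rewrite -sqrf_eq0; apply/eqP; lra.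
  have ew : w = (-1 : R)%:C by apply: complex_ext.
  have : complex.Im (w ^+ n) = 0 by rewrite ew -rmorphXn.
  by rewrite wn/= => /eqP; rewrite oner_eq0.
- by rewrite -wn; congr (_ ^+ _); apply: complex_ext.
Qed.

Lemma zc_rot (u v : R) z : zc (rot u v z) = (u +i* v) * zc z.
Proof. by apply: complex_ext; rewrite ?Re_mulc ?Im_mulc/=; ring. Qed.

Lemma Hf_rot a k (u v : R) z : u ^+ 2 + v ^+ 2 = 1 ->
  Hf a k (rot u v z) = (u +i* v) ^+ k * conjc (u +i* v) ^+ a * Hf a k z.
Proof.
move=> uv; rewrite /Hf zc_rot rmorphM; apply: ito_rot.
by apply: complex_ext; rewrite ?Re_mulc ?Im_mulc ?Re_conjc ?Im_conjc/=; [rewrite -uv|]; ring.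
Qed.

Lemma sqn_rot (u v : R) z : u ^+ 2 + v ^+ 2 = 1 -> sqn (rot u v z) = sqn z.
Proof.
move=> uv; rewrite /sqn /rot/=.
have -> : (u * z.1 - v * z.2) ^+ 2 + (v * z.1 + u * z.2) ^+ 2 = (u ^+ 2 + v ^+ 2) * (z.1 ^+ 2 + z.2 ^+ 2) by ring.
by rewrite uv mul1r.
Qed.

Lemma disk_fin r : (plane (disk r) < +oo)%E.
Proof.
have e := @area_sdisk R (r ^+ 2) (sqr_ge0 r); rewrite sdisk_disk in e.
have h : (plane (disk r) < +oo)%E by rewrite e ltry.
exact: h.
Qed.

Lemma integrable_cst_disk r (c : R) : plane.-integrable (disk r) (fun=> c%:E).
Proof.
apply: (@le_bounded_integrable _ _ R plane (disk r) (fun=> c) `|c|) => //.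
- exact: measurable_disk.
- exact: disk_fin.
Qed.

Lemma cintegrable_bdd r (f : R * R -> C) (M : R) : cmeas (disk r) f ->
  (forall z, disk r z -> cabs (f z) <= M) -> cintegrable plane (disk r) f.
Proof.
move=> mf fM; apply: (@cintegrable_le _ _ R plane (disk r) (measurable_disk r) f (fun=> M)) => //.
exact: integrable_cst_disk.
Qed.

Lemma Hf_bdd a k r : exists2 M : R, 0 <= M & forall z, disk r z -> cabs (Hf a k z) <= M.
Proof.
exists ((2 * `|r| + 1 + k%:R) ^+ a * (2 * `|r| + 1) ^+ k).
  by rewrite mulr_ge0// exprn_ge0// !addr_ge0// mulr_ge0.
by move=> z dz; apply: ito_bound; rewrite ?cabs_conj; exact: cabs_zc.
Qed.

Lemma cabs_gauss z : cabs ((gauss z)%:C : C) <= 1.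
Proof. by rewrite cabsC ger0_norm ?gauss_ge0// gauss_le1. Qed.

Lemma cintegrable_ip a j k r :
  cintegrable plane (disk r) (fun z => conjc (Hf a j z) * Hf a k z * (gauss z)%:C).
Proof.
have [M M0 hM] := Hf_bdd a j r; have [M' M0' hM'] := Hf_bdd a k r.
apply: (@cintegrable_bdd r _ (M * M' * 1)).
  by apply: cmeasM; [apply: cmeasM; [apply: cmeas_conj|]; exact: cmeas_Hf|exact: cmeas_gauss].
move=> z dz; apply: cabsM_le; last exact: cabs_gauss.
by apply: cabsM_le; [rewrite cabs_conj; exact: hM|exact: hM'].
Qed.

Lemma cI_rot r (u v : R) (f : R * R -> C) : u ^+ 2 + v ^+ 2 = 1 -> 1 + u != 0 ->
  cmeas setT f -> cI plane (disk r) (fun z => f (rot u v z)) = cI plane (disk r) f.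
Proof.
move=> uv u1 [m1 m2]; apply: complex_ext => /=.
  exact: (Rintegral_disk_rot r uv u1 m1).
exact: (Rintegral_disk_rot r uv u1 m2).
Qed.

(** Rotation by w multiplies the integrand by conj(w)^j w^k. With w^|j-k| = i this factor differs
    from 1, while the integral is invariant. *)
Lemma ip_orth a r j k : j != k -> ip a r j k = 0.
Proof.
move=> jk.
have [u [v [uv u1 rv]]] : exists u v : R, [/\ u ^+ 2 + v ^+ 2 = 1, 1 + u != 0 &
    (u +i* v) ^+ k != (u +i* v) ^+ j].
  have hn : (0 < maxn j k - minn j k)%N by case: (ltngtP j k) jk => // h _; rewrite subn_gt0.
  have [u [v [uv u1 e]]] := root_of_i hn.
  exists u, v; split => //.
  have w0 : (u +i* v) != 0 :> C.
    apply/eqP => w0; move: e; rewrite w0 expr0n gtn_eqF//= => /eqP.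
    by rewrite eq_sym eq_complex/= oner_eq0 andbF.
  have i1 : 'i%C != 1 :> C by rewrite eq_complex/= oner_eq0 andbF.
  case: (ltngtP j k) jk e => // h _ e.
    rewrite -(subnK (ltnW h)) exprD e; apply/eqP => h2; move/eqP: i1; apply.
    by apply: (mulIf (expf_neq0 j w0)); rewrite mul1r.
  rewrite -(subnK (ltnW h)) exprD e eq_sym; apply/eqP => h2; move/eqP: i1; apply.
  by apply: (mulIf (expf_neq0 k w0)); rewrite mul1r.
pose w : C := u +i* v.
have ww : w * conjc w = 1.
  by apply: complex_ext; rewrite ?Re_mulc ?Im_mulc ?Re_conjc ?Im_conjc/=; [rewrite -uv|]; ring.
have ww' n : w ^+ n * conjc w ^+ n = 1 by rewrite -exprMn ww expr1n.
pose F z := conjc (Hf a j z) * Hf a k z * (gauss z)%:C.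
have Frot z : F (rot u v z) = (conjc w ^+ j * w ^+ k) * F z.
  rewrite /F !Hf_rot// -/w.
  have -> : gauss (rot u v z) = gauss z by rewrite /gauss -!/(sqn _) sqn_rot.
  have conjX n (x : C) : conjc (x ^+ n) = conjc x ^+ n by rewrite rmorphXn.
  have conjM (x y : C) : conjc (x * y) = conjc x * conjc y by rewrite rmorphM.
  rewrite !conjM !conjX conjcK.
  have e := ww' a.
  transitivity ((w ^+ a * conjc w ^+ a) * ((conjc w ^+ j * w ^+ k) * (conjc (Hf a j z) * Hf a k z * (gauss z)%:C))).
    by move: (conjc (Hf a j z)) (conjc w) ((gauss z)%:C) => q wb g; ring.
  by rewrite e mul1r.
have mF : cmeas setT F.
  by apply: cmeasM; [apply: cmeasM; [apply: cmeas_conj|]; exact: cmeas_Hf|exact: cmeas_gauss].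
have e1 := cI_rot r uv u1 mF.
have e2 : cI plane (disk r) (fun z => F (rot u v z)) = (conjc w ^+ j * w ^+ k) * ip a r j k.
  rewrite -(@cIZ _ _ R plane (disk r) (measurable_disk r)); last exact: cintegrable_ip.
  by apply: eq_cI => z _; rewrite Frot.
have e3 : ip a r j k = (conjc w ^+ j * w ^+ k) * ip a r j k := etrans (esym e1) e2.
apply/eqP; apply: contraNT rv => i0; rewrite -/w.
have e4 : conjc w ^+ j * w ^+ k = 1 by apply: (mulIf i0); rewrite mul1r; exact: (esym e3).
by rewrite -[X in X == _]mul1r -(ww' j) -mulrA e4 mulr1.
Qed.

End InnerProducts.

(** * Multiplicities and the trace *)

Section Eigenfunctions.
Local Open Scope complex_scope.
Variables (R : realType) (a : nat) (r : R).
Hypothesis r0 : 0 < r.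
Local Notation C := R[i].
Local Notation mu := (@lebesgue_measure R).
Local Notation plane := (mu \x mu)%E.
Local Notation D := (disk r).
Implicit Types (k j N n : nat) (l e : R) (z w : R * R) (g : R * R -> C).

(* The measurability of the disk with respect to the display carried by [plane]. *)
Let mD := (fun d (T : measurableType d) (m : {measure set T -> \bar R}) (A : set T)
  (h : measurable A) => h) _ _ plane D (measurable_disk r).

(** On the disk the weight is at least e^{-r^2}/pi, and |t| <= (1 + t^2)/2. *)
Lemma inL2_cintegrable g : inL2 r g -> cintegrable plane D g.
Proof.
move=> [m1 m2 ig].
pose c := pi * expR (r ^+ 2).
pose q w := (complex.Re (g w) ^+ 2 + complex.Im (g w) ^+ 2) * gauss w.
apply: (@cintegrable_le _ _ R plane D mD g (fun w => 1 + c * q w)); first by split.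
  have i1 := integrable_cst_disk r 1.
  have ig' : plane.-integrable D (fun w => (q w)%:E) := ig.
  have i2 := integrableZl mD c ig'.
  have := integrableD mD i1 i2; exact.
move=> w Dw; set x := complex.Re (g w); set y := complex.Im (g w).
have cg : 1 <= c * gauss w.
  have -> : c * gauss w = expR (r ^+ 2 - (w.1 ^+ 2 + w.2 ^+ 2)).
    rewrite /c /gauss expRD; have p0 : pi != 0 :> R by rewrite gt_eqF// pi_gt0.
    by move: (@pi R) p0 => p p0; field.
  by rewrite -expR0 ler_expR subr_ge0; apply: ltW; exact: Dw.
have h0 : 0 <= x ^+ 2 + y ^+ 2 by rewrite addr_ge0 ?sqr_ge0.
have h1 : x ^+ 2 + y ^+ 2 <= c * q w.
  by rewrite /q -/x -/y mulrCA -[leLHS]mulr1; apply: ler_wpM2l.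
have hx (t : R) : `|t| <= (1 + t ^+ 2) / 2.
  rewrite -(real_normK (num_real t)); have := sqr_ge0 (1 - `|t|); rewrite !expr2; lra.
have := hx x; have := hx y; rewrite /cabs -/x -/y; lra.
Qed.

Lemma laguerre_measurable (A : set (R * R)) z :
  measurable_fun A (fun w => laguerre a ((z.1 - w.1) ^+ 2 + (z.2 - w.2) ^+ 2)).
Proof.
apply: measurable_funTS; rewrite /laguerre; apply: measurable_sum => l.
apply: measurable_funM => //; apply: measurable_funM => //.
apply: measurable_funX; apply: measurableT_comp => //.
apply: measurable_funD; apply: measurable_funX; apply: measurable_funB => //.
Qed.

Lemma cmeas_Kker (A : set (R * R)) z : cmeas A (Kker a z).
Proof.
apply: cmeasM; first by apply: cmeas_real; exact: laguerre_measurable.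
have m1 : measurable_fun setT (fun w : R * R => z.1 * w.1 + z.2 * w.2).
  by apply: measurable_funD; apply: measurable_funM.
have m2 : measurable_fun setT (fun w : R * R => z.2 * w.1 - z.1 * w.2).
  by apply: measurable_funB; apply: measurable_funM.
have mc : measurable_fun setT (@cos R).
  by apply: continuous_measurable_fun; exact: continuous_cos.
have ms : measurable_fun setT (@sin R).
  by apply: continuous_measurable_fun; exact: continuous_sin.
by split; apply: measurable_funTS => /=; apply: measurable_funM; apply: measurableT_comp.
Qed.

Definition coef k g : C := cI plane D (fun w => conjc (Hf a k w) * g w * (gauss w)%:C).

Lemma cintegrable_coef k g : cintegrable plane D g ->
  cintegrable plane D (fun w => conjc (Hf a k w) * g w * (gauss w)%:C).
Proof.
move=> ig; have [M M0 hM] := Hf_bdd a k r.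
have h : cintegrable plane D (fun w => (conjc (Hf a k w) * (gauss w)%:C) * g w).
  apply: (@cintegrableM _ _ R plane D mD _ _ (M * 1)) => //.
    by apply: cmeasM; [apply: cmeas_conj; exact: cmeas_Hf|exact: cmeas_gauss].
  move=> z dz; apply: cabsM_le; last exact: cabs_gauss.
  by rewrite cabs_conj; exact: hM.
by under eq_fun do rewrite mulrAC.
Qed.

Definition Kseries N g z : C := \sum_(k < N) Hf a k z / ((a`!)%:R * (k`!)%:R) * coef k g.

Lemma KseriesE N g z : cintegrable plane D g ->
  cintegrable plane D (fun w => Hker a N z w * g w * (gauss w)%:C) /\
  Kseries N g z = cI plane D (fun w => Hker a N z w * g w * (gauss w)%:C).
Proof.
move=> ig; pose F (k : 'I_N) w :=
   Hf a k z / ((a`!)%:R * (k`!)%:R) * (conjc (Hf a k w) * g w * (gauss w)%:C).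
have iF (k : 'I_N) : cintegrable plane D (F k).
  by apply: cintegrableZ => //; exact: cintegrable_coef.
have e : (fun w => Hker a N z w * g w * (gauss w)%:C) = (fun w => \sum_(k < N) F k w).
  apply/funext => w; rewrite /Hker !mulr_suml; apply: eq_bigr => k _; rewrite /F.
  by move: (gauss w)%:C (conjc (Hf a k w)) => u v; ring.
rewrite e; split; first exact: cintegrable_sum.
rewrite (cI_sum mD iF); apply: eq_bigr => k _.
by rewrite /F cIZ//; exact: cintegrable_coef.
Qed.

Lemma cmeas_Hker N z : cmeas D (Hker a N z).
Proof.
apply: cmeas_sum => k; apply: cmeasM; last exact: cmeas_cst.
by apply: cmeasM; [exact: cmeas_cst|apply: cmeas_conj; exact: cmeas_Hf].
Qed.

Lemma cintegrable_Kker_sub N z (c : R) g :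
  (forall w, D w -> cabs (Kker a z w - Hker a N z w) <= c) -> cintegrable plane D g ->
  cintegrable plane D (fun w => (Kker a z w - Hker a N z w) * (gauss w)%:C * g w).
Proof.
move=> hc ig; apply: (@cintegrableM _ _ R plane D mD _ _ (c * 1)) => //.
  apply: cmeasM; last exact: cmeas_gauss.
  by apply: cmeasD; [exact: cmeas_Kker|apply: cmeasN; exact: cmeas_Hker].
by move=> w Dw; apply: cabsM_le; [exact: hc|exact: cabs_gauss].
Qed.

Lemma cintegrable_Kker z g : D z -> cintegrable plane D g ->
  cintegrable plane D (fun w => Kker a z w * g w * (gauss w)%:C).
Proof.
move=> Dz ig; have [N0 hN] := @Kker_expansion R a r 1 ltr01.
have i2 := cintegrable_Kker_sub (fun w Dw => hN N0 z w (leqnn _) Dz Dw) ig.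
have [i1 _] := KseriesE N0.+1 z ig.
have := cintegrableD mD i2 i1; congr cintegrable; apply/funext => w.
by move: (gauss w)%:C => u; ring.
Qed.

(** The uniform error of the kernel is integrated against [cabs g]; the factor 2 comes from the l1
    modulus. *)
Lemma Kop_cvg g : cintegrable plane D g -> forall e, 0 < e -> exists N0, forall N z,
  (N0 <= N)%N -> D z -> cabs (Kop a r g z - Kseries N.+1 g z) <= e.
Proof.
move=> ig e e0; pose A := Rintegral plane D (fun w => cabs (g w)).
have ia := cintegrable_cabs mD ig.
have A0 : 0 <= A by apply: Rintegral_ge0 => w _; exact: cabs_ge0.
have p0 : 0 < 2 * A + 1 by lra.
have [N0 hN] := @Kker_expansion R a r (e / (2 * A + 1)) ltac:(by rewrite divr_gt0).
exists N0 => N z nN Dz.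
set e' := e / (2 * A + 1).
have [i1 ->] := KseriesE N.+1 z ig.
have bd w (Dw : D w) : cabs (Kker a z w - Hker a N.+1 z w) <= e' := hN N z w nN Dz Dw.
have i2 := cintegrable_Kker_sub bd ig.
have i3 := cintegrable_Kker Dz ig.
have -> : Kop a r g z = cI plane D (fun w => Kker a z w * g w * (gauss w)%:C) by [].
rewrite -(cIB mD i3 i1).
have -> : cI plane D (fun w => Kker a z w * g w * (gauss w)%:C - Hker a N.+1 z w * g w * (gauss w)%:C) =
   cI plane D (fun w => (Kker a z w - Hker a N.+1 z w) * (gauss w)%:C * g w).
  by apply: eq_cI => w _; move: (gauss w)%:C => u; ring.
have ie : plane.-integrable D (fun w => (e' * cabs (g w))%:E).
  have := integrableZl mD e' ia; exact.
have := @cabs_cI_le _ _ R plane D mD _ _ i2 ie ltac:(by move=> w Dw; apply: cabsM_le => //; rewrite -[e']mulr1; apply: cabsM_le; [exact: bd|exact: cabs_gauss]).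
rewrite RintegralZl// -/A => h; apply: le_trans h _.
have -> : 2 * (e' * A) = 2 * A * e' by ring.
rewrite /e' mulrA ler_pdivrMr// [_ * e]mulrC ler_wpM2l ?(ltW e0)//; lra.
Qed.

Lemma cabs_small (x : C) : (forall e, 0 < e -> cabs x <= e) -> x = 0.
Proof.
move=> h; apply: cabs_eq0; apply/eqP; rewrite eq_le cabs_ge0 andbT.
by apply/ler_addgt0Pr => e e0; rewrite add0r; exact: h.
Qed.

Lemma coef_Hf k j : coef k (Hf a j) = ip a r k j.
Proof. by []. Qed.

Lemma cintegrable_Hf j : cintegrable plane D (Hf a j).
Proof.
have [M M0 hM] := Hf_bdd a j r.
by apply: (cintegrable_bdd (M := M)) => //; exact: cmeas_Hf.
Qed.

Lemma Kseries_Hf N j z : (j < N)%N -> Kseries N (Hf a j) z = (lam a j r)%:C * Hf a j z.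
Proof.
move=> jN; rewrite /Kseries (bigD1 (Ordinal jN))//= big1 ?addr0; last first.
  by move=> k kj; rewrite coef_Hf ip_orth ?mulr0.
rewrite coef_Hf ip_diag// rmorphM/= rmorphM/= !rmorph_nat.
have := factC_neq0 R a; have := factC_neq0 R j.
by move: (_ `!%:R) => f f0; move: (_ `!%:R) => f' f0'; field; rewrite f0 f0'.
Qed.

Lemma Kop_Hf j z : D z -> Kop a r (Hf a j) z = (lam a j r)%:C * Hf a j z.
Proof.
move=> Dz; apply/eqP; rewrite -subr_eq0; apply/eqP; apply: cabs_small => e e0.
have [N0 h] := Kop_cvg (cintegrable_Hf j) e0.
rewrite -(@Kseries_Hf (maxn N0 j).+1 j z) ?ltnS ?leq_maxr//.
by apply: h => //; exact: leq_maxl.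
Qed.

Lemma inL2_Hf j : inL2 r (Hf a j).
Proof.
have [m1 m2] := cmeas_Hf D a j; split => //.
have [M M0 hM] := Hf_bdd a j r.
apply: (@le_bounded_integrable _ _ R plane D
   (fun w => (complex.Re (Hf a j w) ^+ 2 + complex.Im (Hf a j w) ^+ 2) * gauss w) ((M ^+ 2 + M ^+ 2) * 1)) => //.
- exact: disk_fin.
- apply: measurable_funM; last exact: measurable_gauss.
  by apply: measurable_funD; apply: measurable_funX.
- move=> w Dw; rewrite normrM; apply: ler_pM => //; last by rewrite ger0_norm ?gauss_ge0// gauss_le1.
  rewrite ger0_norm ?addr_ge0 ?sqr_ge0//; apply: lerD.
    rewrite -(real_normK (num_real (complex.Re _))); apply: lerXn2r; rewrite ?nnegrE//.
    by apply: le_trans (hM w Dw); exact: normRe_le.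
  rewrite -(real_normK (num_real (complex.Im _))); apply: lerXn2r; rewrite ?nnegrE//.
  by apply: le_trans (hM w Dw); exact: normIm_le.
Qed.

Lemma eigenfun_Hf j : eigenfun a r (lam a j r) (Hf a j).
Proof. by split; [exact: inL2_Hf|apply: aeW => z; exact: Kop_Hf]. Qed.

(** Pairing the relation with the i-th function isolates c_i times its squared norm a! k! lam, and
    lam > 0. *)
Lemma L2_indep_Hf n (ks : 'I_n -> nat) : injective ks ->
  (forall i, 0 < lam a (ks i) r) -> L2_indep r (fun i => Hf a (ks i)).
Proof.
move=> inj pos c h i.
pose F (j : 'I_n) w := c j * (conjc (Hf a (ks i) w) * Hf a (ks j) w * (gauss w)%:C).
have iF (j : 'I_n) : cintegrable plane D (F j).
  by apply: cintegrableZ => //; exact: cintegrable_ip.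
have z0 : cI plane D (fun w => \sum_(j < n) F j w) = 0.
  apply: (cI_ae0 mD); first exact: cintegrable_sum.
  apply: (@ae_mono _ _ R plane _ _ h) => z {}h Dz.
  transitivity (conjc (Hf a (ks i) z) * (gauss z)%:C * \sum_(j < n) c j * Hf a (ks j) z).
    rewrite mulr_sumr; apply: eq_bigr => j _; rewrite /F.
    by move: (gauss z)%:C (conjc _) => u v; ring.
  by rewrite h// mulr0.
move: z0; rewrite (cI_sum mD iF) (bigD1 i)//= big1 ?addr0; last first.
  move=> j ji; rewrite /F cIZ//; last exact: cintegrable_ip.
  rewrite -/(ip a r (ks i) (ks j)) ip_orth ?mulr0//.
  by apply: contra ji => /eqP/inj ->.
rewrite /F cIZ//; last exact: cintegrable_ip.
rewrite -/(ip a r (ks i) (ks i)) ip_diag// => /eqP; rewrite mulf_eq0 => /orP[/eqP//|].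
rewrite eq_complex/= eqxx andbT !mulf_eq0 !(negbTE (fact_neq0 R _))/=.
by rewrite gt_eqF.
Qed.

(** The pairing of H_j with l g minus the partial series equals (l - lam_j) coef_j by orthogonality
    as soon as the series reaches j, and it tends to 0 by [Kop_cvg]. This is the orthogonality of
    eigenspaces in concrete form. *)
Lemma eigenfun_coef l g j : eigenfun a r l g -> lam a j r != l -> coef j g = 0.
Proof.
move=> [hg hl] jl; have ig := inL2_cintegrable hg.
suff : (l%:C - (lam a j r)%:C) * coef j g = 0.
  move=> /eqP; rewrite mulf_eq0 => /orP[|/eqP//].
  by rewrite subr_eq0 eq_complex/= eqxx andbT eq_sym (negbTE jl).
apply: cabs_small => e e0.
have [M M0 hM] := Hf_bdd a j r.
pose v := fine (plane D).
have v0 : 0 <= v by exact: fine_ge0.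
have p0 : 0 < 2 * (M * v) + 1 by have := mulr_ge0 M0 v0; lra.
set e' := e / (2 * (M * v) + 1).
have e'0 : 0 < e' by rewrite divr_gt0.
have [N0 hN] := Kop_cvg ig e'0.
pose N := maxn N0 j.
pose F w := conjc (Hf a j w) * (l%:C * g w - Kseries N.+1 g w) * (gauss w)%:C.
pose G (k : 'I_N.+1) w := coef k g / ((a`!)%:R * (k`!)%:R) * (conjc (Hf a j w) * Hf a k w * (gauss w)%:C).
have iG (k : 'I_N.+1) : cintegrable plane D (G k).
  by apply: cintegrableZ => //; exact: cintegrable_ip.
have i1 : cintegrable plane D (fun w => l%:C * (conjc (Hf a j w) * g w * (gauss w)%:C)).
  by apply: cintegrableZ => //; exact: cintegrable_coef.
have i2 := cintegrable_sum mD iG.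
have eF : F = fun w => l%:C * (conjc (Hf a j w) * g w * (gauss w)%:C) - \sum_(k < N.+1) G k w.
  apply/funext => w; rewrite /F /Kseries mulrBr mulrBl; congr (_ - _).
    by move: (gauss w)%:C (conjc _) => x y; ring.
  rewrite mulr_sumr mulr_suml; apply: eq_bigr => k _; rewrite /G.
  by move: (gauss w)%:C (conjc _) => x y; ring.
have iF : cintegrable plane D F.
  rewrite eF; have := cintegrableD mD i1 (cintegrableN mD i2); exact.
have IF : cI plane D F = (l%:C - (lam a j r)%:C) * coef j g.
  rewrite eF (cIB mD i1 i2) cIZ//; last exact: cintegrable_coef.
  rewrite mulrBl; congr (_ - _).
  rewrite (cI_sum mD iG).
  have jN : (j < N.+1)%N by rewrite ltnS leq_maxr.
  rewrite (bigD1 (Ordinal jN))//= big1 ?addr0; last first.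
    move=> k kj; rewrite /G cIZ//; last exact: cintegrable_ip.
    rewrite -/(ip a r j k) ip_orth ?mulr0//.
    by apply: contra kj => /eqP jk; apply/eqP/val_inj.
  rewrite /G cIZ//=; last exact: cintegrable_ip.
  rewrite -/(ip a r j j) ip_diag// rmorphM/= rmorphM/= !rmorph_nat.
  have := factC_neq0 R a; have := factC_neq0 R j.
  by move: (_ `!%:R) => f f0; move: (_ `!%:R) => f' f0'; field; rewrite f0 f0'.
rewrite -IF.
have ic := integrable_cst_disk r (M * e' * 1).
have c0 : 0 <= M * e' * 1 by rewrite mulr1 mulr_ge0// ltW.
have h := @cabs_cI_ae_le _ _ R plane D mD F (fun=> M * e' * 1) iF ic ltac:(by []).
apply: le_trans (h _) _.
  apply: (@ae_mono _ _ R plane _ _ hl) => z hz Dz; apply: cabsM_le; last exact: cabs_gauss.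
  apply: cabsM_le; first by rewrite cabs_conj; exact: hM.
  by rewrite -hz//; apply: hN => //; exact: leq_maxl.
rewrite Rintegral_cst// -/v mulr1.
have -> : 2 * (M * e' * v) = 2 * (M * v) * e' by ring.
rewrite /e' mulrA ler_pdivrMr// [_ * e]mulrC ler_wpM2l ?(ltW e0)//; lra.
Qed.

Lemma Kop_sum n (c : 'I_n -> C) (gs : 'I_n -> R * R -> C) z :
  (forall i, cintegrable plane D (gs i)) -> D z ->
  Kop a r (fun w => \sum_(i < n) c i * gs i w) z = \sum_(i < n) c i * Kop a r (gs i) z.
Proof.
move=> ig Dz.
pose F (i : 'I_n) w := c i * (Kker a z w * gs i w * (gauss w)%:C).
have iF i : cintegrable plane D (F i).
  by apply: cintegrableZ => //; exact: cintegrable_Kker.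
transitivity (cI plane D (fun w => \sum_(i < n) F i w)).
  apply: eq_cI => w _; rewrite mulr_sumr mulr_suml; apply: eq_bigr => i _; rewrite /F.
  by move: (gauss w)%:C => u; ring.
rewrite (cI_sum mD iF); apply: eq_bigr => i _.
by rewrite /F cIZ//; exact: cintegrable_Kker.
Qed.

End Eigenfunctions.

From mathcomp Require Import finmap.


(** * Multiplicities as numbers of indices, and the trace as a series *)

Section Multiplicity.
Local Open Scope complex_scope.
Variables (R : realType) (a : nat) (r : R).
Hypothesis r0 : 0 < r.
Local Notation C := R[i].
Local Notation mu := (@lebesgue_measure R).
Local Notation plane := (mu \x mu)%E.
Local Notation D := (disk r).
Implicit Types (k n : nat) (l : R).

Let mD := (fun d (T : measurableType d) (m : {measure set T -> \bar R}) (A : set T)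
  (h : measurable A) => h) _ _ plane D (measurable_disk r).

(** If n > m, a kernel vector of the coefficient matrix yields a combination G all of whose
    coefficients vanish: those with lam_k = l by choice, the others by [eigenfun_coef]. Then K G =
    0, but also K G = l G almost everywhere, so G = 0, against independence. *)
Lemma eigenfun_dim l n m (gs : 'I_n -> R * R -> C) (ks : 'I_m -> nat) : 0 < l ->
  (forall k, lam a k r = l -> exists j, ks j = k) ->
  (forall i, eigenfun a r l (gs i)) -> L2_indep r gs -> (n <= m)%N.
Proof.
move=> l0 hks heig hind; rewrite leqNgt; apply/negP => mn.
have ig i : cintegrable plane D (gs i) by apply: inL2_cintegrable; case: (heig i).
pose M := \matrix_(i < n, j < m) coef a r (ks j) (gs i).
have kn0 : kermx M != 0.
  by rewrite kermx_eq0 /row_free neq_ltn (leq_ltn_trans (rank_leq_col M) mn).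
have /rowV0Pn[v /sub_kermxP vM vn0] := kn0.
pose G w := \sum_(i < n) v 0 i * gs i w.
have iG : cintegrable plane D G.
  by apply: cintegrable_sum => // i; apply: cintegrableZ.
have cG k : coef a r k G = 0.
  have -> : coef a r k G = \sum_(i < n) v 0 i * coef a r k (gs i).
    pose F (i : 'I_n) w := v 0 i * (conjc (Hf a k w) * gs i w * (gauss w)%:C).
    have iF i : cintegrable plane D (F i).
      by apply: cintegrableZ => //; exact: cintegrable_coef.
    transitivity (cI plane D (fun w => \sum_(i < n) F i w)).
      apply: eq_cI => w _; rewrite mulr_sumr mulr_suml; apply: eq_bigr => i _; rewrite /F.
      by move: (gauss w)%:C (conjc _) => u y; ring.
    rewrite (cI_sum mD iF); apply: eq_bigr => i _.
    by rewrite /F cIZ//; exact: cintegrable_coef.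
  have [kl|kl] := eqVneq (lam a k r) l; last first.
    by rewrite big1// => i _; rewrite (eigenfun_coef r0 (heig i) kl) mulr0.
  have [j <-] := hks k kl.
  have e := congr1 (fun A : 'rV_m => A 0 j) vM; rewrite !mxE in e; rewrite -[RHS]e.
  by apply: eq_bigr => i _; rewrite mxE.
have KG z : D z -> Kop a r G z = 0.
  move=> Dz; apply: cabs_small => e e0.
  have [N0 h] := Kop_cvg a iG e0.
  have := h N0 z (leqnn _) Dz; rewrite /Kseries big1 ?subr0// => k _.
  by rewrite cG mulr0.
have G0 : {ae plane, forall z, D z -> \sum_(i < n) v 0 i * gs i z = 0}.
  have hae : {ae plane, forall z, forall i, D z -> Kop a r (gs i) z = l%:C * gs i z}.
    by apply: (@ae_forall _ _ R plane) => i; case: (heig i).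
  apply: (@ae_mono _ _ R plane _ _ hae) => z hz Dz.
  have : l%:C * G z = 0.
    rewrite -(KG z Dz) /G Kop_sum// mulr_sumr; apply: eq_bigr => i _.
    by rewrite hz// mulrCA.
  move/eqP; rewrite mulf_eq0 => /orP[|/eqP//].
  by rewrite eq_complex/= eqxx andbT gt_eqF.
move/eqP: vn0; apply; apply/rowP => i; rewrite mxE.
exact: hind G0 i.
Qed.

Lemma mult_ge l n (ks : 'I_n -> nat) : 0 < l -> injective ks ->
  (forall i, lam a (ks i) r = l) -> (n%:R%:E <= mult a r l)%E.
Proof.
move=> l0 inj hk; apply: ereal_sup_ubound; exists n => //.
exists (fun i => Hf a (ks i)); split.
  by move=> i; rewrite -(hk i); exact: eigenfun_Hf.
by apply: L2_indep_Hf => // i; rewrite hk.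
Qed.

Lemma fsbig_card (A : set nat) : finite_set A ->
  (\sum_(k \in A) (1 : R)%:E)%E = ((size (enum_fset (fset_set A)))%:R)%:E.
Proof.
move=> fA; rewrite fsbig_finite//= sumEFin; congr EFin.
by rewrite big_const_seq count_predT iter_addr addr0.
Qed.

(** If finitely many indices share the eigenvalue, [eigenfun_dim] bounds the multiplicity by their
    number; if infinitely many do, the counting sum exceeds every integer. The other inequality
    tests on finite sets of Hermite functions. *)
Lemma mult_esum l : 0 < l -> mult a r l = (\esum_(k in [set k | lam a k r = l]) (1 : R)%:E)%E.
Proof.
move=> l0; apply/eqP; rewrite eq_le; apply/andP; split.
  apply: ge_ereal_sup => _ [n [gs [hg hi]] <-].
  have [fJ|iJ] := pselect (finite_set [set k | lam a k r = l]); last first.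
    have [B BJ nB] := infinite_set_fset n iJ.
    apply: esum_ge; exists [set` B]; first by split => //; exact: finite_fset.
    by rewrite fsbig_card ?set_fsetK ?lee_fin ?ler_nat//; exact: finite_fset.
  rewrite esum_fset// fsbig_card// lee_fin ler_nat.
  set F := fset_set _.
  apply: (@eigenfun_dim l n (size (enum_fset F)) gs (fun i => nth 0%N (enum_fset F) i)) => // k kl.
  have kF : k \in F by rewrite in_fset_set//; exact: mem_set.
  have iF : (index k (enum_fset F) < (size (enum_fset F)))%N by rewrite index_mem.
  by exists (Ordinal iF); rewrite /= nth_index.
apply: ge_ereal_sup => _ [A [fA AJ] <-]; rewrite fsbig_card//.
set F := fset_set A.
apply: (@mult_ge l _ (fun i : 'I_(size (enum_fset F)) => nth 0%N (enum_fset F) i)) => //.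
  move=> i j /eqP; by rewrite nth_uniq ?fset_uniq// => /eqP/val_inj.
move=> i; apply: AJ; have : nth 0%N (enum_fset F) i \in F by rewrite mem_nth.
by rewrite in_fset_set// => /set_mem.
Qed.

Lemma esum_cst (P : pred nat) (c : R) : 0 <= c ->
  (\esum_(k in [set k | P k]) c%:E = (\esum_(k in [set k | P k]) (1 : R)%:E) * c%:E)%E.
Proof.
move=> c0; rewrite -!nneseries_esum//.
rewrite muleC -nneseriesZl//.
by apply: eq_eseriesr => k _; rewrite mule1.
Qed.

(** The indices are fibred over the value of [lam]. Those with [lam] = 0 do not occur in the sum
    over eigenvalues, and contribute f(0) = 0 to the series. *)
Lemma S_Ssum (b : R) : 1 / 2 < b -> S a b r = Ssum a b r.
Proof.
move=> hb; have [C _ hC] := fbeta_le hb.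
have fb0 x : 0 <= x <= 1 -> 0 <= fbeta b x by move=> /hC/andP[].
have f0 k : 0 <= fbeta b (lam a k r) by apply: fb0; exact: lam_range.
rewrite /S /Ssum nneseries_esumT; last by move=> k; rewrite lee_fin.
transitivity (\esum_(l in [set x : R | 0 < x <= 1]%R)
    \esum_(k in [set k | lam a k r = l]) (fbeta b l)%:E)%E.
  apply: eq_esum => l /= /andP[l0 l1]; rewrite mult_esum//.
  have -> : [set k | lam a k r = l] = [set k | lam a k r == l].
    by apply/seteqP; split => k /= /eqP.
  by rewrite [RHS]esum_cst// fb0// l1 ltW.
rewrite esum_esum; last first.
  by move=> l k /= /andP[l0 l1] _; rewrite lee_fin fb0// l1 ltW.
rewrite (@reindex_esum _ _ _ [set k | 0 < lam a k r] _ (fun k => (lam a k r, k))); last first.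
  split.
  - by move=> k /= k0; rewrite /= k0; have /andP[_ ->] := lam_range a k r0.
  - by move=> k k' _ _ [].
  - move=> [l k] /= [/andP[l0 l1] e]; exists k; rewrite /= e//.
rewrite /= esum_mkcond; apply: eq_esum => k _.
case: ifPn => //; rewrite notin_setE/= => /negP; rewrite -leNgt => h.
have -> : lam a k r = 0.
  by apply/eqP; rewrite eq_le h/=; have /andP[] := lam_range a k r0.
by rewrite fbeta0.
Qed.

End Multiplicity.

(** Integrability and eventual finiteness are part of the claim, so that [Rintegral] and [fine]
    denote the actual integral and trace and not default values. *)
Theorem theorem2p6 (R : realType) (a : nat) (b : R) (hb : 1 / 2 < b) :
  (@lebesgue_measure R).-integrable setT (fun x => (fbeta b (Phi a x))%:E) /\
  (\forall r \near +oo, S a b r \is a fin_num) /\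
  (fine (S a b r) - r * Rintegral lebesgue_measure setT (fun x => fbeta b (Phi a x)))
     @[r --> +oo] --> (0 : R).
Proof.
split; first exact: integrable_prof.
have [h1 h2] := Ssum_asymptotics hb (fun k r => @lam_range R a k r).
split.
  near=> r; have rp : 0 < r by near: r; apply: nbhs_pinfty_gt; rewrite num_real.
  by rewrite S_Ssum//; near: r.
apply: cvg_trans h2; apply: near_eq_cvg; near=> r.
have rp : 0 < r by near: r; apply: nbhs_pinfty_gt; rewrite num_real.
by rewrite S_Ssum.
Unshelve. all: by end_near. Qed.
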